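(* Let $\lambda,\mu\in C^\infty(\mathbb R^2,\mathbb R)$ and $c>0$ satisfy $\mu(u,v)\le -c<0<c\le\lambda(u,v)$ for all $(u,v)\in\mathbb R^2$, and let $(K,\gamma)\in(0,+\infty)\times(0,1)$. Let $\overline{C_1}>0$, $T_h>0$, and let $h\in C^1([-\overline{C_1},\overline{C_1}]\times\mathbb R^+)\cap W^{1,\infty}((-\overline{C_1},\overline{C_1})\times(0,+\infty))$, $h=h(v,t)$, be such that $h(0,t)=0$ for all $t\ge T_h$. Let $C_1\in(0,\overline{C_1}]$ and $C_2>0$, and let $T, C_1',D_1,D_2,M_1,M_2,C_3,C_3',C_3''$ and $\mathcal D$ be defined from these data as in the context (with $M_2>0$). Assume that $C_1$, $C_2$ and $D_2$ are such that $$C_3'\le C_3\qquad\text{and}\qquad C_3''\le C_3 .$$ Then for any pair $(u_0,v_0)\in\mathrm{Lip}([0,1])^2$ with $\max(\|u_0\|_\infty,\|v_0\|_\infty)\le C_1$, $\max(\|u_0'\|_\infty,\|v_0'\|_\infty)\le C_2$ and $u_0(0)=h(v_0(0),0)$, there exists a unique solution $(u,v)$ in the class $\mathcal D$ of the system $$\partial_t u+\lambda(u,v)\partial_x u=0,\qquad \partial_t v+\mu(u,v)\partial_x v=0,$$ $$u(t,0)=h(v(t,0),t),\qquad u(0,x)=u_0(x),$$ $$v(t,1)=v_r(t),\qquad v(0,x)=v_0(x),$$ where $v_r$ solves $$\frac{d}{dt}v_r(t)=-K\,\mathrm{sgn}(v_r(t))|v_r(t)|^\gamma,\qquad v_r(0)=v_0(1).$$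 Furthermore, the solution is global in time (it extends to a solution on $[0,+\infty)\times[0,1]$), with $u(t,\cdot)=v(t,\cdot)=0$ for $t\ge T$. Finally, if $h=h(v)$ (i.e. $h$ does not depend on $t$), then the equilibrium state $(0,0)$ is stable in $\mathrm{Lip}([0,1])^2$ for this system; that is, $$\|(u,v)\|_{L^\infty(\mathbb R^+;\mathrm{Lip}([0,1])^2)}\to0\quad\text{as}\quad\|(u_0,v_0)\|_{\mathrm{Lip}([0,1])^2}\to0.$$
   Context: $\mathrm{Lip}([0,1])=W^{1,\infty}(0,1)$ is the space of Lipschitz continuous functions on $[0,1]$, with norm $\|u\|_{\mathrm{Lip}([0,1])}=\|u\|_\infty+\|u'\|_\infty$; similarly for $\mathrm{Lip}([0,T]\times[0,1])$. A function $u$ on $[0,T]\times[0,1]$ is $M$-Lipschitz if $|u(t_1,x_1)-u(t_2,x_2)|\le M(|t_1-t_2|+|x_1-x_2|)$. Constants: $$T=\frac1c+\max\Big(T_h,\frac1c+\frac{C_1^{1-\gamma}}{(1-\gamma)K}\Big),$$ $$C_1'=\max\big(C_1,\|h\|_{L^\infty((-C_1,C_1)\times(0,+\infty))}\big),$$ $$D_1=\|\partial_v h\|_{L^\infty((-C_1,C_1)\times(0,+\infty))},\qquad D_2=\|\partial_t h\|_{L^\infty((-C_1,C_1)\times(0,+\infty))}.$$ With $R=[-C_1',C_1']\times[-C_1,C_1]$, $$M_1=\max\big(\|\lambda\|_{C^0(R)},\|\mu\|_{C^0(R)}\big),$$ $$M_2=\max\big(\|\partial_u\mu\|_{C^0(R)},\|\partial_v\mu\|_{C^0(R)},\|\partial_u\lambda\|_{C^0(R)},\|\partial_v\lambda\|_{C^0(R)}\big),$$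 $$C_3=\max\Big(\frac1{2TM_2},C_2\Big),$$ $$C_3'=\max\Big(\frac{KC_1^\gamma}{c},C_2\Big)\max(1,M_1)\exp(2TM_2C_3),$$ $$C_3''=\max\Big(\frac1c(D_1C_3'+D_2),C_2\Big)\max(1,M_1)\exp(2TM_2C_3).$$ $\mathcal D$ is the set of $(u,v)\in\mathrm{Lip}([0,T]\times[0,1])^2$ such that $\|u\|_{C^0([0,T]\times[0,1])}\le C_1'$, $\|v\|_{C^0([0,T]\times[0,1])}\le C_1$, $u$ is $C_3$-Lipschitz and $v$ is $C_3'$-Lipschitz. By a solution of the system is meant a pair $(u,v)$ of Lipschitz functions such that the two partial differential equations hold in the distributional sense (on $(0,T)\times(0,1)$, resp. on $(0,+\infty)\times(0,1)$ for global solutions) and the boundary and initial conditions hold pointwise. *)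

(* Defs.v *)
From HB Require Import structures.
From mathcomp Require Import all_boot all_order all_algebra.
From mathcomp Require Import all_classical all_reals all_analysis.

Set Implicit Arguments.
Unset Strict Implicit.
Unset Printing Implicit Defensive.

Import Order.TTheory GRing.Theory Num.Theory.
Import numFieldNormedType.Exports.

Local Open Scope classical_set_scope.
Local Open Scope ring_scope.

(* Functions of two variables are maps on R * R. For u, v and test functions the
   variables are (t, x); for h they are (v, t); for lambda and mu they are
   (u, v). A function on a subset of R or R * R is a total function of which
   only the values on that subset are used. *)

Definition d1 (R : realType) (f : R * R -> R) : R * R -> R :=
  fun z => 'D_((1, 0) : R * R) f z.

Definition d2 (R : realType) (f : R * R -> R) : R * R -> R :=
  fun z => 'D_((0, 1) : R * R) f z.

Definition has_partials (R : realType) (A : set (R * R)) (f : R * R -> R) :=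
  forall z, A z -> derivable f z (1, 0) /\ derivable f z (0, 1).

Fixpoint Ck (R : realType) (k : nat) (f : R * R -> R) : Prop :=
  continuous f /\
  if k is k'.+1 then [/\ has_partials setT f, Ck k' (d1 f) & Ck k' (d2 f)]
  else True.

Definition Csmooth (R : realType) (f : R * R -> R) := forall k, Ck k f.

(* C^1 up to the boundary: the partial derivatives on the interior of A extend
   continuously to A. *)
Definition C1_upto (R : realType) (A : set (R * R)) (f : R * R -> R) :=
  [/\ {within A, continuous f}, has_partials (A°) f &
      exists g1 g2 : R * R -> R,
        [/\ {within A, continuous g1}, {within A, continuous g2} &
            forall z, (A°) z -> g1 z = d1 f z /\ g2 z = d2 f z]].

Definition leb1 (R : realType) : {measure set (measurableTypeR R) -> \bar R} :=
  @lebesgue_measure R.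

Definition leb2 (R : realType) :
    {measure set (measurableTypeR R * measurableTypeR R) -> \bar R} :=
  (@lebesgue_measure R \x @lebesgue_measure R)%E.

(* L^infty norm over D, the function being extended by 0 outside D. *)
Definition Loo1 (R : realType) (D : set R) (f : R -> \bar R) : \bar R :=
  ('N[@leb1 R]_+oo [patch (cst 0) D f])%E.

Definition Loo2 (R : realType) (D : set (R * R)) (f : R * R -> R) : \bar R :=
  ('N[@leb2 R]_+oo [EFin \o patch (cst 0%R) D f])%E.

(* Membership in W^{1,oo}(D) of a function that is C^1 in the open set D, whose
   weak partial derivatives are the classical ones. *)
Definition W1oo (R : realType) (D : set (R * R)) (f : R * R -> R) :=
  [/\ (Loo2 D f < +oo)%E, (Loo2 D (d1 f) < +oo)%E & (Loo2 D (d2 f) < +oo)%E].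

(* Used only for functions that are bounded on A. *)
Definition C0norm (R : realType) (A : set (R * R)) (f : R * R -> R) : R :=
  sup [set `|f z| | z in A].

Definition sup01 (R : realType) (f : R -> R) : \bar R :=
  Loo1 `]0, 1[ (EFin \o f).

(* A Lipschitz function is differentiable almost everywhere and its weak
   derivative is the class of its classical one; derive1 f takes junk values only
   on a null set. *)
Definition dsup01 (R : realType) (f : R -> R) : \bar R := sup01 (derive1 f).

Definition Lip01 (R : realType) (f : R -> R) := [lipschitz f x | x in `[0, 1]].

Definition Lip01_norm (R : realType) (f : R -> R) : \bar R :=
  (sup01 f + dsup01 f)%E.

Definition Lip01_norm2 (R : realType) (f g : R -> R) : \bar R :=
  (Lip01_norm f + Lip01_norm g)%E.

(* Norm of (u, v) in L^oo(R^+; Lip([0,1])^2). *)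
Definition LooLip_norm2 (R : realType) (u v : R * R -> R) : \bar R :=
  Loo1 `]0, +oo[
    (fun t => Lip01_norm2 (fun x => u (t, x)) (fun x => v (t, x))).

(* [0,b] x [0,1] if b is finite, and [0,+oo) x [0,1] if b = +oo. *)
Definition cyl (R : realType) (b : \bar R) : set (R * R) :=
  [set z | [/\ 0 <= z.1, (z.1%:E <= b)%E & 0 <= z.2 <= 1]].

Definition ocyl (R : realType) (b : \bar R) : set (R * R) :=
  [set z | [/\ 0 < z.1, (z.1%:E < b)%E & 0 < z.2 < 1]].

(* Unlike the library's M.-lipschitz_A u, which uses the sup norm on R * R,
   this is the Lipschitz condition for the l^1 norm. *)
Definition Lip2 (R : realType) (M : R) (A : set (R * R)) (u : R * R -> R) :=
  forall z1 z2, A z1 -> A z2 ->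
    `|u z1 - u z2| <= M * (`|z1.1 - z2.1| + `|z1.2 - z2.2|).

Definition test_fun (R : realType) (D : set (R * R)) (phi : R * R -> R) :=
  [/\ Csmooth phi, compact (closure [set z | phi z != 0]) &
      closure [set z | phi z != 0] `<=` D].

(* p is the distributional derivative of u in its second variable, as an
   element of L^oo(D). *)
Definition weak_dx (R : realType) (D : set (R * R)) (u p : R * R -> R) :=
  [/\ measurable_fun (D : set (measurableTypeR R * measurableTypeR R)) p,
      (Loo2 D p < +oo)%E &
      forall phi, test_fun D phi ->
        \int[@leb2 R]_(z in D) (u z * d2 phi z) =
        - \int[@leb2 R]_(z in D) (p z * phi z)].

(* u_t + a u_x = 0 in the distributions on D, where a u_x is the product of the
   function a with the essentially bounded function u_x. *)
Definition transport_distr (R : realType) (D : set (R * R))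
    (a u : R * R -> R) :=
  exists p, weak_dx D u p /\
    forall phi, test_fun D phi ->
      - (\int[@leb2 R]_(z in D) (u z * d1 phi z)) +
        (\int[@leb2 R]_(z in D) (a z * p z * phi z)) = 0.

Definition boundary_ode (R : realType) (K gamma : R) (a : R) (vr : R -> R) :=
  [/\ {within `[0, +oo[, continuous vr}, vr 0 = a &
      forall t : R, 0 < t ->
        is_derive t 1 vr (- K * Num.sg (vr t) * `|vr t| `^ gamma)].

(* Solution on the time interval [0,b], or [0,+oo) if b = +oo. *)
Definition is_solution (R : realType) (lam mu : R * R -> R) (K gamma : R)
    (h : R * R -> R) (b : \bar R) (u0 v0 : R -> R) (u v : R * R -> R) :=
  [/\ (exists M, Lip2 M (cyl b) u /\ Lip2 M (cyl b) v),
      transport_distr (ocyl b) (fun z => lam (u z, v z)) u /\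
      transport_distr (ocyl b) (fun z => mu (u z, v z)) v,
      (forall t : R, 0 <= t -> (t%:E <= b)%E ->
         u (t, 0) = h (v (t, 0), t)),
      (exists vr, boundary_ode K gamma (v0 1) vr /\
         forall t : R, 0 <= t -> (t%:E <= b)%E -> v (t, 1) = vr t) &
      (forall x : R, 0 <= x <= 1 -> u (0, x) = u0 x /\ v (0, x) = v0 x)].

Definition class_D (R : realType) (T C1 C1' C3 C3' : R) (u v : R * R -> R) :=
  [/\ C0norm (cyl T%:E) u <= C1', C0norm (cyl T%:E) v <= C1,
      Lip2 C3 (cyl T%:E) u & Lip2 C3' (cyl T%:E) v].

Definition admissible (R : realType) (h : R * R -> R) (C1 C2 : R)
    (u0 v0 : R -> R) :=
  [/\ Lip01 u0, Lip01 v0,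
      (Order.max (sup01 u0) (sup01 v0) <= C1%:E)%E,
      (Order.max (dsup01 u0) (dsup01 v0) <= C2%:E)%E &
      u0 0 = h (v0 0, 0)].

Definition vanishes_from (R : realType) (T : R) (u v : R * R -> R) :=
  forall t x : R, T <= t -> 0 <= x <= 1 -> u (t, x) = 0 /\ v (t, x) = 0.

(* Main.v *)
Require Import Defs.
From HB Require Import structures.
From mathcomp Require Import all_boot all_order all_algebra.
From mathcomp Require Import all_classical all_reals all_analysis.
From mathcomp Require Import measurable_realfun ess_sup_inf.
From mathcomp Require Import ring lra.

Set Implicit Arguments.
Unset Strict Implicit.
Unset Printing Implicit Defensive.

Import Order.TTheory GRing.Theory Num.Theory.
Import numFieldNormedType.Exports.

Local Open Scope classical_set_scope.
Local Open Scope ring_scope.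

(** Each component of a solution is constant along the characteristics of its own
    speed. This is used in the following form, called [transported] below: over a
    backward step of length [e], [w (t, x)] and [w (t - e, x - e * a (t, x))] differ
    by [O(e^2)]. For Lipschitz functions the relation is equivalent to the equation
    in the sense of distributions ([weak_transported], [transported_weak]), it passes
    to limits, and it allows a maximum principle: at a positive maximum of the
    difference of two transported functions, one would gain by stepping back along
    a characteristic ([transport_compare], [transport_extinct]). The component that
    moves to the left is reflected in space, so that all speeds are positive.

    Local existence is a fixed point argument in the class of the theorem. Freeze the
    speeds along a pair of that class; they are then Lipschitz of constant
    [L = 2 * M2 * C3]. The linear equation is solved by composing the data with the
    foot of the backward characteristic ([flow_exists], [linear_transport]). The foot
    is Lipschitz of constant [expR (L * T)] in space, and a datum of slope [G] on the
    boundary has slope [G / c] as a function of the foot, because the boundary is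
    crossed at speed at least [c]. The solution is therefore Lipschitz of constant
    [max (G / c) C2 * max 1 M1 * expR (L * T)]. With [G] the slope of the feedback
    [v_r] this is [C3'], and with [G] the slope of the trace [h (v (t, 0), t)] it is
    [C3'']; so the hypotheses [C3' <= C3] and [C3'' <= C3] say that the class is
    preserved ([frozen_exists]). By the comparison principle the map halves distances
    in the sup norm weighted by [expR (th * t)] for a suitable [th]
    ([frozen_contract]), which gives existence and uniqueness.

    Extinction follows the information: [v_r] vanishes after a finite time because
    [|v_r| ^ (1 - gamma)] decreases at constant speed, [v] vanishes [1 / c] later,
    then so does [u (t, 0) = h (0, t)] once [t >= Th], and [u] after another [1 / c]
    ([nonlinear_extinct]). From then on the solution is continued by zero.

    For stability, a given solution of the class also solves a linear problem whose
    speeds have Lipschitz constants under control, and the estimates for that problem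
    are homogeneous in the data. Data of size [d] give [|v_r| <= d] with slope at most
    [K * d ^ gamma], and all the bounds tend to zero with [d] ([small_solution],
    [small_choice]).

    The equivalence with the distributional equation rests on the almost everywhere
    differentiability of Lipschitz functions and the fundamental theorem of calculus
    for them ([lipschitz_FTC]) in one direction, and on testing the equation against
    a mollifier that moves along a straight line ([weak_transport_at]) in the other. *)

(** * Limits, extensions and a maximum principle *)

Lemma le_half_pow (R : realType) (C e : R) : 0 < e ->
  exists n, C * 2^-1 ^+ n <= e.
Proof.
move=> e0; have [C0|C0] := leP C 0.
  by exists 0%N; rewrite expr0 mulr1 (le_trans C0)// ltW.
exists (Num.bound (C / e)).
have h : C / e < 2 ^+ Num.bound (C / e).
  rewrite (lt_trans (archi_boundP _)) ?divr_ge0 ?(ltW e0) ?(ltW C0)//.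
  by rewrite -natrX ltr_nat ltn_expl.
rewrite exprVn ler_pdivrMr ?exprn_gt0// mulrC -ler_pdivrMr//.
exact: ltW.
Qed.

(** Errors along dyadic sequences are removed by this lemma instead of limits. *)
Lemma le_of_half_pow (R : realType) (x y C : R) :
  (forall n, x <= y + C * 2^-1 ^+ n) -> x <= y.
Proof.
move=> h; apply/ler_addgt0Pr => e e0.
have [n hn] := le_half_pow C e0.
by rewrite (le_trans (h n))// lerD2l.
Qed.

(** Cutting [s, t] into [2 ^ n] equal pieces divides the total quadratic error by
    [2 ^ n], so only the linear part of the bound survives. *)
Lemma lip_of_quadratic (R : realType) (f : R -> R) (a b M C : R) :
  (forall s t : R, a <= s -> s <= t -> t <= b ->
     f t - f s <= M * (t - s) + C * (t - s) ^+ 2) ->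
  forall s t : R, a <= s -> s <= t -> t <= b -> f t - f s <= M * (t - s).
Proof.
move=> hf.
have hn n s t : a <= s -> s <= t -> t <= b ->
    f t - f s <= M * (t - s) + (C * (t - s) ^+ 2) * 2^-1 ^+ n.
  move: s t; elim: n => [|n IH] s t as_ st tb.
    by rewrite expr0 mulr1; exact: hf.
  set m := (s + t) / 2.
  have h1 := IH s m as_ ltac:(rewrite /m; lra) ltac:(rewrite /m; lra).
  have h2 := IH m t ltac:(rewrite /m; lra) ltac:(rewrite /m; lra) tb.
  have e1 : m - s = (t - s) / 2 by rewrite /m; field.
  have e2 : t - m = (t - s) / 2 by rewrite /m; field.
  rewrite e1 in h1; rewrite e2 in h2.
  have -> : f t - f s = (f t - f m) + (f m - f s) by ring.
  apply: (le_trans (lerD h2 h1)); rewrite (exprS _ n) le_eqVlt; apply/orP; left.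
  by apply/eqP; move: (2^-1 ^+ n) => p; field.
by move=> s t as_ st tb; apply: le_of_half_pow => n; exact: hn.
Qed.

(** The limit is the supremum of the lower bounds [f n x - e n x]; it comes with its
    rate of convergence. *)
Lemma sup_limit (R : realType) (X : Type) (f : nat -> X -> R)
    (e : nat -> X -> R) :
  (forall n m x, `|f n x - f m x| <= e n x + e m x) ->
  exists g : X -> R, forall n x, `|g x - f n x| <= e n x.
Proof.
move=> h.
pose S x := [set f n x - e n x | n in setT].
have ub x m : ubound (S x) (f m x + e m x).
  move=> _ [n _ <-]; have := h n m x; rewrite ler_norml; lra.
have hs x : has_sup (S x).
  by split; [exists (f 0%N x - e 0%N x), 0%N|exists (f 0%N x + e 0%N x); exact: ub].
exists (fun x => sup (S x)) => n x.
have h1 : sup (S x) <= f n x + e n x.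
  by apply: ge_sup; [exists (f 0%N x - e 0%N x), 0%N|exact: ub].
have h2 : f n x - e n x <= sup (S x).
  by apply: sup_upper_bound => //; exists n.
rewrite ler_norml; lra.
Qed.

Lemma expRN_le (R : realType) (y : R) : 0 <= y -> expR (- y) <= 1 - y + y ^+ 2.
Proof.
move=> y0; rewrite expRN.
have h := expR_ge1Dx y.
have : (expR y)^-1 <= (1 + y)^-1 by rewrite lef_pV2// posrE ?expR_gt0//; lra.
move=> /le_trans; apply.
rewrite -[leLHS]mul1r ler_pdivrMr; last lra.
have -> : (1 - y + y ^+ 2) * (1 + y) = 1 + y ^+ 3 by ring.
by rewrite lerDl exprn_ge0.
Qed.

Lemma clip_lip (R : realType) (a b x y : R) :
  `|Num.max a (Num.min x b) - Num.max a (Num.min y b)| <= `|x - y|.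
Proof.
have /andP[h1 h2] : - `|x - y| <= x - y <= `|x - y| by rewrite -ler_norml.
rewrite /Num.max /Num.min.
by repeat case: ifPn; rewrite -?leNgt => *; rewrite ler_norml; lra.
Qed.

(** McShane's extension, truncated so that the bound [B] survives. *)
Lemma mcshane_extension (R : realType) (I : Type) (i0 : I) (y b : I -> R) (L B : R) :
  0 <= L -> (forall i, `|b i| <= B) ->
  (forall i j, `|b i - b j| <= L * `|y i - y j|) ->
  exists g : R -> R, [/\ forall s t, `|g s - g t| <= L * `|s - t|,
    forall i, g (y i) = b i & forall s, `|g s| <= B].
Proof.
move=> L0 bB bL.
pose S t := [set b i - L * `|t - y i| | i in setT].
have S0 t : S t !=set0 by exists (b i0 - L * `|t - y i0|), i0.
have S_sup t : has_sup (S t).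
  split => //; exists B => _ [i _ <-].
  have := bB i; rewrite ler_norml => /andP[_ h].
  by rewrite (le_trans _ h)// gerBl mulr_ge0.
pose g t := sup (S t).
have g1 s t : g s <= g t + L * `|s - t|.
  apply: ge_sup => // _ [i _ <-].
  have h : b i - L * `|t - y i| <= g t.
    by apply: sup_upper_bound => //; exists i.
  have : L * `|t - y i| <= L * (`|s - t| + `|s - y i|).
    by rewrite ler_wpM2l// (distrC s t) ler_distD.
  lra.
have gy i : g (y i) = b i.
  apply/eqP; rewrite eq_le; apply/andP; split.
    apply: ge_sup => // _ [j _ <-].
    by have := bL j i; rewrite (distrC (y j)) ler_norml; lra.
  apply: sup_upper_bound => //; exists i => //.
  by rewrite subrr normr0 mulr0 subr0.
have B0 : 0 <= B by exact: le_trans (bB i0).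
exists (fun t => Num.max (- B) (Num.min (g t) B)); split.
- move=> s t; have h1 := g1 s t; have := g1 t s; rewrite (distrC t).
  set D := L * `|s - t| in h1 *; move=> h2.
  by rewrite (le_trans (clip_lip _ _ _ _))// ler_norml; apply/andP; split; lra.
- move=> i; rewrite gy; have := bB i; rewrite ler_norml => /andP[h1 h2].
  by rewrite min_l// max_r.
- by move=> s; rewrite ler_norml le_max lexx ge_max ge_min lexx orbT ge0_cp.
Qed.

(** The maximum principle in the form that suits transport: a point of maximum cannot
    be improved, in particular not by a step back along a characteristic. *)
Lemma le0_of_improvable (R : realType) (Om : set (R * R)) (w : R * R -> R) :
  compact Om -> {within Om, continuous w} ->
  (forall z, Om z -> 0 < w z -> exists2 z', Om z' & w z < w z') ->
  forall z, Om z -> w z <= 0.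
Proof.
move=> cO cw h z Oz.
have [|m mO hm] := compact_EVT_max _ cO cw; first by exists z.
have zm : w z <= w m by apply: hm; rewrite inE.
apply: (le_trans zm); rewrite leNgt; apply/negP => wm.
have [z' Oz'] := h m (set_mem mO) wm.
by rewrite ltNge hm// inE.
Qed.

Lemma cyl_segment (R : realType) (T : R) :
  cyl T%:E = `[0, T] `*` `[0, 1] :> set (R * R).
Proof.
apply/seteqP; split => -[t x] /=; rewrite /cyl /= !in_itv/= !lee_fin.
  by move=> [-> -> ->].
by move=> [/andP[-> ->] ->].
Qed.

Lemma compact_cyl (R : realType) (T : R) : compact (cyl (R := R) T%:E).
Proof. by rewrite cyl_segment; apply: compact_setX; exact: segment_compact. Qed.

Lemma Lip2_continuous (R : realType) (M : R) (A : set (R * R)) (u : R * R -> R) :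
  Lip2 M A u -> {within A, continuous u}.
Proof.
move=> hu; apply/subspace_continuousP => z Az.
apply/cvgrPdist_le => e e0; rewrite near_withinE.
pose K := Num.max M 1.
have K1 : 1 <= K by rewrite /K le_max lexx orbT.
have d0 : 0 < e / (2 * K) by rewrite divr_gt0//; lra.
near=> y => Ay.
rewrite (le_trans (hu _ _ Az Ay))//.
have : ball z (e / (2 * K)) y by near: y; exact: nbhsx_ballx.
case; rewrite /= /ball/= => h1 h2.
have h3 : `|z.1 - y.1| + `|z.2 - y.2| <= e / K.
  have -> : e / K = e / (2 * K) + e / (2 * K) by field; lra.
  by apply: lerD; exact: ltW.
apply: (@le_trans _ _ (K * (e / K))); last by rewrite mulrC divfK//; lra.
apply: (@le_trans _ _ (K * (`|z.1 - y.1| + `|z.2 - y.2|))).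
  by rewrite ler_wpM2r ?addr_ge0// /K le_max lexx.
by rewrite ler_wpM2l//; lra.
Unshelve. all: by end_near. Qed.

(** * Backward characteristics by Euler's scheme *)

(** The foot at time 0 of the backward Euler polygon that leaves [x] at the grid time
    [k * tau]. *)
Fixpoint euler_foot (R : realType) (a : R * R -> R) (tau : R) (k : nat) (x : R) : R :=
  if k is k'.+1 then euler_foot a tau k' (x - tau * a (k'.+1%:R * tau, x)) else x.

(** The first step, from [t] down to the grid, is shorter than the others. *)
Definition euler_map (R : realType) (a : R * R -> R) (tau t x : R) : R :=
  let k := Num.truncn (t / tau) in
  euler_foot a tau k (x - (t - k%:R * tau) * a (t, x)).

Lemma euler_mapE (R : realType) (a : R * R -> R) (tau t x : R) (k : nat) :
  0 < tau -> k%:R * tau <= t -> t <= k.+1%:R * tau ->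
  euler_map a tau t x = euler_foot a tau k (x - (t - k%:R * tau) * a (t, x)).
Proof.
move=> tau0 kt tk; rewrite /euler_map.
have tt0 : 0 <= t / tau.
  by rewrite divr_ge0 ?(ltW tau0)// (le_trans _ kt)// mulr_ge0 ?ler0n// ltW.
have /andP[h1 h2] := truncn_itv tt0.
move: tk; rewrite le_eqVlt => /predU1P[tE|tk].
  have -> : Num.truncn (t / tau) = k.+1.
    by rewrite tE mulfK ?gt_eqF// natrK.
  by rewrite tE /= subrr mul0r subr0 -mulrBl -natrB// subSnn mul1r.
have -> // : Num.truncn (t / tau) = k.
apply/eqP; rewrite eqn_leq; apply/andP; split; rewrite -ltnS -(ltr_nat R).
  by rewrite (le_lt_trans h1)// ltr_pdivrMr.
by rewrite (le_lt_trans _ h2)// ler_pdivlMr.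
Qed.

Lemma euler_cell (R : realType) (tau t : R) : 0 < tau -> 0 <= t ->
  exists k : nat, k%:R * tau <= t /\ t <= k.+1%:R * tau.
Proof.
move=> tau0 t0; exists (Num.truncn (t / tau)).
have /truncn_itv/andP[h1 h2] : 0 <= t / tau by rewrite divr_ge0// ltW.
by split; [rewrite -ler_pdivlMr|rewrite -ler_pdivrMr// ltW].
Qed.

(** Each step expands distances by a factor at most [1 + L * tau]. *)
Lemma euler_foot_lip (R : realType) (a : R * R -> R) (L tau : R) k x y :
  0 <= L -> 0 < tau ->
  (forall t x s y, `|a (t, x) - a (s, y)| <= L * (`|t - s| + `|x - y|)) ->
  `|euler_foot a tau k x - euler_foot a tau k y| <=
    expR (L * (k%:R * tau)) * `|x - y|.
Proof.
move=> L0 tau0 aL; elim: k x y => [|k IH] x y /=.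
  by rewrite mul0r mulr0 expR0 mul1r.
rewrite (le_trans (IH _ _))//.
have -> : expR (L * (k.+1%:R * tau)) = expR (L * (k%:R * tau)) * expR (L * tau).
  by rewrite -expRD; congr expR; rewrite -natr1; ring.
rewrite -mulrA ler_wpM2l ?expR_ge0//.
have h := aL (k.+1%:R * tau) x (k.+1%:R * tau) y.
rewrite subrr normr0 add0r in h.
apply: (@le_trans _ _ ((1 + L * tau) * `|x - y|)); last first.
  by rewrite ler_wpM2r// expR_ge1Dx.
have -> : forall p q : R, x - tau * p - (y - tau * q) = (x - y) - tau * (p - q).
  by move=> p q; ring.
rewrite (le_trans (ler_normB _ _))// [leRHS]mulrDl mul1r lerD2l normrM gtr0_norm//.
have -> : L * tau * `|x - y| = tau * (L * `|x - y|) by ring.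
by rewrite ler_wpM2l// ltW.
Qed.

Lemma euler_map_lip (R : realType) (a : R * R -> R) (L tau t x y : R) :
  0 <= L -> 0 < tau -> 0 <= t ->
  (forall t x s y, `|a (t, x) - a (s, y)| <= L * (`|t - s| + `|x - y|)) ->
  `|euler_map a tau t x - euler_map a tau t y| <= expR (L * t) * `|x - y|.
Proof.
move=> L0 tau0 t0 aL; have [k [kt tk]] := euler_cell tau0 t0.
rewrite !(@euler_mapE _ _ _ _ _ k)//.
rewrite (le_trans (euler_foot_lip _ _ _ L0 tau0 aL))//.
have -> : expR (L * t) = expR (L * (k%:R * tau)) * expR (L * (t - k%:R * tau)).
  by rewrite -expRD; congr expR; ring.
rewrite -mulrA ler_wpM2l ?expR_ge0//.
have h := aL t x t y; rewrite subrr normr0 add0r in h.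
set d := t - k%:R * tau; have d0 : 0 <= d by rewrite subr_ge0.
apply: (@le_trans _ _ ((1 + L * d) * `|x - y|)); last first.
  by rewrite ler_wpM2r// expR_ge1Dx.
have -> : forall p q : R, x - d * p - (y - d * q) = (x - y) - d * (p - q).
  by move=> p q; ring.
rewrite (le_trans (ler_normB _ _))// [leRHS]mulrDl mul1r lerD2l normrM ger0_norm//.
have -> : L * d * `|x - y| = d * (L * `|x - y|) by ring.
exact: ler_wpM2l.
Qed.

Lemma step_var (R : realType) (a : R * R -> R) (L M t x e : R) :
  0 <= L -> 0 <= e ->
  (forall t x s y, `|a (t, x) - a (s, y)| <= L * (`|t - s| + `|x - y|)) ->
  (forall z, `|a z| <= M) ->
  `|a (t, x) - a (t - e, x - e * a (t, x))| <= L * (1 + M) * e.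
Proof.
move=> L0 e0 aL aM; rewrite (le_trans (aL _ _ _ _))//.
rewrite (_ : t - (t - e) = e); last by ring.
rewrite (_ : x - (x - e * a (t, x)) = e * a (t, x)); last by ring.
rewrite normrM (ger0_norm e0).
have -> : L * (1 + M) * e = L * (e + e * M) by ring.
by rewrite ler_wpM2l// lerD2l ler_wpM2l.
Qed.

(** Within a cell of the grid both polygons finish with the same steps; they differ
    by the velocities read at the two ends of the short step. *)
Lemma euler_cell_step (R : realType) (a : R * R -> R) (L M T tau t x e : R) k :
  0 <= L -> 0 < tau -> 0 <= e -> t <= T ->
  (forall t x s y, `|a (t, x) - a (s, y)| <= L * (`|t - s| + `|x - y|)) ->
  (forall z, `|a z| <= M) ->
  k%:R * tau <= t - e -> t <= k.+1%:R * tau ->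
  `|euler_map a tau t x - euler_map a tau (t - e) (x - e * a (t, x))| <=
    expR (L * T) * L * (1 + M) * (e * tau).
Proof.
move=> L0 tau0 e0 tT aL aM kt tk.
rewrite !(@euler_mapE _ _ _ _ _ k)//; [|lra..].
rewrite (le_trans (euler_foot_lip _ _ _ L0 tau0 aL))//.
have h := step_var t x L0 e0 aL aM.
have kT : expR (L * (k%:R * tau)) <= expR (L * T).
  by rewrite ler_expR ler_wpM2l//; lra.
have -> : forall p q : R, x - (t - k%:R * tau) * p -
   (x - e * p - (t - e - k%:R * tau) * q) = - ((t - e - k%:R * tau) * (p - q)).
  by move=> p q; ring.
rewrite normrN normrM -!mulrA ler_pM ?expR_ge0 ?mulr_ge0//.
have h1 : t - e - k%:R * tau <= tau.
  by move: tk; rewrite -natr1 mulrDl mul1r; lra.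
have h2 : 0 <= t - e - k%:R * tau by lra.
have -> : L * ((1 + M) * (e * tau)) = tau * (L * (1 + M) * e) by ring.
by rewrite ger0_norm// ler_pM.
Qed.

(** A step shorter than [tau] crosses at most one grid time, where it is split. *)
Lemma euler_step (R : realType) (a : R * R -> R) (L M T tau t x e : R) :
  0 <= L -> 0 < tau -> 0 <= e -> e <= tau -> e <= t -> t <= T ->
  (forall t x s y, `|a (t, x) - a (s, y)| <= L * (`|t - s| + `|x - y|)) ->
  (forall z, `|a z| <= M) ->
  `|euler_map a tau t x - euler_map a tau (t - e) (x - e * a (t, x))| <=
    expR (L * T) * L * (1 + M) * (e * tau + e ^+ 2).
Proof.
move=> L0 tau0 e0 etau et tT aL aM.
have M0 : 0 <= M by exact: le_trans (aM (0, 0)).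
set K := expR (L * T) * L * (1 + M).
have K0 : 0 <= K by rewrite !mulr_ge0 ?expR_ge0//; lra.
have [k [kt tk]] := euler_cell tau0 (le_trans e0 et).
have [kte|kte] := leP (k%:R * tau) (t - e).
  rewrite (le_trans (euler_cell_step _ L0 tau0 e0 tT aL aM kte tk))//.
  by rewrite ler_wpM2l// lerDl sqr_ge0.
case: k kt tk kte => [|k] kt tk kte; first by rewrite mul0r in kte; lra.
set s := k.+1%:R * tau; set x2 := x - (t - s) * a (t, x); set d := s - (t - e).
have d0 : 0 <= d by rewrite /d /s; lra.
have de : d <= e by rewrite /d /s; lra.
have ks : k%:R * tau <= s - d.
  by have := kt; rewrite -natr1 mulrDl mul1r /d; lra.
have -> : euler_map a tau t x = euler_map a tau s x2.
  rewrite (@euler_mapE _ _ _ t _ k.+1)// (@euler_mapE _ _ _ s _ k.+1)//.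
    by rewrite subrr mul0r subr0.
  by rewrite ler_wpM2r ?(ltW tau0)// ler_nat.
have h1 := @euler_cell_step _ a L M T tau s x2 d k L0 tau0 d0 ltac:(rewrite /s; lra)
  aL aM ks (lexx _).
have sd : s - d = t - e by rewrite /d; ring.
rewrite sd in h1.
have h2 := @euler_map_lip _ a L tau (t - e) (x2 - d * a (s, x2)) (x - e * a (t, x))
  L0 tau0 ltac:(lra) aL.
have h3 : `|x2 - d * a (s, x2) - (x - e * a (t, x))| <= L * (1 + M) * e ^+ 2.
  have -> : x2 - d * a (s, x2) - (x - e * a (t, x)) = d * (a (t, x) - a (s, x2)).
    by rewrite /x2 /d; ring.
  have := @step_var _ a L M t x (t - s) L0 ltac:(rewrite /s; lra) aL aM.
  rewrite (_ : t - (t - s) = s) -/x2; last by ring.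
  move=> h; rewrite normrM ger0_norm//.
  have -> : L * (1 + M) * e ^+ 2 = e * (L * (1 + M) * e) by ring.
  rewrite ler_pM//; rewrite (le_trans h)// ler_wpM2l ?mulr_ge0//; first lra.
  by rewrite /d in d0; lra.
rewrite (_ : euler_map a tau s x2 - _ =
  (euler_map a tau s x2 - euler_map a tau (t - e) (x2 - d * a (s, x2))) +
  (euler_map a tau (t - e) (x2 - d * a (s, x2)) -
   euler_map a tau (t - e) (x - e * a (t, x)))); last by ring.
rewrite (le_trans (ler_normD _ _))// mulrDr lerD//.
  by rewrite (le_trans h1)// -/K ler_wpM2l// ler_wpM2r ?(ltW tau0).
rewrite (le_trans h2)// /K -!mulrA ler_pM ?expR_ge0//; last by rewrite mulrA.
by rewrite ler_expR ler_wpM2l//; lra.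
Qed.

(** Two half steps are joined. Their velocities differ by [O(e)], which costs one more
    [O(e^2)], and the factor 2 in front of [e ^+ 2] absorbs that cost. *)
Lemma step_doubling (R : realType) (a : R * R -> R) (F : R -> R -> R)
    (L M T tau K e1 : R) :
  0 <= L -> 0 <= tau -> 0 <= K ->
  (forall t x s y, `|a (t, x) - a (s, y)| <= L * (`|t - s| + `|x - y|)) ->
  (forall z, `|a z| <= M) ->
  expR (L * T) * L * (1 + M) <= K ->
  (forall t x y : R, 0 <= t -> t <= T -> `|F t x - F t y| <= expR (L * T) * `|x - y|) ->
  let P e1 := forall t x e, 0 <= e -> e <= e1 -> e <= t -> t <= T ->
    `|F t x - F (t - e) (x - e * a (t, x))| <= K * (e * tau + 2 * e ^+ 2) in
  P e1 -> P (2 * e1).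
Proof.
move=> L0 tau0 K0 aL aM KK FL P He t x e e0 ee et tT.
set d := e / 2; have ed : e = 2 * d by rewrite /d; field.
have d0 : 0 <= d by rewrite /d; lra.
set x1 := x - d * a (t, x).
have h1 := He t x d d0 ltac:(rewrite /d; lra) ltac:(rewrite /d; lra) tT.
have h2 := He (t - d) x1 d d0 ltac:(rewrite /d; lra) ltac:(rewrite /d; lra)
  ltac:(rewrite /d; lra).
have te : t - d - d = t - e by rewrite ed; ring.
rewrite te -/x1 in h1 h2.
have h3 := FL (t - e) (x1 - d * a (t - d, x1)) (x - e * a (t, x)) ltac:(lra)
  ltac:(lra).
have h4 : `|x1 - d * a (t - d, x1) - (x - e * a (t, x))| <= d * (L * (1 + M) * d).
  have -> : x1 - d * a (t - d, x1) - (x - e * a (t, x)) =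
            d * (a (t, x) - a (t - d, x1)) by rewrite /x1 ed; ring.
  by rewrite normrM ger0_norm// ler_wpM2l//; exact: step_var.
have h5 : expR (L * T) * `|x1 - d * a (t - d, x1) - (x - e * a (t, x))| <= K * d ^+ 2.
  apply: (@le_trans _ _ (expR (L * T) * (d * (L * (1 + M) * d)))).
    by rewrite ler_wpM2l ?expR_ge0.
  have -> : expR (L * T) * (d * (L * (1 + M) * d)) =
    expR (L * T) * L * (1 + M) * d ^+ 2 by ring.
  by rewrite ler_wpM2r ?sqr_ge0.
rewrite (_ : F t x - F (t - e) (x - e * a (t, x)) =
   (F t x - F (t - d) x1) + (F (t - d) x1 - F (t - e) (x1 - d * a (t - d, x1))) +
   (F (t - e) (x1 - d * a (t - d, x1)) - F (t - e) (x - e * a (t, x)))); last by ring.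
rewrite (le_trans (ler_normD _ _))//.
rewrite (le_trans (lerD (le_trans (ler_normD _ _) (lerD h1 h2)) (le_trans h3 h5)))//.
have Kd : 0 <= K * d ^+ 2 by rewrite mulr_ge0 ?sqr_ge0.
have -> : K * (e * tau + 2 * e ^+ 2) = K * (d * tau + 2 * d ^+ 2) +
   K * (d * tau + 2 * d ^+ 2) + K * d ^+ 2 + 3 * (K * d ^+ 2) by rewrite ed; ring.
by rewrite lerDl; lra.
Qed.

(** The scheme transports its own values over steps of any length, by repeated
    doubling from the length [tau]; the error is first order in the mesh only. *)
Lemma euler_any_step (R : realType) (a : R * R -> R) (L M T tau t x e : R) :
  0 <= L -> 0 < tau -> 0 <= e -> e <= t -> t <= T ->
  (forall t x s y, `|a (t, x) - a (s, y)| <= L * (`|t - s| + `|x - y|)) ->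
  (forall z, `|a z| <= M) ->
  `|euler_map a tau t x - euler_map a tau (t - e) (x - e * a (t, x))| <=
    expR (L * T) * L * (1 + M) * (e * tau + 2 * e ^+ 2).
Proof.
move=> L0 tau0 e0 et tT aL aM.
have M0 : 0 <= M by exact: le_trans (aM (0, 0)).
set K := expR (L * T) * L * (1 + M).
have K0 : 0 <= K by rewrite !mulr_ge0 ?expR_ge0//; lra.
have FL s p q : 0 <= s -> s <= T ->
    `|euler_map a tau s p - euler_map a tau s q| <= expR (L * T) * `|p - q|.
  move=> s0 sT; rewrite (le_trans (euler_map_lip _ _ L0 tau0 s0 aL))//.
  by rewrite ler_wpM2r// ler_expR ler_wpM2l.
have [n hn] := @le_half_pow _ e tau tau0.
suff H m t' x' e' : 0 <= e' -> e' <= 2 ^+ m * tau -> e' <= t' -> t' <= T ->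
    `|euler_map a tau t' x' - euler_map a tau (t' - e') (x' - e' * a (t', x'))| <=
    K * (e' * tau + 2 * e' ^+ 2).
  apply: (H n) => //; rewrite exprVn in hn.
  by rewrite mulrC -ler_pdivrMr// exprn_gt0.
elim: m t' x' e' => [|m IH] t' x' e' e'0 h e't t'T.
  rewrite expr0 mul1r in h.
  rewrite (le_trans (euler_step _ L0 tau0 e'0 h e't t'T aL aM))// ler_wpM2l//.
  by rewrite lerD2l; have := sqr_ge0 e'; lra.
apply: (@step_doubling _ a _ L M T tau K (2 ^+ m * tau)) => //; first exact: ltW.
by rewrite mulrA -exprS.
Qed.

(** Both schemes are followed along the same [2 ^ n] equal steps down to time 0, where
    they agree; the errors quadratic in the step vanish as [n] grows. *)
Lemma euler_compare (R : realType) (a : R * R -> R) (L M T tau sg t x : R) :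
  0 <= L -> 0 < tau -> 0 < sg -> 0 <= t -> t <= T ->
  (forall t x s y, `|a (t, x) - a (s, y)| <= L * (`|t - s| + `|x - y|)) ->
  (forall z, `|a z| <= M) ->
  `|euler_map a tau t x - euler_map a sg t x| <=
    expR (L * T) * L * (1 + M) * t * (tau + sg).
Proof.
move=> L0 tau0 sg0 t0 tT aL aM.
set K := expR (L * T) * L * (1 + M).
have e0x ta y : 0 < ta -> euler_map a ta 0 y = y.
  move=> ta0; rewrite (@euler_mapE _ _ _ _ _ 0) ?mul0r ?mul1r ?(ltW ta0)//=.
  by rewrite subrr mul0r subr0.
suff H n : `|euler_map a tau t x - euler_map a sg t x| <=
    K * t * (tau + sg) + (4 * K * t ^+ 2) * 2^-1 ^+ n.
  exact: le_of_half_pow H.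
set e := t * 2^-1 ^+ n.
have e0 : 0 <= e by rewrite mulr_ge0 ?exprn_ge0// invr_ge0.
have te : t = (2 ^ n)%:R * e.
  by rewrite /e natrX exprVn mulrCA divff ?mulr1// expf_neq0.
have H j y : (j <= 2 ^ n)%N ->
    `|euler_map a tau (j%:R * e) y - euler_map a sg (j%:R * e) y| <=
     j%:R * (K * (e * tau + 2 * e ^+ 2) + K * (e * sg + 2 * e ^+ 2)).
  elim: j y => [|j IH] y jn; first by rewrite !mul0r !e0x// subrr normr0.
  have jt : j.+1%:R * e <= T by rewrite (le_trans _ tT)// te ler_wpM2r// ler_nat.
  have ej : e <= j.+1%:R * e by rewrite ler_peMl// ler1n.
  have h1 := euler_any_step y L0 tau0 e0 ej jt aL aM.
  have h2 := euler_any_step y L0 sg0 e0 ej jt aL aM.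
  have je : j.+1%:R * e - e = j%:R * e by rewrite -natr1; ring.
  rewrite je in h1 h2.
  have h3 := IH (y - e * a (j.+1%:R * e, y)) (ltnW jn).
  set A := euler_map a tau (j.+1%:R * e) y in h1 *.
  set B := euler_map a sg (j.+1%:R * e) y in h2 *.
  set A' := euler_map a tau (j%:R * e) _ in h1 h3.
  set B' := euler_map a sg (j%:R * e) _ in h2 h3.
  rewrite (_ : A - B = (A - A') + (A' - B') - (B - B')); last by ring.
  rewrite (le_trans (ler_normB _ _))//.
  rewrite (le_trans (lerD (le_trans (ler_normD _ _) (lerD h1 h3)) h2))//.
  by rewrite -natr1 -/K le_eqVlt; apply/orP; left; apply/eqP; ring.
have := H (2 ^ n)%N x (leqnn _); rewrite -te => /le_trans; apply.
rewrite le_eqVlt; apply/orP; left; apply/eqP.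
have -> : (2 ^ n)%:R * (K * (e * tau + 2 * e ^+ 2) + K * (e * sg + 2 * e ^+ 2)) =
  K * ((2 ^ n)%:R * e) * (tau + sg) + 4 * K * ((2 ^ n)%:R * e) * e by ring.
by rewrite -te /e; ring.
Qed.

(** [Y t x] is the foot at time 0 of the characteristic through [(t, x)]. To the left
    of 0 the speed does not depend on the position, so the characteristics there are
    translates of each other, and [Y t 0] labels the one that enters at time [t]. *)
Lemma flow_exists (R : realType) (a : R * R -> R) (L M T : R) :
  0 <= L -> 0 <= T ->
  (forall t x s y, `|a (t, x) - a (s, y)| <= L * (`|t - s| + `|x - y|)) ->
  (forall z, 0 <= a z <= M) ->
  (forall t x : R, x <= 0 -> a (t, x) = a (t, 0)) ->
  exists Y : R -> R -> R, [/\ forall x, Y 0 x = x,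
    forall t x y : R, 0 <= t -> t <= T -> `|Y t x - Y t y| <= expR (L * T) * `|x - y|,
    forall t x e : R, 0 <= e -> e <= t -> t <= T ->
      `|Y t x - Y (t - e) (x - e * a (t, x))| <=
      2 * (expR (L * T) * L * (1 + M)) * e ^+ 2 &
    forall t x : R, 0 <= t -> t <= T -> x <= 0 -> Y t x = Y t 0 + x].
Proof.
move=> L0 T0 aL aM a0.
have aM' z : `|a z| <= M by have /andP[h1 h2] := aM z; rewrite ger0_norm.
have M0 : 0 <= M by exact: le_trans (aM' (0, 0)).
set K := expR (L * T) * L * (1 + M).
have K0 : 0 <= K by rewrite !mulr_ge0 ?expR_ge0//; lra.
pose tau n : R := 2^-1 ^+ n.
have tau0 n : 0 < tau n by rewrite exprn_gt0// invr_gt0.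
pose cl t : R := Num.max 0 (Num.min t T).
have clE t : 0 <= t -> t <= T -> cl t = t.
  by move=> t0 tT; rewrite /cl min_l// max_r.
have cl0 t : 0 <= cl t by rewrite /cl le_max lexx.
have clT t : cl t <= T by rewrite /cl ge_max T0 ge_min lexx orbT.
have [] := @sup_limit _ (R * R) (fun n z => euler_map a (tau n) (cl z.1) z.2)
  (fun n z => K * T * tau n).
  move=> n m z; rewrite (le_trans (euler_compare _ L0 _ _ (cl0 _) (clT _) aL aM'))//.
  by rewrite -/K -mulrDr ler_wpM2r ?addr_ge0 ?(ltW (tau0 _))// ler_wpM2l.
move=> Y HY.
have HYt n t x : 0 <= t -> t <= T ->
    `|Y (t, x) - euler_map a (tau n) t x| <= K * T * tau n.
  by move=> t0 tT; have := HY n (t, x); rewrite /= clE.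
exists (fun t x => Y (t, x)); split.
- move=> x; have H n : `|Y (0, x) - x| <= 0 + (K * T) * 2^-1 ^+ n.
    have := HYt n 0 x (lexx _) T0.
    rewrite (@euler_mapE _ _ _ _ _ 0) ?mul0r ?mul1r ?(ltW (tau0 n))//=.
    by rewrite subrr mul0r subr0 add0r.
  by have /le_of_half_pow := H; rewrite normr_le0 subr_eq0 => /eqP.
- move=> t x y t0 tT; apply: (@le_of_half_pow _ _ _ (2 * (K * T))) => n.
  have h1 := HYt n t x t0 tT; have h2 := HYt n t y t0 tT.
  have h3 := euler_map_lip x y L0 (tau0 n) t0 aL.
  have h4 : expR (L * t) * `|x - y| <= expR (L * T) * `|x - y|.
    by rewrite ler_wpM2r// ler_expR ler_wpM2l.
  rewrite /tau in h1 h2; move: h1 h2 (le_trans h3 h4); rewrite !ler_norml; lra.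
- move=> t x e e0 et tT; apply: (@le_of_half_pow _ _ _ (2 * (K * T) + K * e)) => n.
  have h1 := HYt n t x ltac:(lra) tT.
  have h2 := HYt n (t - e) (x - e * a (t, x)) ltac:(lra) ltac:(lra).
  have h3 := euler_any_step x L0 (tau0 n) e0 et tT aL aM'.
  rewrite -/K /tau in h1 h2 h3 *; move: h1 h2 h3.
  by rewrite !ler_norml; lra.
- move=> t x t0 tT x0; apply/eqP; rewrite -subr_eq0 -normr_le0.
  apply: (@le_of_half_pow _ _ _ (2 * (K * T))) => n.
  have h1 := HYt n t x t0 tT; have h2 := HYt n t 0 t0 tT.
  have ef k y : y <= 0 ->
      euler_foot a (tau n) k y = euler_foot a (tau n) k 0 + y.
    have H d y' : 0 <= d -> y' <= 0 -> forall s, y' - d * a (s, y') <= 0.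
      move=> d0 y'0 s; have /andP[h _] := aM (s, y').
      by have := mulr_ge0 d0 h; lra.
    elim: k y => [|k IH] y y0 /=; first by rewrite add0r.
    have tn := ltW (tau0 n).
    by rewrite (IH _ (H _ _ tn y0 _)) (IH _ (H _ _ tn (lexx 0) _)) (a0 _ y)//; ring.
  have [k [kt tk]] := euler_cell (tau0 n) t0.
  have E : euler_map a (tau n) t x = euler_map a (tau n) t 0 + x.
    rewrite !(@euler_mapE _ _ _ _ _ k)// (a0 _ x)//.
    have /andP[ha _] := aM (t, 0).
    have hd : 0 <= (t - k%:R * tau n) * a (t, 0) by rewrite mulr_ge0// subr_ge0.
    by rewrite (ef _ (x - _)) ?(ef _ (0 - _)); [ring|lra|lra].
  rewrite E /tau in h1; rewrite /tau in h2.
  by move: h1 h2; rewrite !ler_norml; lra.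
Qed.

(** * The linear transport equation *)

(** The equation [w_t + a w_x = 0] along characteristics. The constant [C] is explicit
    because passing to the limit needs it to be common to a sequence. *)
Definition transported (R : realType) (C T : R) (a w : R * R -> R) :=
  forall t x e : R, 0 < e -> e < t -> t <= T -> 0 < x - e * a (t, x) -> 0 <= x <= 1 ->
    `|w (t, x) - w (t - e, x - e * a (t, x))| <= C * e ^+ 2.

Definition clamp (R : realType) (b s : R) : R := Num.max 0 (Num.min s b).

Lemma clamp_itv (R : realType) (b s : R) : 0 <= b -> 0 <= clamp b s <= b.
Proof. by move=> b0; rewrite /clamp le_max lexx ge_max b0 ge_min lexx orbT. Qed.

Lemma clampE (R : realType) (b s : R) : 0 <= s <= b -> clamp b s = s.
Proof. by move=> /andP[s0 sb]; rewrite /clamp min_l// max_r. Qed.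

Lemma clamp_lip (R : realType) (b s t : R) : `|clamp b s - clamp b t| <= `|s - t|.
Proof.
exact: clip_lip.
Qed.

(** The projection on the cylinder. Composing with it extends a function to the plane
    with the same bounds and the same Lipschitz constant. *)
Definition clamp2 (R : realType) (T : R) (z : R * R) := (clamp T z.1, clamp 1 z.2).

Lemma clamp2_cyl (R : realType) (T : R) z : 0 <= T -> cyl T%:E (clamp2 T z).
Proof.
move=> T0; have /andP[h1 h2] := clamp_itv z.1 T0.
by split; rewrite //= ?lee_fin//; apply: clamp_itv.
Qed.

Lemma clamp2E (R : realType) (T : R) z : cyl T%:E z -> clamp2 T z = z.
Proof.
case: z => t x [/= t0]; rewrite lee_fin => tT x01.
by rewrite /clamp2 /= !clampE ?t0.
Qed.

Lemma foot_cyl (R : realType) (T t x e a : R) : 0 < e -> e < t -> t <= T -> 0 <= a ->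
  0 < x - e * a -> 0 <= x <= 1 -> cyl T%:E (t - e, x - e * a).
Proof.
move=> e0 et tT a0 xe x01; have ea : 0 <= e * a by rewrite mulr_ge0// ltW.
by split; rewrite /= ?lee_fin; lra.
Qed.

Lemma Lip2_clamp (R : realType) (T L : R) (a : R * R -> R) : 0 <= L -> 0 <= T ->
  Lip2 L (cyl T%:E) a -> forall z1 z2,
  `|a (clamp2 T z1) - a (clamp2 T z2)| <= L * (`|z1.1 - z2.1| + `|z1.2 - z2.2|).
Proof.
move=> L0 T0 aL z1 z2; rewrite (le_trans (aL _ _ (clamp2_cyl _ T0) (clamp2_cyl _ T0)))//.
by rewrite ler_wpM2l// lerD//= clamp_lip.
Qed.

(** The solution is a function of the foot of the characteristic: the value of [u0] at
    [x] sits at the foot [x], the value of [g] at [t] at the negative foot [Y t 0].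
    As [Y t 0] decreases at speed at least [c], the slope [G] of [g] becomes [G / c],
    and the data extend to a Lipschitz function of the foot. *)
Lemma linear_transport (R : realType) (a : R * R -> R) (u0 g : R -> R)
    (c L M T G C2 B : R) :
  0 < c -> 0 <= L -> 0 <= T -> 0 <= G -> 0 <= C2 ->
  Lip2 L (cyl T%:E) a -> (forall z, cyl T%:E z -> c <= a z <= M) ->
  (forall x y : R, 0 <= x <= 1 -> 0 <= y <= 1 -> `|u0 x - u0 y| <= C2 * `|x - y|) ->
  (forall s t : R, 0 <= s <= T -> 0 <= t <= T -> `|g s - g t| <= G * `|s - t|) ->
  (forall x : R, 0 <= x <= 1 -> `|u0 x| <= B) ->
  (forall t : R, 0 <= t <= T -> `|g t| <= B) ->
  u0 0 = g 0 ->
  let C := Num.max (G / c) C2 in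
  exists w : R * R -> R,
   [/\ transported (C * (2 * (expR (L * T) * L * (1 + M)))) T a w,
       Lip2 (C * Num.max 1 M * expR (L * T)) (cyl T%:E) w,
       forall z, `|w z| <= B,
       forall x : R, 0 <= x <= 1 -> w (0, x) = u0 x &
       forall t : R, 0 <= t <= T -> w (t, 0) = g t].
Proof.
move=> c0 L0 T0 G0 C20 aL aM u0L gL u0B gB u0g C.
pose a' z := a (clamp2 T z).
have a'L t x s y : `|a' (t, x) - a' (s, y)| <= L * (`|t - s| + `|x - y|).
  exact: (Lip2_clamp L0 T0 aL (t, x) (s, y)).
have a'M z : c <= a' z <= M by apply: aM; exact: clamp2_cyl.
have a'M0 z : 0 <= a' z <= M.
  by have /andP[h ->] := a'M z; rewrite (le_trans (ltW c0)).
have a'0 (t x : R) : x <= 0 -> a' (t, x) = a' (t, 0).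
  move=> x0; rewrite /a' /clamp2 /= (@clampE _ 1 0) ?lexx ?ler01//.
  suff -> : clamp 1 x = 0 by [].
  by rewrite /clamp min_l ?(le_trans x0)// max_l.
have a'E t x : cyl T%:E (t, x) -> a' (t, x) = a (t, x).
  by move=> h; rewrite /a' clamp2E.
have M0 : 0 <= M by have /andP[h1 h2] := a'M0 (0, 0); exact: le_trans h2.
have [Y [Y0 YL YT Yneg]] := flow_exists L0 T0 a'L a'M0 a'0.
set K := 2 * _ in YT.
set E := expR (L * T) in YL *.
have E0 : 0 <= E by exact: expR_ge0.
have C0 : 0 <= C by rewrite /C le_max C20 orbT.
(* the boundary characteristics have distinct feet, separated at speed c *)
have YB s t : 0 <= s -> s <= t -> t <= T -> c * (t - s) <= Y s 0 - Y t 0.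
  move=> s0 st tT.
  suff H : Y t 0 - Y s 0 <= - c * (t - s) by lra.
  apply: (@lip_of_quadratic _ (fun t => Y t 0) 0 T (- c) K _ s t s0 st tT).
  move=> {s0 st tT} {}s {}t s0 st tT /=.
  have := YT t 0 (t - s) ltac:(lra) ltac:(lra) tT.
  have -> : t - (t - s) = s by ring.
  have /andP[h1 h2] := a'M (t, 0).
  have h3 : 0 <= (t - s) * (a' (t, 0) - c) by rewrite mulr_ge0//; lra.
  have h4 : 0 <= (t - s) * a' (t, 0) by rewrite mulr_ge0//; lra.
  have -> := Yneg s (0 - (t - s) * a' (t, 0)) s0 ltac:(lra) ltac:(lra).
  by rewrite ler_norml; lra.
have Y0neg t : 0 <= t -> t <= T -> c * t <= - Y t 0.
  by move=> t0 tT; have := YB 0 t (lexx _) t0 tT; rewrite Y0; lra.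
have YtL s t x : 0 <= s -> s <= t -> t <= T -> `|Y t x - Y s x| <= E * M * (t - s).
  move=> s0 st tT.
  have H s' t' : 0 <= s' -> s' <= t' -> t' <= T ->
      `|Y t' x - Y s' x| <= E * M * (t' - s') + K * (t' - s') ^+ 2.
    move=> s'0 st' t'T.
    have h1 := YT t' x (t' - s') ltac:(lra) ltac:(lra) t'T.
    have e1 : t' - (t' - s') = s' by ring.
    rewrite e1 in h1.
    have h2 := YL s' (x - (t' - s') * a' (t', x)) x s'0 ltac:(lra).
    have e2 : x - (t' - s') * a' (t', x) - x = - ((t' - s') * a' (t', x)) by ring.
    rewrite e2 in h2.
    have /andP[h3 h4] := a'M0 (t', x).
    have ts' : 0 <= t' - s' by lra.
    rewrite normrN (ger0_norm (mulr_ge0 ts' h3)) in h2.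
    have h5 : E * ((t' - s') * a' (t', x)) <= E * ((t' - s') * M).
      by rewrite ler_wpM2l// ler_wpM2l.
    have := le_trans h2 h5; move: h1; rewrite !ler_norml; lra.
  rewrite ler_norml; apply/andP; split.
    suff H' : - Y t x - - Y s x <= E * M * (t - s) by lra.
    apply: (@lip_of_quadratic _ (fun t => - Y t x) 0 T (E * M) K _ s t s0 st tT).
    by move=> s' t' h1 h2 h3; have := H s' t' h1 h2 h3; rewrite ler_norml; lra.
  apply: (@lip_of_quadratic _ (fun t => Y t x) 0 T (E * M) K _ s t s0 st tT).
  by move=> s' t' h1 h2 h3; have := H s' t' h1 h2 h3; rewrite ler_norml; lra.
(* a nonnegative index is an initial point, a negative one the opposite of a time *)
pose y (i : R) := if 0 <= i then clamp 1 i else Y (clamp T (- i)) 0.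
pose b (i : R) := if 0 <= i then u0 (clamp 1 i) else g (clamp T (- i)).
have bg s t : 0 <= s <= T -> 0 <= t <= T -> `|g s - g t| <= C * `|Y s 0 - Y t 0|.
  wlog st : s t / s <= t.
    move=> H hs ht; have [st|/ltW ts] := leP s t; first exact: H.
    by rewrite distrC (distrC (Y s 0)) H.
  move=> hs ht; have /andP[s0 sT] := hs; have /andP[t0 tT] := ht.
  rewrite (le_trans (gL _ _ hs ht))//.
  have h := YB _ _ s0 st tT.
  have h' : c * (t - s) <= `|Y s 0 - Y t 0| by rewrite (le_trans h)// ler_norm.
  rewrite distrC ger0_norm ?subr_ge0//.
  apply: (@le_trans _ _ (G / c * (c * (t - s)))).
    by rewrite mulrA divfK// gt_eqF.
  by rewrite ler_pM ?mulr_ge0 ?invr_ge0 ?subr_ge0 ?(ltW c0)// /C le_max lexx.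
have bug x t : 0 <= x <= 1 -> 0 <= t <= T -> `|u0 x - g t| <= C * `|x - Y t 0|.
  move=> hx ht; have /andP[x0 x1] := hx; have /andP[t0 tT] := ht.
  have hY := Y0neg _ t0 tT.
  have ct : 0 <= c * t by rewrite mulr_ge0// ltW.
  rewrite [leRHS](_ : _ = C * x + C * (- Y t 0)); last first.
    by rewrite ger0_norm; [ring|lra].
  have -> : u0 x - g t = (u0 x - u0 0) + (g 0 - g t) by rewrite u0g; ring.
  rewrite (le_trans (ler_normD _ _))// lerD//.
    rewrite (le_trans (u0L _ _ hx _)) ?lexx ?ler01// subr0 ger0_norm//.
    by rewrite ler_wpM2r// /C le_max lexx orbT.
  have := bg 0 t; rewrite lexx T0 Y0 => /(_ isT ht).
  by rewrite sub0r (ger0_norm (_ : 0 <= - Y t 0))//; lra.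
have cl1 (i : R) : 0 <= clamp 1 i <= 1 by apply: clamp_itv.
have clT (i : R) : 0 <= clamp T i <= T by exact: clamp_itv.
have [||h [hL hy hB]] := @mcshane_extension R R 0 y b C B C0.
- by move=> i; rewrite /b; case: ifP => _; [exact: u0B|exact: gB].
- move=> i j; rewrite /b /y; case: ifP => _; case: ifP => _.
  + by rewrite (le_trans (u0L _ _ _ _))// ler_wpM2r// /C le_max lexx orbT.
  + exact: bug.
  + by rewrite distrC (distrC (Y _ _)); exact: bug.
  + exact: bg.
exists (fun z => h (Y (clamp T z.1) z.2)); split.
- move=> t x e e0 et tT xe x1.
  have ht : 0 <= t <= T by rewrite tT andbT; lra.
  have hte : 0 <= t - e <= T by apply/andP; split; lra.
  rewrite /= !clampE// (le_trans (hL _ _))// -[leRHS]mulrA ler_wpM2l//.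
  have cT : cyl T%:E (t, x) by split => //=; lra.
  have := YT t x e (ltW e0) (ltW et) tT; rewrite a'E//.
- move=> [t1 x1] [t2 x2] [/= t10 t1T x1b] [/= t20 t2T x2b].
  rewrite !lee_fin in t1T t2T.
  rewrite !clampE ?t10 ?t20// (le_trans (hL _ _))// -!mulrA ler_wpM2l//.
  have h1 : `|Y t1 x1 - Y t2 x1| <= E * M * `|t1 - t2|.
    have [st|/ltW ts] := leP t1 t2.
      by rewrite distrC (distrC t1) (ger0_norm (_ : 0 <= t2 - t1)) ?subr_ge0// YtL.
    by rewrite (ger0_norm (_ : 0 <= t1 - t2)) ?subr_ge0// YtL.
  have h2 := YL t2 x1 x2 t20 t2T.
  have -> : Y t1 x1 - Y t2 x2 = (Y t1 x1 - Y t2 x1) + (Y t2 x1 - Y t2 x2) by ring.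
  rewrite (le_trans (ler_normD _ _))//.
  set m := Num.max 1 M.
  have m1 : 1 <= m by rewrite /m le_max lexx.
  have mM : M <= m by rewrite /m le_max lexx orbT.
  have -> : m * (E * (`|t1 - t2| + `|x1 - x2|)) =
    E * m * `|t1 - t2| + m * (E * `|x1 - x2|) by ring.
  rewrite lerD//; first by rewrite (le_trans h1)// ler_wpM2r// ler_wpM2l.
  by rewrite (le_trans h2)// ler_peMl// mulr_ge0.
- by move=> z.
- move=> x hx /=; rewrite clampE ?lexx// Y0 -[in h x](clampE hx).
  have := hy x; rewrite /y /b; have /andP[-> _] := hx.
  by rewrite !clampE.
- move=> t ht /=; rewrite clampE//.
  have [->|t0] := eqVneq t 0.
    rewrite Y0 -u0g; have := hy 0; rewrite /y /b lexx clampE ?lexx ?ler01//.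
  have := hy (- t); rewrite /y /b oppr_ge0 opprK (clampE ht).
  case: ifP => // t0'; have /andP[h1 h2] := ht. by move: t0; rewrite eq_le h1 t0'.
Qed.

(** At a positive maximum of the difference less the weight, a short step back gains
    [th * A] from the decay of the weight and loses at most [M * B] from the mismatch
    of the speeds; all the rest is quadratic in the step. *)
Lemma transport_compare_le (R : realType) (a1 a2 w1 w2 : R * R -> R)
    (c C T M B A th s : R) :
  `|s| = 1 ->
  0 < c -> 0 <= T -> 0 < th -> 0 <= M -> 0 <= A ->
  (forall z, cyl T%:E z -> c <= a1 z) ->
  (forall z, cyl T%:E z -> c <= a2 z) ->
  transported C T a1 w1 -> transported C T a2 w2 ->
  (exists M1, Lip2 M1 (cyl T%:E) w1) -> Lip2 M (cyl T%:E) w2 ->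
  (forall z, cyl T%:E z -> `|a1 z - a2 z| <= B * expR (th * z.1)) ->
  (forall x : R, 0 <= x <= 1 -> w1 (0, x) = w2 (0, x)) ->
  (forall t : R, 0 <= t <= T -> `|w1 (t, 0) - w2 (t, 0)| <= A * expR (th * t)) ->
  M * B < th * A ->
  forall z, cyl T%:E z -> s * (w1 z - w2 z) <= A * expR (th * z.1).
Proof.
move=> s1 c0 T0 th0 M0 A0 a1c a2c tr1 tr2 [M1 L1] L2 aB wini wbd MB z Hz.
pose F z := s * (w1 z - w2 z) - A * expR (th * z.1).
have sN (r : R) : - `|r| <= s * r <= `|r|.
  by rewrite -ler_norml normrM s1 mul1r.
suff H : F z <= 0 by move: H; rewrite /F; lra.
apply: (le0_of_improvable (@compact_cyl R T) _ _ Hz).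
  have cE : {within cyl T%:E, continuous (fun z => expR (th * z.1))}.
    apply: continuous_subspaceT => y.
    apply: continuous_comp; last exact: continuous_expR.
    by apply: cvgM; [exact: cvg_cst|exact: cvg_fst].
  rewrite /F => y; apply: cvgB; last by apply: cvgM; [exact: cvg_cst|exact: cE].
  apply: cvgM; first exact: cvg_cst.
  by apply: cvgB; [exact: (Lip2_continuous L1)|exact: (Lip2_continuous L2)].
move=> {z Hz} [t x] Hz Fz; have [/= t0 tT x01] := Hz; rewrite lee_fin in tT.
have /andP[x0 x1] := x01.
have {}t0 : 0 < t.
  rewrite lt_neqAle t0 andbT; apply/eqP => tE; move: Fz.
  rewrite /F -tE wini// subrr mulr0 /= mulr0 expR0; lra.
have {}x0 : 0 < x.
  rewrite lt_neqAle x0 andbT; apply/eqP => xE; move: Fz.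
  rewrite /F -xE /=; have := wbd t; rewrite (ltW t0) tT => /(_ isT).
  by have := sN (w1 (t, 0) - w2 (t, 0)); lra.
have a1p := a1c _ Hz; have a2p := a2c _ Hz.
set E := expR (th * t); have E0 : 0 < E by exact: expR_gt0.
set g := (th * A - M * B) * E.
have g0 : 0 < g by rewrite mulr_gt0//; lra.
set Q := `|C| + `|C| + A * E * th ^+ 2.
have Q0 : 0 <= Q.
  rewrite /Q !addr_ge0//; apply: mulr_ge0; last exact: sqr_ge0.
  by rewrite mulr_ge0// ltW.
set a1z := a1 (t, x) in a1p *; set a2z := a2 (t, x) in a2p *.
(* a step short enough to stay inside, and for the gain g to beat the errors Q *)
pose D := 1 + a1z + a2z.
have D0 : 0 < D by rewrite /D; lra.
pose e := Num.min (Num.min t x / (2 * D)) (g / (2 * (Q + 1))).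
have tx0 : 0 < Num.min t x by rewrite lt_min t0.
have e0 : 0 < e.
  by rewrite /e lt_min; apply/andP; split; apply: divr_gt0 => //; lra.
have e1 : e <= Num.min t x / (2 * D) by rewrite /e ge_min lexx.
have e2 : e <= g / (2 * (Q + 1)) by rewrite /e ge_min lexx orbT.
have eD : e * (2 * D) <= Num.min t x by rewrite -ler_pdivlMr//; lra.
have eDt : e * (2 * D) <= t by rewrite (le_trans eD)// ge_min lexx.
have eDx : e * (2 * D) <= x by rewrite (le_trans eD)// ge_min lexx orbT.
have eQ : e * (2 * (Q + 1)) <= g by rewrite -ler_pdivlMr//; lra.
have ed : e * D = e + e * a1z + e * a2z by rewrite /D; ring.
have ea1 : 0 < e * a1z by rewrite mulr_gt0//; lra.
have ea2 : 0 < e * a2z by rewrite mulr_gt0//; lra.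
have et : e < t by lra.
have xe1 : 0 < x - e * a1z by lra.
have xe2 : 0 < x - e * a2z by lra.
have cz1 : cyl T%:E (t - e, x - e * a1z).
  by apply: foot_cyl => //; exact: le_trans (ltW c0) a1p.
have cz2 : cyl T%:E (t - e, x - e * a2z).
  by apply: foot_cyl => //; exact: le_trans (ltW c0) a2p.
exists (t - e, x - e * a1z) => //.
have h1 := tr1 _ _ _ e0 et tT xe1 x01; have h2 := tr2 _ _ _ e0 et tT xe2 x01.
have h3 := L2 _ _ cz2 cz1; rewrite /= subrr normr0 add0r in h3.
have e3 : x - e * a2z - (x - e * a1z) = e * (a1z - a2z) by ring.
rewrite e3 normrM (gtr0_norm e0) in h3.
have h4 := aB _ Hz; rewrite /= -/a1z -/a2z -/E in h4.
have h5 : M * (e * `|a1z - a2z|) <= M * (e * (B * E)).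
  by rewrite ler_wpM2l// ler_wpM2l// ltW.
have h6 : expR (th * (t - e)) <= E * (1 - th * e + (th * e) ^+ 2).
  have -> : th * (t - e) = th * t + - (th * e) by ring.
  by rewrite expRD ler_wpM2l ?(ltW E0)// expRN_le// mulr_ge0// ltW.
have h7 : A * expR (th * (t - e)) <= A * (E * (1 - th * e + (th * e) ^+ 2)).
  by rewrite ler_wpM2l.
have h8 : C * e ^+ 2 <= `|C| * e ^+ 2 by rewrite ler_wpM2r ?sqr_ge0// ler_norm.
set z1 := (t - e, x - e * a1z) in h1 h3 *.
set z2 := (t - e, x - e * a2z) in h2 h3 *.
have k1 := sN (w1 (t, x) - w1 z1); have k2 := sN (w2 (t, x) - w2 z2).
have k3 := sN (w2 z2 - w2 z1).
have Qe : e * (e * (2 * (Q + 1))) <= e * g by rewrite ler_pM2l.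
have ee : 0 < e * e by rewrite mulr_gt0.
rewrite /F /= -/E.
have k7 : 0 <= Q * (e * e) by rewrite mulr_ge0// ltW.
have k4 : s * (w1 (t, x) - w2 (t, x)) - s * (w1 z1 - w2 z1) <=
    2 * (`|C| * e ^+ 2) + M * (e * (B * E)).
  have -> : s * (w1 (t, x) - w2 (t, x)) - s * (w1 z1 - w2 z1) =
    s * (w1 (t, x) - w1 z1) - s * (w2 (t, x) - w2 z2) - s * (w2 z2 - w2 z1) by ring.
  by clear - k1 k2 k3 h1 h2 h3 h5 h8; lra.
have k5 : A * E - A * (E * (1 - th * e + (th * e) ^+ 2)) =
  (2 * (`|C| * e ^+ 2) + M * (e * (B * E))) + (e * g - Q * (e * e)).
  by rewrite /g /Q; ring.
have k6 : e * (e * (2 * (Q + 1))) = 2 * (Q * (e * e)) + 2 * (e * e) by ring.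
by clear - k4 k5 k6 k7 h7 Qe ee; lra.
Qed.


(** The non-strict inequality is reached by enlarging [A] slightly. *)
Lemma transport_compare (R : realType) (a1 a2 w1 w2 : R * R -> R)
    (c C T M B A th : R) :
  0 < c -> 0 <= T -> 0 < th -> 0 <= M -> 0 <= A ->
  (forall z, cyl T%:E z -> c <= a1 z) ->
  (forall z, cyl T%:E z -> c <= a2 z) ->
  transported C T a1 w1 -> transported C T a2 w2 ->
  (exists M1, Lip2 M1 (cyl T%:E) w1) -> Lip2 M (cyl T%:E) w2 ->
  (forall z, cyl T%:E z -> `|a1 z - a2 z| <= B * expR (th * z.1)) ->
  (forall x : R, 0 <= x <= 1 -> w1 (0, x) = w2 (0, x)) ->
  (forall t : R, 0 <= t <= T -> `|w1 (t, 0) - w2 (t, 0)| <= A * expR (th * t)) ->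
  M * B <= th * A ->
  forall z, cyl T%:E z -> `|w1 z - w2 z| <= A * expR (th * z.1).
Proof.
move=> c0 T0 th0 M0 A0 a1c a2c tr1 tr2 L1 L2 aB wini wbd MB z Hz.
apply/ler_addgt0Pr => e e0.
set E := expR (th * z.1); have E0 : 0 < E by exact: expR_gt0.
pose A' := A + e / E.
have eE : 0 < e / E by rewrite divr_gt0.
have -> : A * E + e = A' * E by rewrite /A' mulrDl divfK// gt_eqF.
have A'0 : 0 <= A' by rewrite /A'; lra.
have MB' : M * B < th * A'.
  have := mulr_gt0 th0 eE; rewrite /A' mulrDr; lra.
have wbd' (t : R) : 0 <= t <= T -> `|w1 (t, 0) - w2 (t, 0)| <= A' * expR (th * t).
  move=> ht; rewrite (le_trans (wbd t ht))// ler_wpM2r ?expR_ge0// /A'; lra.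
have n1 : `|1 : R| = 1 by rewrite normr1.
have n2 : `|- 1 : R| = 1 by rewrite normrN normr1.
have h1 := transport_compare_le n1 c0 T0 th0 M0 A'0 a1c a2c tr1 tr2 L1 L2 aB wini
  wbd' MB' Hz.
have h2 := transport_compare_le n2 c0 T0 th0 M0 A'0 a1c a2c tr1 tr2 L1 L2 aB wini
  wbd' MB' Hz.
rewrite -/E in h1 h2; rewrite ler_norml; lra.
Qed.

(** The region reached by characteristics that leave the boundary after [tau] is
    stable under backward steps, so the maximum principle applies to it alone; the
    small multiple of time makes the gain strict. *)
Lemma transport_extinct (R : realType) (a w : R * R -> R) (c C T tau : R) :
  0 < c -> 0 <= T -> 0 <= tau ->
  (forall z, cyl T%:E z -> c <= a z) ->
  transported C T a w -> (exists M, Lip2 M (cyl T%:E) w) ->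
  (forall t : R, tau <= t <= T -> w (t, 0) = 0) ->
  forall t x : R, tau + x / c <= t -> t <= T -> 0 <= x <= 1 -> w (t, x) = 0.
Proof.
move=> c0 T0 tau0 ac tr [M Lw] w0.
(* the edge is the path at speed c that leaves the boundary at time tau *)
pose Om := cyl T%:E `&` [set z : R * R | c * tau + z.2 <= c * z.1].
have cOm : compact Om.
  apply: compact_closedI; first exact: compact_cyl.
  rewrite (_ : [set z | _] = (fun z : R * R => c * z.1 - z.2 - c * tau) @^-1` [set y | 0 <= y]).
    apply: preimage_closed; last exact: closed_ge.
    move=> z _; apply: cvgB; last exact: cvg_cst.
    by apply: cvgB; [apply: cvgM; [exact: cvg_cst|exact: cvg_fst]|exact: cvg_snd].
  by apply/seteqP; split => z /=; lra.
suff H s t x : `|s| = 1 -> tau + x / c <= t -> t <= T -> 0 <= x <= 1 -> s * w (t, x) <= 0.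
  move=> t x h1 h2 h3; apply/eqP; rewrite eq_le.
  have := H 1 t x; have := H (- 1) t x; rewrite normrN normr1 => /(_ erefl h1 h2 h3) k1.
  by move=> /(_ erefl h1 h2 h3) k2; apply/andP; split; lra.
move=> s1 htx tT x01; apply/ler_addgt0Pr => d d0; rewrite add0r.
have {d d0} [e e0 ->] : exists2 e : R, 0 < e & d = e * (T + 1).
  by exists (d / (T + 1)); [rewrite divr_gt0//; lra|rewrite divfK// gt_eqF//; lra].
pose F z := s * w z - e * z.1.
have sN (r : R) : - `|r| <= s * r <= `|r|.
  by rewrite -ler_norml normrM s1 mul1r.
have hOm : Om (t, x).
  have /andP[x0 x1] := x01.
  have xc : 0 <= x / c by rewrite divr_ge0// ltW.
  split; first by split => //=; lra.
  rewrite /=; have := htx; rewrite -(ler_pM2l c0) mulrDr (mulrC c (x / c)) divfK//.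
  by rewrite gt_eqF.
suff : F (t, x) <= 0.
  rewrite /F /= => h.
  by have : e * t <= e * (T + 1) by [rewrite ler_pM2l//; lra]; lra.
apply: (le0_of_improvable cOm _ _ hOm).
  have cw : {within Om, continuous w}.
    by apply: continuous_subspaceW (Lip2_continuous Lw); exact: subIsetl.
  have cf : {within Om, continuous (fun z : R * R => z.1)}.
    by apply: continuous_subspaceT => y; exact: cvg_fst.
  move=> y; apply: cvgB; first by apply: cvgM; [exact: cvg_cst|exact: cw].
  by apply: cvgM; [exact: cvg_cst|exact: cf].
move=> {hOm t x htx tT x01} [t x] [Hz /= hz] Fz.
have [/= t0 tT x01] := Hz; rewrite lee_fin in tT.
have /andP[x0 x1] := x01.
have taut : tau <= t by rewrite -(ler_pM2l c0); lra.
have {}x0 : 0 < x.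
  rewrite lt_neqAle x0 andbT; apply/eqP => xE; move: Fz.
  rewrite /F -xE w0 ?taut// mulr0 /=; have := mulr_ge0 (ltW e0) t0; lra.
have {}t0 : 0 < t.
  by rewrite -(pmulr_rgt0 _ c0); have := mulr_ge0 (ltW c0) tau0; lra.
have ap := ac _ Hz; set az := a (t, x) in ap.
pose Q := `|C| + 1; have Q0 : 0 < Q by rewrite /Q; have := normr_ge0 C; lra.
pose D := 1 + az; have D0 : 0 < D by rewrite /D; lra.
have tx0 : 0 < Num.min t x by rewrite lt_min t0.
pose r := Num.min (Num.min t x / (2 * D)) (e / (2 * Q)).
have r0 : 0 < r by rewrite /r lt_min; apply/andP; split; apply: divr_gt0 => //; lra.
have r1 : r <= Num.min t x / (2 * D) by rewrite /r ge_min lexx.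
have r2 : r <= e / (2 * Q) by rewrite /r ge_min lexx orbT.
have rD : r * (2 * D) <= Num.min t x by rewrite -ler_pdivlMr//; lra.
have rDt : r * (2 * D) <= t by rewrite (le_trans rD)// ge_min lexx.
have rDx : r * (2 * D) <= x by rewrite (le_trans rD)// ge_min lexx orbT.
have rQ : r * (2 * Q) <= e by rewrite -ler_pdivlMr//; lra.
have rd : r * D = r + r * az by rewrite /D; ring.
have ra : 0 < r * az by rewrite mulr_gt0//; lra.
have xe : 0 < x - r * az by lra.
have rt : r < t by lra.
exists (t - r, x - r * az).
  split; first by split => /=; rewrite ?lee_fin; lra.
  have : r * c <= r * az by rewrite ler_pM2l.
  by rewrite /= mulrBr; lra.
have h1 := tr _ _ _ r0 rt tT xe x01; rewrite -/az in h1.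
have h2 := sN (w (t, x) - w (t - r, x - r * az)).
have h3 : C * r ^+ 2 <= `|C| * r ^+ 2 by rewrite ler_wpM2r ?sqr_ge0// ler_norm.
have h4 : r * (r * (2 * Q)) <= r * e by rewrite ler_pM2l.
have h5 : r * (r * (2 * Q)) = 2 * (`|C| * r ^+ 2) + 2 * (r * r) by rewrite /Q; ring.
have h6 : 0 < r * r by rewrite mulr_gt0.
have h7 : 0 <= `|C| * r ^+ 2 by rewrite mulr_ge0 ?sqr_ge0.
by rewrite /F /=; lra.
Qed.

(** * The system with frozen speeds *)

(** Reflection in space turns a negative speed into a positive one. *)
Definition flip (R : realType) (w : R * R -> R) : R * R -> R :=
  fun z => w (z.1, 1 - z.2).

Lemma flip_cyl (R : realType) (b : \bar R) (z : R * R) :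
  cyl b (z.1, 1 - z.2) <-> cyl b z.
Proof.
split => -[h1 h2 /= h3]; split => //; first by move: h3; rewrite /=; lra.
by rewrite /=; move: h3; lra.
Qed.

Lemma flipE (R : realType) (w : R * R -> R) t x : flip w (t, 1 - x) = w (t, x).
Proof. by rewrite /flip /=; congr (w (_, _)); ring. Qed.

Lemma Lip2_flip (R : realType) (M : R) (b : \bar R) (w : R * R -> R) :
  Lip2 M (cyl b) w -> Lip2 M (cyl b) (flip w).
Proof.
move=> h z1 z2 /flip_cyl h1 /flip_cyl h2.
have := h _ _ h1 h2; rewrite /flip /=.
have -> : 1 - z1.2 - (1 - z2.2) = - (z1.2 - z2.2) by ring.
by rewrite normrN.
Qed.

Lemma Lip2W (R : realType) (M M' : R) (A : set (R * R)) (w : R * R -> R) :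
  M <= M' -> Lip2 M A w -> Lip2 M' A w.
Proof.
move=> MM h z1 z2 h1 h2; rewrite (le_trans (h _ _ h1 h2))//.
by rewrite ler_wpM2r// addr_ge0.
Qed.

Lemma transportedW (R : realType) (C C' T : R) (a w : R * R -> R) :
  C <= C' -> transported C T a w -> transported C' T a w.
Proof.
move=> CC h t x e h1 h2 h3 h4 h5; rewrite (le_trans (h _ _ _ h1 h2 h3 h4 h5))//.
by rewrite ler_wpM2r ?sqr_ge0.
Qed.

(** The feet for [a] and [an n] differ by [O(e * 2 ^ (- n))], which the common Lipschitz
    constant of the [wn n] converts into a vanishing error. *)
Lemma transported_limit (R : realType) (C T c M K : R) (a w : R * R -> R)
    (an wn : nat -> R * R -> R) : 0 < c -> 0 <= M ->
  (forall n z, cyl T%:E z -> `|a z - an n z| <= K * 2^-1 ^+ n) ->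
  (forall n z, cyl T%:E z -> `|w z - wn n z| <= K * 2^-1 ^+ n) ->
  (forall z, cyl T%:E z -> c <= a z) ->
  (forall n z, cyl T%:E z -> c <= an n z) ->
  (forall n, Lip2 M (cyl T%:E) (wn n)) ->
  (forall n, transported C T (an n) (wn n)) ->
  transported C T a w.
Proof.
move=> c0 M0 aK wK ac anc wL tr t x e e0 et tT xe x01.
have Hz : cyl T%:E (t, x) by split => /=; rewrite ?lee_fin; lra.
have hac := ac _ Hz.
have Hz' : cyl T%:E (t - e, x - e * a (t, x)).
  have : 0 <= e * a (t, x) by rewrite mulr_ge0//; lra.
  by split => /=; rewrite ?lee_fin; lra.
have K0 : 0 <= K by have := le_trans (normr_ge0 _) (wK 0%N _ Hz); rewrite expr0 mulr1.
have d0 : 0 < (x - e * a (t, x)) / (2 * e) by rewrite divr_gt0//; lra.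
have [N hN] := le_half_pow K d0.
have hp n : 0 <= 2^-1 ^+ n :> R by rewrite exprn_ge0// invr_ge0.
apply: (@le_of_half_pow _ _ _ (2 * K + M * (e * K))) => n.
have KnN : K * 2^-1 ^+ (n + N) <= K * 2^-1 ^+ N.
  by rewrite ler_wpM2l// exprD ler_piMl// exprn_ile1 ?invr_ge0 ?invf_le1 ?ler1n.
have Knn : K * 2^-1 ^+ (n + N) <= K * 2^-1 ^+ n.
  by rewrite ler_wpM2l// exprD ler_piMr// exprn_ile1 ?invr_ge0 ?invf_le1 ?ler1n.
set m := (n + N)%N in KnN Knn.
have h1 := aK m _ Hz; have hc := anc m _ Hz.
have hd : `|a (t, x) - an m (t, x)| <= (x - e * a (t, x)) / (2 * e) by lra.
have he : e * `|a (t, x) - an m (t, x)| <= (x - e * a (t, x)) / 2.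
  have -> : (x - e * a (t, x)) / 2 = e * ((x - e * a (t, x)) / (2 * e)).
    by field; lra.
  by rewrite ler_pM2l.
have hf : `|e * a (t, x) - e * an m (t, x)| <= (x - e * a (t, x)) / 2.
  by rewrite -mulrBr normrM (gtr0_norm e0).
have xe' : 0 < x - e * an m (t, x) by move: hf; rewrite ler_norml; lra.
have Hz2 : cyl T%:E (t - e, x - e * an m (t, x)).
  have : 0 <= e * an m (t, x) by rewrite mulr_ge0//; lra.
  by split => /=; rewrite ?lee_fin; lra.
have h2 := tr m _ _ _ e0 et tT xe' x01.
have h3 := wL m _ _ Hz2 Hz'.
rewrite /= subrr normr0 add0r in h3.
have e3 : x - e * an m (t, x) - (x - e * a (t, x)) = e * (a (t, x) - an m (t, x)) by ring.
rewrite e3 normrM (gtr0_norm e0) in h3.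
have h4 : M * (e * `|a (t, x) - an m (t, x)|) <= M * (e * (K * 2^-1 ^+ n)).
  by rewrite ler_wpM2l// ler_wpM2l ?(ltW e0)// (le_trans h1).
have h5 := wK m _ Hz; have h6 := wK m _ Hz'.
rewrite mulrDl; move: h2 (le_trans h3 h4) (le_trans h5 Knn) (le_trans h6 Knn).
by rewrite !ler_norml; lra.
Qed.

(** What the fixed point argument requires of the data: bounds and slopes on the ranges
    of the unknowns, and inequalities by which the estimates of [linear_transport] stay
    in the class. [G] is the slope of the feedback [vr], and [D1 * C3' + D2] that of
    the boundary value of [u]. *)
Record transport_data (R : realType) (lam mu h : R * R -> R) (u0 v0 vr : R -> R)
    (c T B C1 C2 C3 C3' D1 D2 G M1 M2 : R) : Prop := TransportData {
  td_c : 0 < c; td_T : 0 <= T; td_D1 : 0 <= D1; td_D2 : 0 <= D2; td_G : 0 <= G;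
  td_M2 : 0 <= M2; td_C2 : 0 <= C2; td_C1B : C1 <= B;
  td_mu : forall z, mu z <= - c;
  td_lam : forall z, c <= lam z;
  td_M1 : forall u v : R, `|u| <= B -> `|v| <= C1 ->
    `|lam (u, v)| <= M1 /\ `|mu (u, v)| <= M1;
  td_lamL : forall u v u' v' : R, `|u| <= B -> `|v| <= C1 -> `|u'| <= B -> `|v'| <= C1 ->
    `|lam (u, v) - lam (u', v')| <= M2 * (`|u - u'| + `|v - v'|);
  td_muL : forall u v u' v' : R, `|u| <= B -> `|v| <= C1 -> `|u'| <= B -> `|v'| <= C1 ->
    `|mu (u, v) - mu (u', v')| <= M2 * (`|u - u'| + `|v - v'|);
  td_hB : forall w t : R, `|w| <= C1 -> 0 <= t -> `|h (w, t)| <= B;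
  td_hL : forall w t w' t' : R, `|w| <= C1 -> 0 <= t -> `|w'| <= C1 -> 0 <= t' ->
    `|h (w, t) - h (w', t')| <= D1 * `|w - w'| + D2 * `|t - t'|;
  td_u0L : forall x y : R, 0 <= x <= 1 -> 0 <= y <= 1 -> `|u0 x - u0 y| <= C2 * `|x - y|;
  td_v0L : forall x y : R, 0 <= x <= 1 -> 0 <= y <= 1 -> `|v0 x - v0 y| <= C2 * `|x - y|;
  td_u0B : forall x : R, 0 <= x <= 1 -> `|u0 x| <= C1;
  td_v0B : forall x : R, 0 <= x <= 1 -> `|v0 x| <= C1;
  td_u0h : u0 0 = h (v0 0, 0);
  td_vrL : forall s t : R, 0 <= s <= T -> 0 <= t <= T -> `|vr s - vr t| <= G * `|s - t|;
  td_vrB : forall t : R, 0 <= t <= T -> `|vr t| <= C1;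
  td_vr0 : vr 0 = v0 1;
  td_C3' : Num.max (G / c) C2 * Num.max 1 M1 * expR (2 * M2 * C3 * T) <= C3';
  td_C3'' : Num.max ((D1 * C3' + D2) / c) C2 * Num.max 1 M1 *
    expR (2 * M2 * C3 * T) <= C3;
  td_C3'3 : C3' <= C3 }.

Definition in_box (R : realType) (T B C1 C3 C3' : R)
    (p : (R * R -> R) * (R * R -> R)) :=
  [/\ forall z, cyl T%:E z -> `|p.1 z| <= B, forall z, cyl T%:E z -> `|p.2 z| <= C1,
      Lip2 C3 (cyl T%:E) p.1 & Lip2 C3' (cyl T%:E) p.2].

(** [q] solves the linear problem obtained by freezing the speeds along [p]. *)
Definition frozen_sol (R : realType) (lam mu h : R * R -> R) (u0 v0 vr : R -> R)
    (C T : R) (p q : (R * R -> R) * (R * R -> R)) :=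
  [/\ transported C T (fun z => lam (p.1 z, p.2 z)) q.1,
      transported C T (flip (fun z => - mu (p.1 z, p.2 z))) (flip q.2),
      forall t : R, 0 <= t <= T -> q.1 (t, 0) = h (q.2 (t, 0), t),
      forall t : R, 0 <= t <= T -> q.2 (t, 1) = vr t &
      forall x : R, 0 <= x <= 1 -> q.1 (0, x) = u0 x /\ q.2 (0, x) = v0 x].

Lemma frozen_speeds (R : realType) (lam mu h : R * R -> R) (u0 v0 vr : R -> R)
    (c T B C1 C2 C3 C3' D1 D2 G M1 M2 : R) p :
  transport_data lam mu h u0 v0 vr c T B C1 C2 C3 C3' D1 D2 G M1 M2 ->
  in_box T B C1 C3 C3' p ->
  [/\ Lip2 (2 * M2 * C3) (cyl T%:E) (fun z => lam (p.1 z, p.2 z)),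
      Lip2 (2 * M2 * C3) (cyl T%:E) (flip (fun z => - mu (p.1 z, p.2 z))),
      forall z, cyl T%:E z -> c <= lam (p.1 z, p.2 z) <= M1 &
      forall z, cyl T%:E z -> c <= flip (fun z => - mu (p.1 z, p.2 z)) z <= M1].
Proof.
move=> D [p1 p2 p3 p4].
have H (f : R * R -> R) : (forall u v u' v' : R, `|u| <= B -> `|v| <= C1 -> `|u'| <= B ->
    `|v'| <= C1 -> `|f (u, v) - f (u', v')| <= M2 * (`|u - u'| + `|v - v'|)) ->
    Lip2 (2 * M2 * C3) (cyl T%:E) (fun z => f (p.1 z, p.2 z)).
  move=> fL z1 z2 h1 h2.
  rewrite (le_trans (fL _ _ _ _ (p1 _ h1) (p2 _ h1) (p1 _ h2) (p2 _ h2)))//.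
  have -> : 2 * M2 * C3 * (`|z1.1 - z2.1| + `|z1.2 - z2.2|) =
    M2 * (C3 * (`|z1.1 - z2.1| + `|z1.2 - z2.2|) +
          C3 * (`|z1.1 - z2.1| + `|z1.2 - z2.2|)) by ring.
  rewrite ler_wpM2l ?(td_M2 D)// lerD ?p3//.
  exact: (Lip2W (td_C3'3 D) p4).
split.
- exact: H (td_lamL D).
- apply: Lip2_flip; move=> z1 z2 h1 h2.
  have := H mu (td_muL D) _ _ h1 h2.
  by rewrite -opprD normrN.
- move=> z hz; have [h1 _] := td_M1 D (p1 _ hz) (p2 _ hz).
  by rewrite (td_lam D) /= (le_trans (ler_norm _)).
- move=> z /flip_cyl hz; rewrite /flip.
  have [_ h1] := td_M1 D (p1 _ hz) (p2 _ hz).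
  by rewrite lerNr (td_mu D) /= (le_trans (ler_norm _))// normrN.
Qed.

Lemma box_consts (R : realType) (lam mu h : R * R -> R) (u0 v0 vr : R -> R)
    (c T B C1 C2 C3 C3' D1 D2 G M1 M2 : R) :
  transport_data lam mu h u0 v0 vr c T B C1 C2 C3 C3' D1 D2 G M1 M2 ->
  [/\ 0 <= C1, 0 <= C3, 0 <= C3', C2 <= C3' & C2 <= C3].
Proof.
move=> D.
have hC : C2 <= C3'.
  apply: le_trans (td_C3' D).
  rewrite -[C2 in leLHS]mulr1 -mulrA; apply: ler_pM => //; first exact: td_C2 D.
    by rewrite le_max lexx orbT.
  have C30 : 0 <= C3.
    apply: le_trans (td_C3'' D); rewrite !mulr_ge0 ?expR_ge0//.
      by rewrite le_max (td_C2 D) orbT.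
    by rewrite le_max ler01.
  rewrite -[1 in leLHS]mulr1 ler_pM//; first by rewrite le_max lexx.
  by rewrite -expR0 ler_expR !mulr_ge0 ?(td_M2 D) ?(td_T D).
have h' := td_C2 D; have h'' := td_C3'3 D.
split; [|lra..].
have := td_u0B D (x := 0); rewrite lexx ler01 => /(_ isT).
exact: le_trans.
Qed.

(** The second component is solved first, from its data at [x = 1]; its trace at
    [x = 0] then feeds the first one. *)
Lemma frozen_exists (R : realType) (lam mu h : R * R -> R) (u0 v0 vr : R -> R)
    (c T B C1 C2 C3 C3' D1 D2 G M1 M2 : R) :
  transport_data lam mu h u0 v0 vr c T B C1 C2 C3 C3' D1 D2 G M1 M2 ->
  exists C, forall p, in_box T B C1 C3 C3' p ->
  exists q, in_box T B C1 C3 C3' q /\ frozen_sol lam mu h u0 v0 vr C T p q.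
Proof.
move=> D; have c0 := td_c D; have T0 := td_T D.
have [C10 C30 C3'0 C2C3' C2C3] := box_consts D.
set L := 2 * M2 * C3; have L0 : 0 <= L by rewrite !mulr_ge0// (td_M2 D).
pose lc G := Num.max (G / c) C2 * (2 * (expR (L * T) * L * (1 + M1))).
exists (Num.max (lc G) (lc (D1 * C3' + D2))) => p hp.
have [Llam Lmu Blam Bmu] := frozen_speeds D hp.
have G'0 : 0 <= D1 * C3' + D2.
  by rewrite addr_ge0 ?mulr_ge0// ?(td_D1 D) ?(td_D2 D).
have fL (x y : R) : 0 <= x <= 1 -> 0 <= y <= 1 ->
    `|v0 (1 - x) - v0 (1 - y)| <= C2 * `|x - y|.
  move=> hx hy; have hx' : 0 <= 1 - x <= 1 by lra.
  have hy' : 0 <= 1 - y <= 1 by lra.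
  have := td_v0L D hx' hy'.
  by rewrite (_ : 1 - x - (1 - y) = - (x - y)) ?normrN//; ring.
have fB (x : R) : 0 <= x <= 1 -> `|v0 (1 - x)| <= C1.
  by move=> hx; apply: (td_v0B D); lra.
have f0 : v0 (1 - 0) = vr 0 by rewrite subr0 (td_vr0 D).
have [v [v1 v2 v3 v4 v5]] := linear_transport c0 L0 T0 (td_G D) (td_C2 D) Lmu Bmu
  fL (td_vrL D) fB (td_vrB D) f0.
have v2' : Lip2 C3' (cyl T%:E) (flip v).
  exact: Lip2W (td_C3' D) (Lip2_flip v2).
have cylt t : 0 <= t <= T -> cyl T%:E (t, 0 : R).
  by move=> ht; split => //=; rewrite ?lee_fin ?lexx ?ler01//; lra.
have vB t : `|flip v (t, 0)| <= C1 by exact: v3.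
pose g t := h (flip v (t, 0), t).
have gL (s t : R) : 0 <= s <= T -> 0 <= t <= T ->
    `|g s - g t| <= (D1 * C3' + D2) * `|s - t|.
  move=> hs ht; have /andP[s0 sT] := hs; have /andP[t0 tT] := ht.
  rewrite (le_trans (td_hL D (vB s) s0 (vB t) t0))//.
  rewrite mulrDl lerD// -mulrA ler_wpM2l ?(td_D1 D)//.
  by have := v2' _ _ (cylt _ hs) (cylt _ ht); rewrite /= subrr normr0 addr0.
have gB (t : R) : 0 <= t <= T -> `|g t| <= B.
  by move=> /andP[t0 _]; exact: (td_hB D (vB t) t0).
have g0 : u0 0 = g 0.
  by rewrite /g (td_u0h D) /flip /= subr0 v4 ?subrr// lexx ler01.
have uB (x : R) : 0 <= x <= 1 -> `|u0 x| <= B.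
  by move=> hx; exact: le_trans (td_u0B D hx) (td_C1B D).
have [u [w1 w2 w3 w4 w5]] := linear_transport c0 L0 T0 G'0 (td_C2 D) Llam Blam
  (td_u0L D) gL uB gB g0.
exists (u, flip v); split.
  split => //=; first by move=> z _; exact: v3.
  exact: Lip2W (td_C3'' D) w2.
split => /=.
- by apply: transportedW w1; rewrite le_max lexx orbT.
- have -> : flip (flip v) = v.
    by apply/funext => -[t x]; rewrite /flip /=; congr (v (_, _)); ring.
  by apply: transportedW v1; rewrite le_max lexx.
- by move=> t ht; rewrite w5.
- by move=> t ht; rewrite /flip /= subrr v5.
- move=> x hx; rewrite w4//; split => //; rewrite /flip /= v4; last lra.
  by congr v0; ring.
Qed.

(** * The nonlinear fixed point *)

(** The weight has to beat the cost [2 * M2 * C3] of a perturbation of the speeds, after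
    amplification by [D1] at the boundary, with a factor 2 for the contraction. *)
Definition picard_rate (R : realType) (M2 C3 D1 : R) : R :=
  2 * (2 * M2 * C3) * Num.max 1 D1 + 1.

Definition exp_close (R : realType) (T th S : R) (p q : (R * R -> R) * (R * R -> R)) :=
  forall z, cyl T%:E z -> `|p.1 z - q.1 z| <= S * expR (th * z.1) /\
                          `|p.2 z - q.2 z| <= S * expR (th * z.1).

(** Perturbing the speeds by [2 * M2 * S] times the weight perturbs a solution of slope
    [C3] by [2 * M2 * C3 * S / th] times the weight, and the boundary condition
    multiplies the perturbation of the second component by [D1]. *)
Lemma frozen_contract (R : realType) (lam mu h : R * R -> R) (u0 v0 vr : R -> R)
    (c T B C1 C2 C3 C3' D1 D2 G M1 M2 C S : R) p1 p2 q1 q2 :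
  transport_data lam mu h u0 v0 vr c T B C1 C2 C3 C3' D1 D2 G M1 M2 ->
  in_box T B C1 C3 C3' p1 -> in_box T B C1 C3 C3' p2 ->
  in_box T B C1 C3 C3' q1 -> in_box T B C1 C3 C3' q2 ->
  frozen_sol lam mu h u0 v0 vr C T p1 q1 -> frozen_sol lam mu h u0 v0 vr C T p2 q2 ->
  0 <= S -> exp_close T (picard_rate M2 C3 D1) S p1 p2 ->
  exp_close T (picard_rate M2 C3 D1) (S / 2) q1 q2.
Proof.
move=> D bp1 bp2 bq1 bq2 s1 s2 S0 pS.
have [C10 C30 C3'0 C2C3' C2C3] := box_consts D.
have c0 := td_c D; have T0 := td_T D; have M20 := td_M2 D; have D10 := td_D1 D.
set th := picard_rate M2 C3 D1 in pS *.
set m := Num.max 1 D1; set k := 2 * M2 * C3.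
have k0 : 0 <= k by rewrite !mulr_ge0.
have m1 : 1 <= m by rewrite le_max lexx.
have mD : D1 <= m by rewrite le_max lexx orbT.
have thE : th = 2 * (k * m) + 1 by rewrite /th /picard_rate -/m -/k; ring.
have km : k <= k * m by rewrite ler_peMr.
have km0 : 0 <= k * m by rewrite mulr_ge0//; lra.
have th0 : 0 < th by rewrite thE; lra.
have [_ _ lc1 mc1] := frozen_speeds D bp1; have [_ _ lc2 mc2] := frozen_speeds D bp2.
case: bp1 => p11 p12 p13 p14; case: bp2 => p21 p22 p23 p24.
case: bq1 => q11 q12 q13 q14; case: bq2 => q21 q22 q23 q24.
case: s1 => tu1 tv1 b1 r1 i1; case: s2 => tu2 tv2 b2 r2 i2.
have dist (f : R * R -> R) : (forall u v u' v' : R, `|u| <= B -> `|v| <= C1 -> `|u'| <= B ->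
    `|v'| <= C1 -> `|f (u, v) - f (u', v')| <= M2 * (`|u - u'| + `|v - v'|)) ->
    forall z, cyl T%:E z -> `|f (p1.1 z, p1.2 z) - f (p2.1 z, p2.2 z)| <=
      (2 * M2 * S) * expR (th * z.1).
  move=> fL z hz.
  rewrite (le_trans (fL _ _ _ _ (p11 _ hz) (p12 _ hz) (p21 _ hz) (p22 _ hz)))//.
  have [h1 h2] := pS _ hz.
  have -> : 2 * M2 * S * expR (th * z.1) =
    M2 * (S * expR (th * z.1) + S * expR (th * z.1)) by ring.
  by rewrite ler_wpM2l// lerD.
pose A := k * S / th.
have A0 : 0 <= A by rewrite /A !mulr_ge0// invr_ge0 ltW.
have thA : th * A = k * S by rewrite /A; field; rewrite gt_eqF.
have dv z : cyl T%:E z -> `|q1.2 z - q2.2 z| <= A * expR (th * z.1).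
  move=> hz; have hz' : cyl T%:E (z.1, 1 - z.2) by apply/flip_cyl.
  have := @transport_compare _ _ _ _ _ c C T C3 (2 * M2 * S) A th c0 T0 th0 C30 A0
    _ _ tv1 tv2 _ _ _ _ _ _ _ hz'.
  rewrite /flip /= (_ : 1 - (1 - z.2) = z.2); last by ring.
  case: (z) => t x /=; apply.
  - by move=> y /mc1/andP[].
  - by move=> y /mc2/andP[].
  - by exists C3'; exact: Lip2_flip.
  - exact/Lip2_flip/(Lip2W (td_C3'3 D)).
  - move=> y /flip_cyl hy; have := dist mu (td_muL D) _ hy.
    by rewrite /flip /= -opprD normrN.
  - move=> y hy; have hy' : 0 <= 1 - y <= 1 by lra.
    by have [_ ->] := i1 _ hy'; have [_ ->] := i2 _ hy'.
  - move=> s hs; rewrite subr0 r1// r2// subrr normr0 mulr_ge0// expR_ge0.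
  - by rewrite thA /k le_eqVlt; apply/orP; left; apply/eqP; ring.
have AS : m * A <= S / 2.
  rewrite -(ler_pM2l th0).
  have -> : th * (m * A) = k * m * S by rewrite mulrCA thA; ring.
  have -> : th * (S / 2) = k * m * S + S / 2 by rewrite thE; field.
  by lra.
have AmA : A <= m * A by rewrite ler_peMl.
have AS' : A <= S / 2 by lra.
move=> z hz; split; last first.
  by rewrite (le_trans (dv _ hz))// ler_wpM2r ?expR_ge0.
apply: (@transport_compare _ _ _ _ _ c C T C3 (2 * M2 * S) (S / 2) th c0 T0 th0 C30 _
    _ _ tu1 tu2 _ _ _ _ _ _ _ hz); rewrite ?divr_ge0//.
- by move=> y /lc1/andP[].
- by move=> y /lc2/andP[].
- by exists C3.
- exact: dist (td_lamL D).
- by move=> y hy; have [-> _] := i1 _ hy; have [-> _] := i2 _ hy.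
- move=> s hs; have /andP[hs0 _] := hs.
  have cs : cyl T%:E (s, 0 : R) by split => //=; rewrite ?lee_fin ?lexx ?ler01//; lra.
  rewrite b1// b2//.
  rewrite (le_trans (td_hL D (q12 _ cs) hs0 (q22 _ cs) hs0))//.
  rewrite subrr normr0 mulr0 addr0.
  apply: (@le_trans _ _ (m * A * expR (th * s))).
    by rewrite -mulrA ler_pM// dv.
  by rewrite ler_wpM2r ?expR_ge0.
- have -> : C3 * (2 * M2 * S) = k * S by rewrite /k; ring.
  rewrite -thA ler_pM2l//; lra.
Qed.

Lemma exp_close_le (R : realType) (T th S S' : R) (p q : (R * R -> R) * (R * R -> R)) :
  S <= S' -> exp_close T th S p q -> exp_close T th S' p q.
Proof.
move=> SS h z hz; have [h1 h2] := h z hz.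
by split; [apply: (le_trans h1)|apply: (le_trans h2)]; rewrite ler_wpM2r ?expR_ge0.
Qed.

Lemma exp_close_trans (R : realType) (T th S S' : R) (p q r : (R * R -> R) * (R * R -> R)) :
  exp_close T th S p q -> exp_close T th S' q r -> exp_close T th (S + S') p r.
Proof.
move=> h h' z hz; have [h1 h2] := h z hz; have [h1' h2'] := h' z hz.
rewrite mulrDl; split.
  by rewrite (le_trans (ler_distD (q.1 z) _ _))// lerD.
by rewrite (le_trans (ler_distD (q.2 z) _ _))// lerD.
Qed.

Lemma box_exp_close (R : realType) (T B C1 C3 C3' th : R)
    (p q : (R * R -> R) * (R * R -> R)) : 0 <= th -> C1 <= B ->
  in_box T B C1 C3 C3' p -> in_box T B C1 C3 C3' q -> exp_close T th (2 * B) p q.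
Proof.
move=> th0 CB [p1 p2 _ _] [q1 q2 _ _] z hz.
have h1 := p1 z hz; have h2 := p2 z hz; have h3 := q1 z hz; have h4 := q2 z hz.
have B0 : 0 <= B by exact: le_trans h1.
have e1 : 1 <= expR (th * z.1).
  by rewrite -expR0 ler_expR mulr_ge0//; case: hz.
have h5 : 2 * B <= 2 * B * expR (th * z.1) by rewrite ler_peMr// mulr_ge0.
by split; move: h1 h2 h3 h4; rewrite !ler_norml; lra.
Qed.

(** By iterated contraction, two fixed points in the class are at weighted distance at most
    [2 * B * 2 ^ (- n)] for every [n]. *)
Lemma nonlinear_unique (R : realType) (lam mu h : R * R -> R) (u0 v0 vr : R -> R)
    (c T B C1 C2 C3 C3' D1 D2 G M1 M2 C C' : R) p q :
  transport_data lam mu h u0 v0 vr c T B C1 C2 C3 C3' D1 D2 G M1 M2 ->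
  in_box T B C1 C3 C3' p -> in_box T B C1 C3 C3' q ->
  frozen_sol lam mu h u0 v0 vr C T p p -> frozen_sol lam mu h u0 v0 vr C' T q q ->
  forall z, cyl T%:E z -> p.1 z = q.1 z /\ p.2 z = q.2 z.
Proof.
move=> D bp bq [s1 s2 s3 s4 s5] [s1' s2' s3' s4' s5'] z hz.
have [C10 C30 C3'0 C2C3' C2C3] := box_consts D.
pose K := Num.max C C'.
have KC : C <= K by rewrite le_max lexx.
have KC' : C' <= K by rewrite le_max lexx orbT.
have S1 : frozen_sol lam mu h u0 v0 vr K T p p.
  by split => //; [exact: transportedW s1|exact: transportedW s2].
have S2 : frozen_sol lam mu h u0 v0 vr K T q q.
  by split => //; [exact: transportedW s1'|exact: transportedW s2'].
have th0 : 0 <= picard_rate M2 C3 D1.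
  rewrite addr_ge0// !mulr_ge0// ?(td_M2 D)//.
  by rewrite le_max ler01.
have B0 : 0 <= B by exact: le_trans (td_C1B D).
have H n : exp_close T (picard_rate M2 C3 D1) (2 * B * 2^-1 ^+ n) p q.
  elim: n => [|n IH]; first by rewrite expr0 mulr1; exact: (box_exp_close th0 (td_C1B D) bp bq).
  have hp : 0 <= 2 * B * 2^-1 ^+ n by rewrite !mulr_ge0// exprn_ge0// invr_ge0.
  have := frozen_contract D bp bq bp bq S1 S2 hp IH.
  by rewrite exprSr mulrA.
have H0 (x y : R) : (forall n, `|x - y| <= 2 * B * 2^-1 ^+ n *
    expR (picard_rate M2 C3 D1 * z.1)) -> x = y.
  move=> hxy; apply/eqP; rewrite -subr_eq0 -normr_le0.
  apply: (@le_of_half_pow _ _ _ (2 * B * expR (picard_rate M2 C3 D1 * z.1))) => n.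
  by rewrite add0r mulrAC.
by split; apply: H0 => n; have [] := H n z hz.
Qed.

Lemma picard_limit (R : realType) (T th S : R)
    (s : nat -> (R * R -> R) * (R * R -> R)) :
  0 <= T -> 0 <= th -> 0 <= S ->
  (forall n, exp_close T th (S * 2^-1 ^+ n) (s n) (s n.+1)) ->
  exists p, forall n z, cyl T%:E z ->
    `|p.1 z - (s n).1 z| <= 2 * S * expR (th * T) * 2^-1 ^+ n /\
    `|p.2 z - (s n).2 z| <= 2 * S * expR (th * T) * 2^-1 ^+ n.
Proof.
move=> T0 th0 S0 hs.
have hp n : 0 <= 2^-1 ^+ n :> R by rewrite exprn_ge0// invr_ge0.
have close0 q : exp_close T th 0 q q.
  by move=> z _; rewrite !subrr normr0 mul0r.
have closeC S' p q : exp_close T th S' p q -> exp_close T th S' q p.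
  by move=> hpq z hz; rewrite distrC (distrC (q.2 z)); exact: hpq.
have H n k : exp_close T th (2 * S * 2^-1 ^+ n) (s n) (s (n + k)%N).
  apply: (@exp_close_le _ _ _ (2 * S * (2^-1 ^+ n - 2^-1 ^+ (n + k)))).
    by rewrite ler_wpM2l ?mulr_ge0// gerBl.
  elim: k => [|k IH]; first by rewrite addn0 subrr mulr0.
  rewrite addnS; apply: exp_close_le (exp_close_trans IH (hs _)).
  by rewrite exprS le_eqVlt; apply/orP; left; apply/eqP; field.
pose e n (z : R * R) : R := 2 * S * expR (th * T) * 2^-1 ^+ n.
have cl n z : cyl T%:E z -> S * 2^-1 ^+ n * 2 * expR (th * z.1) <= e n z.
  move=> [h1 h2 _]; rewrite lee_fin in h2.
  have -> : e n z = S * 2^-1 ^+ n * 2 * expR (th * T) by rewrite /e; ring.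
  by rewrite ler_wpM2l ?mulr_ge0// ler_expR ler_wpM2l.
have H2 n m z : cyl T%:E z ->
    `|(s n).1 z - (s m).1 z| <= e n z + e m z /\
    `|(s n).2 z - (s m).2 z| <= e n z + e m z.
  wlog nm : n m / (n <= m)%N.
    move=> W hz; have [nm|/ltnW mn] := leqP n m; first exact: W.
    by rewrite distrC (distrC ((s n).2 z)) (addrC (e n z)); exact: W.
  move=> hz; have := H n (m - n)%N; rewrite subnKC// => /(_ z hz)[h1 h2].
  have h3 := cl n z hz.
  have e0 : 0 <= e m z by rewrite /e !mulr_ge0// expR_ge0.
  have h4 : 2 * S * 2^-1 ^+ n * expR (th * z.1) <= e n z + e m z.
    by rewrite (_ : 2 * S * 2^-1 ^+ n = S * 2^-1 ^+ n * 2); [lra|ring].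
  by split; [exact: le_trans h1 h4|exact: le_trans h2 h4].
have [p1 hp1] := @sup_limit _ (R * R) (fun n z => (s n).1 (clamp2 T z)) e
  (fun n m z => proj1 (H2 n m _ (clamp2_cyl z T0))).
have [p2 hp2] := @sup_limit _ (R * R) (fun n z => (s n).2 (clamp2 T z)) e
  (fun n m z => proj2 (H2 n m _ (clamp2_cyl z T0))).
exists (p1, p2) => n z hz; rewrite /=.
by have := hp1 n z; have := hp2 n z; rewrite clamp2E.
Qed.

(** The Picard iterates form a geometric series; bounds, slopes, boundary values and the
    transport relation all pass to the limit. *)
Lemma nonlinear_exists (R : realType) (lam mu h : R * R -> R) (u0 v0 vr : R -> R)
    (c T B C1 C2 C3 C3' D1 D2 G M1 M2 : R) :
  transport_data lam mu h u0 v0 vr c T B C1 C2 C3 C3' D1 D2 G M1 M2 ->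
  exists C p, in_box T B C1 C3 C3' p /\ frozen_sol lam mu h u0 v0 vr C T p p.
Proof.
move=> D; have c0 := td_c D; have T0 := td_T D; have M20 := td_M2 D.
have [C10 C30 C3'0 C2C3' C2C3] := box_consts D.
have [C HC] := frozen_exists D; exists C.
have B0 : 0 <= B by exact: le_trans (td_C1B D).
pose p0 : (R * R -> R) * (R * R -> R) := (fun z => u0 z.2, fun z => v0 z.2).
have bp0 : in_box T B C1 C3 C3' p0.
  have H (f : R -> R) M : C2 <= M -> (forall x y : R, 0 <= x <= 1 -> 0 <= y <= 1 ->
      `|f x - f y| <= C2 * `|x - y|) -> Lip2 M (cyl T%:E) (fun z => f z.2).
    move=> CM fL [t x] [t' x'] [_ _ /= hx] [_ _ /= hx'].
    rewrite (le_trans (fL _ _ hx hx'))//.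
    apply: (@le_trans _ _ (M * `|x - x'|)); first by rewrite ler_wpM2r.
    by rewrite ler_wpM2l// ?lerDr//; have := td_C2 D; lra.
  split => /=.
  - by move=> z [_ _ hz]; exact: le_trans (td_u0B D hz) (td_C1B D).
  - by move=> z [_ _ hz]; exact: (td_v0B D hz).
  - exact: H (td_u0L D).
  - exact: H (td_v0L D).
(* iteration needs a map defined on all pairs *)
have /choice[F HF] : forall p, exists q, in_box T B C1 C3 C3' p ->
    in_box T B C1 C3 C3' q /\ frozen_sol lam mu h u0 v0 vr C T p q.
  move=> p; have [/HC[q hq]|np] := pselect (in_box T B C1 C3 C3' p).
    by exists q.
  by exists p.
pose s n := iter n F p0.
have bs n : in_box T B C1 C3 C3' (s n).
  by elim: n => [//|n IH]; have [] := HF _ IH.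
have fs n : frozen_sol lam mu h u0 v0 vr C T (s n) (s n.+1).
  by have [] := HF _ (bs n).
set th := picard_rate M2 C3 D1.
have th0 : 0 <= th.
  by rewrite addr_ge0// !mulr_ge0// le_max ler01.
have hp n : 0 <= 2^-1 ^+ n :> R by rewrite exprn_ge0// invr_ge0.
have cs n : exp_close T th (2 * B * 2^-1 ^+ n) (s n) (s n.+1).
  elim: n => [|n IH].
    by rewrite expr0 mulr1; exact: (box_exp_close th0 (td_C1B D) (bs 0%N) (bs 1%N)).
  rewrite exprSr mulrA.
  apply: (frozen_contract D (bs _) (bs _) (bs _) (bs _) (fs _) (fs _) _ IH).
  by rewrite !mulr_ge0.
have [p Hp] := picard_limit T0 th0 (mulr_ge0 (ler0n _ 2) B0) cs.
set K := 2 * (2 * B) * expR (th * T) in Hp.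
have K0 : 0 <= K by rewrite !mulr_ge0// expR_ge0.
have lipl M (f : R * R -> R) (fn : nat -> R * R -> R) :
    (forall n z, cyl T%:E z -> `|f z - fn n z| <= K * 2^-1 ^+ n) ->
    (forall n, Lip2 M (cyl T%:E) (fn n)) -> Lip2 M (cyl T%:E) f.
  move=> hf hL z1 z2 h1 h2; apply: (@le_of_half_pow _ _ _ (2 * K)) => n.
  have := hf n _ h1; have := hf n _ h2; have := hL n _ _ h1 h2.
  by rewrite -mulrA !ler_norml; lra.
have bdl M (f : R * R -> R) (fn : nat -> R * R -> R) :
    (forall n z, cyl T%:E z -> `|f z - fn n z| <= K * 2^-1 ^+ n) ->
    (forall n z, cyl T%:E z -> `|fn n z| <= M) -> forall z, cyl T%:E z -> `|f z| <= M.
  move=> hf hL z hz; apply: (@le_of_half_pow _ _ _ K) => n.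
  have := hf n _ hz; have := hL n _ hz.
  by rewrite !ler_norml; lra.
have P1 n z (hz : cyl T%:E z) := proj1 (Hp n z hz).
have P2 n z (hz : cyl T%:E z) := proj2 (Hp n z hz).
have bp : in_box T B C1 C3 C3' p.
  split.
  - by apply: bdl P1 _ => n; case: (bs n).
  - by apply: bdl P2 _ => n; case: (bs n).
  - by apply: lipl P1 _ => n; case: (bs n).
  - by apply: lipl P2 _ => n; case: (bs n).
exists p; split => //.
have [_ _ lc mc] := frozen_speeds D bp.
pose K' := K + 2 * M2 * K.
have K'n n : K * 2^-1 ^+ n <= K' * 2^-1 ^+ n.
  by rewrite ler_wpM2r// lerDl !mulr_ge0.
have P1' n z : cyl T%:E z -> `|p.1 z - (s n.+1).1 z| <= K' * 2^-1 ^+ n.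
  move=> hz; rewrite (le_trans (P1 n.+1 z hz))// (le_trans _ (K'n n))//.
  by rewrite ler_wpM2l// exprS ler_piMl// invf_le1// ler1n.
have P2' n z : cyl T%:E z -> `|p.2 z - (s n.+1).2 z| <= K' * 2^-1 ^+ n.
  move=> hz; rewrite (le_trans (P2 n.+1 z hz))// (le_trans _ (K'n n))//.
  by rewrite ler_wpM2l// exprS ler_piMl// invf_le1// ler1n.
have dist (f : R * R -> R) : (forall u v u' v' : R, `|u| <= B -> `|v| <= C1 -> `|u'| <= B ->
    `|v'| <= C1 -> `|f (u, v) - f (u', v')| <= M2 * (`|u - u'| + `|v - v'|)) ->
    forall n z, cyl T%:E z -> `|f (p.1 z, p.2 z) - f ((s n).1 z, (s n).2 z)| <=
      K' * 2^-1 ^+ n.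
  move=> fL n z hz; case: bp => b1 b2 _ _; case: (bs n) => c1 c2 _ _.
  rewrite (le_trans (fL _ _ _ _ (b1 _ hz) (b2 _ hz) (c1 _ hz) (c2 _ hz)))//.
  apply: (@le_trans _ _ (M2 * (K * 2^-1 ^+ n + K * 2^-1 ^+ n))).
    by rewrite ler_wpM2l// lerD// ?P1 ?P2.
  have : 0 <= K * 2^-1 ^+ n by rewrite mulr_ge0.
  by rewrite /K'; lra.
have lim_eq (x y K1 : R) (f : nat -> R) : (forall n, `|x - f n| <= K1 * 2^-1 ^+ n) ->
    (forall n, `|y - f n| <= K1 * 2^-1 ^+ n) -> x = y.
  move=> hx hy; apply/eqP; rewrite -subr_eq0 -normr_le0.
  apply: (@le_of_half_pow _ _ _ (2 * K1)) => n.
  by have := hx n; have := hy n; rewrite -mulrA !ler_norml; lra.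
have cylt (t x : R) : 0 <= t <= T -> 0 <= x <= 1 -> cyl T%:E (t, x).
  by move=> /andP[t0 tT] hx; split.
have z01 : 0 <= (0 : R) <= 1 by rewrite lexx ler01.
have o01 : 0 <= (1 : R) <= 1 by rewrite lexx ler01.
split.
- apply: (@transported_limit _ C T c C3 K' _ _ (fun n z => lam ((s n).1 z, (s n).2 z))
    (fun n => (s n.+1).1) c0 C30 (dist _ (td_lamL D)) P1').
  + by move=> z /lc/andP[].
  + by move=> n z hz; exact: (td_lam D).
  + by move=> n; case: (bs n.+1).
  + by move=> n; case: (fs n).
- apply: (@transported_limit _ C T c C3 K' _ _
    (fun n => flip (fun z => - mu ((s n).1 z, (s n).2 z)))
    (fun n => flip (s n.+1).2) c0 C30).
  + move=> n z /flip_cyl hz; have := dist _ (td_muL D) n _ hz.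
    by rewrite /flip /= -opprD normrN.
  + by move=> n z /flip_cyl hz; exact: P2'.
  + by move=> z /mc/andP[].
  + by move=> n z hz; rewrite /flip lerNr (td_mu D).
  + move=> n; apply: Lip2_flip; apply: (Lip2W (td_C3'3 D)).
    by case: (bs n.+1).
  + by move=> n; case: (fs n).
- move=> t ht; have hz := cylt _ _ ht z01; have /andP[t0 _] := ht.
  apply: (@lim_eq _ _ ((1 + D1) * K') (fun n => (s n.+1).1 (t, 0))) => n.
    rewrite (le_trans (P1' n _ hz))// ler_wpM2r// ler_peMl ?lerDl ?(td_D1 D)//.
    by rewrite /K' addr_ge0// !mulr_ge0.
  case: (fs n) => _ _ -> // _ _; case: bp => _ b2 _ _; case: (bs n.+1) => _ b2' _ _.
  rewrite (le_trans (td_hL D (b2 _ hz) t0 (b2' _ hz) t0))//.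
  rewrite subrr normr0 mulr0 addr0 -mulrA.
  apply: (@le_trans _ _ (D1 * (K' * 2^-1 ^+ n))).
    by rewrite ler_wpM2l ?(td_D1 D)// P2'.
  rewrite ler_wpM2r ?lerDr// mulr_ge0// /K' addr_ge0// !mulr_ge0//.
- move=> t ht; have hz := cylt _ _ ht o01.
  apply: (@lim_eq _ _ K' (fun n => (s n.+1).2 (t, 1))) => n; first exact: P2'.
  case: (fs n) => _ _ _ -> // _.
  by rewrite subrr normr0 mulr_ge0// /K' addr_ge0// !mulr_ge0.
- move=> x hx; have hz : cyl T%:E (0, x) by apply: cylt => //; rewrite lexx.
  split.
    apply: (@lim_eq _ _ K' (fun n => (s n.+1).1 (0, x))) => n; first exact: P1'.
    case: (fs n) => _ _ _ _ /(_ _ hx)[-> _].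
    by rewrite subrr normr0 mulr_ge0// /K' addr_ge0// !mulr_ge0.
  apply: (@lim_eq _ _ K' (fun n => (s n.+1).2 (0, x))) => n; first exact: P2'.
  case: (fs n) => _ _ _ _ /(_ _ hx)[_ ->].
  by rewrite subrr normr0 mulr_ge0// /K' addr_ge0// !mulr_ge0.
Qed.

(** The second component is empty once its boundary value has been zero for a time
    [1 / c]; the boundary value of the first one is then [h (0, t)], which is zero, and
    it takes another [1 / c] to empty the interval. *)
Lemma nonlinear_extinct (R : realType) (lam mu h : R * R -> R) (u0 v0 vr : R -> R)
    (c T B C1 C2 C3 C3' D1 D2 G M1 M2 C Tr Th : R) p :
  transport_data lam mu h u0 v0 vr c T B C1 C2 C3 C3' D1 D2 G M1 M2 ->
  in_box T B C1 C3 C3' p -> frozen_sol lam mu h u0 v0 vr C T p p ->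
  0 <= Tr -> 0 <= Th ->
  (forall t : R, Tr <= t <= T -> vr t = 0) ->
  (forall t : R, Th <= t -> h (0, t) = 0) ->
  T = c^-1 + Num.max Th (c^-1 + Tr) ->
  forall x : R, 0 <= x <= 1 -> p.1 (T, x) = 0 /\ p.2 (T, x) = 0.
Proof.
move=> D bp [s1 s2 s3 s4 s5] Tr0 Th0 vr0 h0 TE.
have [C10 C30 C3'0 C2C3' C2C3] := box_consts D.
have c0 := td_c D; have T0 := td_T D.
have [_ _ lc mc] := frozen_speeds D bp; case: bp => _ _ b3 b4.
have ci0 : 0 < c^-1 by rewrite invr_gt0.
set m := Num.max Th (c^-1 + Tr) in TE.
have mTh : Th <= m by rewrite le_max lexx.
have mTr : c^-1 + Tr <= m by rewrite le_max lexx orbT.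
have xc (x : R) : 0 <= x <= 1 -> x / c <= c^-1.
  by move=> /andP[_ x1]; rewrite ler_piMl// ltW.
have v0' t x : Tr + c^-1 <= t -> t <= T -> 0 <= x <= 1 -> p.2 (t, x) = 0.
  move=> ht tT x01; rewrite -flipE.
  have hx' : 0 <= 1 - x <= 1 by lra.
  apply: (transport_extinct c0 T0 Tr0 _ s2 _ _ _ tT hx').
  - by move=> z /mc/andP[].
  - by exists C3'; exact: Lip2_flip.
  - move=> s hs; rewrite /flip /= subr0 s4 ?vr0//; lra.
  - by have := xc _ hx'; lra.
move=> x hx; split; last by apply: v0' => //; lra.
apply: (@transport_extinct _ _ _ c C T m c0 T0 _ _ s1 _ _ _ _ _ _ hx) => //.
- by lra.
- by move=> z /lc/andP[].
- by exists C3.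
- move=> t ht; rewrite s3; last lra.
  rewrite v0' ?h0//; lra.
- by have := xc _ hx; lra.
Qed.

(** * Lipschitz functions as integrals of their derivatives *)

Definition cumul (R : realType) (f : R -> R) (nd : {homo f : x y / x <= y})
  (rc : right_continuous f) : R -> R := f.

HB.instance Definition _ (R : realType) (f : R -> R)
  (nd : {homo f : x y / x <= y}) (rc : right_continuous f) :=
  isCumulative.Build R _ R (cumul nd rc) nd rc.

Lemma lebesgue_stieltjes_itv (R : realType) (f : cumulative R R) (a b : R) :
  a <= b -> lebesgue_stieltjes_measure f `]a, b]%classic = (f b - f a)%:E.
Proof.
move=> ab; rewrite /lebesgue_stieltjes_measure /measure_extension/=.
rewrite measurable_mu_extE/=; last exact: is_ocitv.
by rewrite wlength_itv_bnd.
Qed.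

(** The Stieltjes measures of [F] and [G] add up to [c] times the Lebesgue measure, so
    each is dominated by it. *)
Lemma stieltjes_dominated (R : realType) (F G : cumulative R R) (c : R) :
  0 <= c -> (forall x, F x + G x = c * x) ->
  forall A, measurable A -> lebesgue_measure A = 0%E ->
  lebesgue_stieltjes_measure F A = 0%E.
Proof.
move=> c0 FG A mA A0.
have nd : {homo (fun x : R => c * x) : x y / x <= y}.
  by move=> x y xy; exact: ler_wpM2l.
have rc : right_continuous (fun x : R => c * x).
  apply: right_continuousW => x.
  by apply: cvgM; [exact: cvg_cst|exact: cvg_id].
pose H : cumulative R R := cumul nd rc.
have HE x : H x = c * x by [].
pose cn : {nonneg R} := NngNum c0.
have hX (a b : R) : b <= a -> `]a, b]%classic = set0 :> set R.
  by move=> ba; rewrite set_itv_ge// bnd_simp -leNgt.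
have h1 : lebesgue_stieltjes_measure H A =
   measure_add (lebesgue_stieltjes_measure F) (lebesgue_stieltjes_measure G) A.
  apply: lebesgue_stieltjes_measure_unique => // _ [[a b] _ <-] /=.
  have [ab|/ltW ba] := leP a b; last by rewrite (hX _ _ ba) !measure0.
  rewrite [RHS]measure_addE.
  apply: etrans (lebesgue_stieltjes_itv H ab) _; apply: esym.
  apply: etrans (congr2 adde (lebesgue_stieltjes_itv F ab) (lebesgue_stieltjes_itv G ab)) _.
  have e : F b - F a + (G b - G a) = H b - H a by rewrite !HE -!FG; ring.
  exact: (congr1 EFin e).
have h2 : lebesgue_stieltjes_measure H A = mscale cn lebesgue_measure A.
  apply: lebesgue_stieltjes_measure_unique => // _ [[a b] _ <-] /=.
  have [ab|/ltW ba] := leP a b; last by rewrite (hX _ _ ba) !measure0.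
  apply: etrans (lebesgue_stieltjes_itv H ab) _; rewrite /mscale/= lebesgue_measure_itv/= lte_fin.
  case: ltP => ab'.
    by rewrite -EFinB -EFinM; congr (_%:E); rewrite !HE; ring.
  by have -> : b = a by [apply/eqP; rewrite eq_le ab ab']; rewrite subrr mule0.
have : (lebesgue_stieltjes_measure F A + lebesgue_stieltjes_measure G A = 0)%E.
  rewrite -measure_addE; apply: (etrans (esym h1)).
  by rewrite h2 /mscale/= A0 mule0.
move=> h3; apply/eqP; rewrite eq_le measure_ge0 andbT -h3.
by rewrite leeDl// measure_ge0.
Qed.

Lemma bounded_integrable d (T : measurableType d) (R : realType)
    (mu : {measure set T -> \bar R}) (D : set T) (f : T -> R) (M : R) :
  measurable D -> (mu D < +oo)%E -> measurable_fun D f ->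
  (forall x, D x -> `|f x| <= M) -> mu.-integrable D (EFin \o f).
Proof.
move=> mD Doo mf fM; apply: measurable_bounded_integrable => //.
by exists M; split; [exact: num_real|move=> K MK x Dx; exact: le_trans (fM _ Dx) (ltW MK)].
Qed.

Lemma lipschitz_continuous (R : realType) (f : R -> R) (M : R) :
  (forall x y, `|f x - f y| <= M * `|x - y|) -> continuous f.
Proof.
move=> fL x; apply/cvgrPdist_le => e e0.
pose K := Num.max M 1.
have K1 : 1 <= K by rewrite /K le_max lexx orbT.
have MK : M <= K by rewrite /K le_max lexx.
near=> y; rewrite (le_trans (fL _ _))// (le_trans (ler_wpM2r _ MK))//.
rewrite mulrC -ler_pdivlMr; last lra.
near: y; apply: cvgr_dist_le; last by rewrite divr_gt0//; lra.
exact: cvg_id.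
Unshelve. all: by end_near. Qed.

(** Both [M * x + f x] and [M * x - f x] are nondecreasing, and their Stieltjes measures
    add up to a multiple of the Lebesgue measure. The first one thus has a density by
    Radon-Nikodym, and Lebesgue differentiation identifies it with [M] plus the
    derivative of [f]. *)
Lemma lipschitz_FTC (R : realType) (f : R -> R) (M A B : R) : 0 <= M -> A < B ->
  (forall x y, `|f x - f y| <= M * `|x - y|) ->
  exists k : R -> R, [/\ (@lebesgue_measure R).-integrable `]A, B] (EFin \o k),
    {ae @lebesgue_measure R, forall x, A < x -> x < B -> is_derive x 1 f (k x)} &
    (\int[@lebesgue_measure R]_(x in `]A, B]) k x = f B - f A)%R].
Proof.
move=> M0 AB fL; have fc := lipschitz_continuous fL.
have cMx : continuous (fun x : R => M * x).
  by move=> x; apply: cvgM; [exact: cvg_cst|exact: cvg_id].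
have ndF : {homo (fun x => M * x + f x) : x y / x <= y}.
  move=> x y xy; have := fL x y; rewrite distrC (distrC x) (ger0_norm (_ : 0 <= y - x)) ?subr_ge0//.
  by rewrite ler_norml; lra.
have ndG : {homo (fun x => M * x - f x) : x y / x <= y}.
  move=> x y xy; have := fL x y; rewrite distrC (distrC x) (ger0_norm (_ : 0 <= y - x)) ?subr_ge0//.
  by rewrite ler_norml; lra.
have rcF : right_continuous (fun x => M * x + f x).
  by apply: right_continuousW => x; apply: cvgD; [exact: cMx|exact: fc].
have rcG : right_continuous (fun x => M * x - f x).
  by apply: right_continuousW => x; apply: cvgB; [exact: cMx|exact: fc].
pose F : cumulative R R := cumul ndF rcF.
pose G : cumulative R R := cumul ndG rcG.
have FE x : F x = M * x + f x by [].
have FG x : F x + G x = 2 * M * x.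
  by rewrite FE (_ : G x = M * x - f x)//; ring.
have dom := stieltjes_dominated (mulr_ge0 (ler0n _ 2) M0) FG.
pose E : set R := `]A, B]%classic.
have mE : measurable (E : set (measurableTypeR R)) by exact: measurable_itv.
have Foo : (lebesgue_stieltjes_measure F E < +oo)%E.
  by rewrite (lebesgue_stieltjes_itv F (ltW AB)) ltry.
pose nu : {finite_measure set (measurableTypeR R) -> \bar R} := mfrestr mE Foo.
(* absolute continuity of the Stieltjes measure of F, restricted to E *)
have numu : nu `<< @lebesgue_measure R.
  apply/null_content_dominatesP => S mS S0.
  rewrite /nu /mfrestr /= /mrestr /=; apply: dom; first exact: measurableI.
  apply/eqP; rewrite eq_le measure_ge0 andbT -S0 le_measure// inE//.
  exact: measurableI.
have [g [g0 gfin ig nuE]] := radon_nikodym_sigma_finite numu.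
pose k0 x := fine (g x).
have k0E : EFin \o k0 = g by apply/funext => x; rewrite /= fineK.
have ik0 D : measurable D -> (@lebesgue_measure R).-integrable D (EFin \o k0).
  by move=> mD; rewrite k0E; apply: integrableS ig.
pose P y := (\int[@lebesgue_measure R]_(t in `]A, y]) k0 t)%R.
(* the primitive of the density is the increment of F *)
have PE y : A <= y -> y <= B -> P y = M * (y - A) + (f y - f A).
  move=> Ay yB; rewrite /P /Rintegral.
  have : nu `]A, y]%classic = ((M * y + f y) - (M * A + f A))%:E.
    have -> : nu `]A, y]%classic = lebesgue_stieltjes_measure F (`]A, y]%classic `&` E).
      by [].
    have -> : `]A, y]%classic `&` E = `]A, y]%classic.
      by apply/setIidPl; apply: subset_itvl; rewrite bnd_simp.
    by rewrite (lebesgue_stieltjes_itv F Ay).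
  rewrite nuE//.
  by rewrite -k0E => -> /=; ring.
have lk0 : locally_integrable setT k0.
  by apply: open_integrable_locally; [exact: openT|exact: ik0].
have P' := FTC1 (fun y => ik0 _ (measurable_itv (Interval (BRight A) (BRight y)))) lk0.
have ABoo : (@lebesgue_measure R `]A, B] < +oo)%E.
  by rewrite lebesgue_measure_itv/= lte_fin AB -EFinB ltry.
have icM : (@lebesgue_measure R).-integrable `]A, B] (EFin \o cst M).
  apply: (@bounded_integrable _ _ _ _ _ _ `|M|) => //; exact: measurable_itv.
exists (fun x => k0 x - M); split.
- have -> : EFin \o (fun x => k0 x - M) = ((EFin \o k0) \- (EFin \o cst M))%E.
    by apply/funext => x.
  by apply: integrableB => //; first exact: ik0.
- apply: (@filterS _ _ (ae_filter_ringOfSetsType (@lebesgue_measure R)) _ _ _ P') => x /= hx Ax xB.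
  have [|dx dxE] := hx _; first by rewrite lte_fin.
  have dP : is_derive x 1 P (k0 x).
    by apply: DeriveDef; [exact: dx|rewrite -dxE derive1E].
  have dH : is_derive x 1 (fun y => f A - M * (y - A) + P y) (k0 x - M).
    by apply: is_derive_eq; rewrite subr0 [_ *: _]mulr1; ring.
  apply: near_eq_is_derive dH; near=> y.
  rewrite PE; [ring| |].
    by apply/ltW; near: y; apply: lt_nbhsr.
  by apply/ltW; near: y; apply: lt_nbhsl.
- rewrite (@RintegralB _ _ _ _ _ k0 (cst M))//; last exact: ik0.
  rewrite Rintegral_cst// -/(P B) PE// ?(ltW AB)//.
  rewrite [X in fine X](_ : _ = (B - A)%:E) /=; first by ring.
  by rewrite lebesgue_measure_itv/= lte_fin AB -EFinB.
Unshelve. all: by end_near. Qed.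

(** * Measurability and Fubini on rectangles *)

(** An open set is a countable union of squares with rational centres. *)
Lemma open_measurable2 (R : realType) (U : set (R * R)) :
  open U -> measurable (U : set (measurableTypeR R * measurableTypeR R)).
Proof.
move=> oU.
pose r n : R := n.+1%:R^-1.
pose S (q p : rat) (n : nat) : set (measurableTypeR R * measurableTypeR R) :=
  if pselect (ball (ratr q : R, ratr p : R) (r n) `<=` U) is left _
  then ball (ratr q : R) (r n) `*` ball (ratr p : R) (r n) else set0.
have mS q p n : measurable (S q p n).
  rewrite /S; case: pselect => _; last exact: measurable0.
  by apply: measurableX; rewrite ball_itv; exact: measurable_itv.
have -> : U = \bigcup_q \bigcup_p \bigcup_n S q p n.
  apply/seteqP; split => [z Uz|z [q _ [p _ [n _]]]]; last first.
    by rewrite /S; case: pselect => // h [h1 h2]; apply: h.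
  have [e /= e0 he] : exists2 e : R, 0 < e & ball z e `<=` U.
    by have /nbhs_ballP[e /= e0 he] := open_nbhs_nbhs (conj oU Uz); exists e.
  have [n hn] : exists n, r n < e / 2.
    have e20 : 0 < e / 2 by rewrite divr_gt0.
    exists (Num.bound (e / 2)^-1); rewrite /r invf_plt ?posrE ?ltr0n//.
    rewrite (lt_le_trans (archi_boundP _)) ?invr_ge0 ?(ltW e20)//.
    by rewrite ler_nat.
  have r0 : 0 < r n by rewrite invr_gt0 ltr0n.
  have H (y : R) : exists q : rat, `|ratr q - y| < r n.
    have [q] := @rat_in_itvoo R (y - r n) (y + r n) ltac:(lra).
    rewrite in_itv/= => /andP[h1 h2]; exists q; rewrite ltr_norml; lra.
  have [q hq] := H z.1; have [p hp] := H z.2.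
  exists q => //; exists p => //; exists n => //; rewrite /S.
  case: pselect => [_|[]]; first by split.
  move=> [y1 y2] [/= h1 h2]; apply: he; split; rewrite /= /ball/= in h1 h2 *.
    rewrite (le_lt_trans (ler_distD (ratr q) _ _))// (distrC z.1); lra.
  rewrite (le_lt_trans (ler_distD (ratr p) _ _))// (distrC z.2); lra.
apply: bigcupT_measurable_rat => q; apply: bigcupT_measurable_rat => p.
exact: bigcupT_measurable.
Qed.

Lemma continuous_measurable2 (R : realType) (f : R * R -> R) :
  continuous f ->
  measurable_fun (setT : set (measurableTypeR R * measurableTypeR R)) f.
Proof.
move=> cf; apply: (measurability _ (RGenOInfty.measurableE R)).
move=> _ [_ [x ->] <-]; rewrite setTI; apply: open_measurable2.
by apply: open_comp; [move=> z _; exact: cf|exact: interval_open].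
Qed.

Lemma rect_fubini (R : realType) (A B : set R) (f : R * R -> R) (M : R) :
  measurable (A : set (measurableTypeR R)) ->
  measurable (B : set (measurableTypeR R)) ->
  (lebesgue_measure A < +oo)%E -> (lebesgue_measure B < +oo)%E ->
  measurable_fun (setT : set (measurableTypeR R * measurableTypeR R)) f ->
  (forall z, `|f z| <= M) ->
  \int[@leb2 R]_(z in A `*` B) f z =
    \int[@leb1 R]_(t in A) \int[@leb1 R]_(x in B) f (t, x) /\
  \int[@leb2 R]_(z in A `*` B) f z =
    \int[@leb1 R]_(x in B) \int[@leb1 R]_(t in A) f (t, x).
Proof.
move=> mA mB Aoo Boo mf fM.
pose D : set (measurableTypeR R * measurableTypeR R) := A `*` B.
have mD : measurable D by exact: measurableX.
have Doo : (@leb2 R D < +oo)%E.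
  rewrite [X in (X < _)%E](product_measure1E _ _ mA mB).
  by rewrite lte_mul_pinfty// ge0_fin_numE.
have fD : (@leb2 R).-integrable D (EFin \o f).
  by apply: (@bounded_integrable _ _ _ _ _ _ M) => //; exact: measurable_funTS.
have fT : (@leb2 R).-integrable setT (EFin \o (f \_ D)).
  by rewrite -restrict_EFin; apply/(integrable_mkcond _ mD).
have mfT : measurable_fun setT (f \_ D).
  by apply/(measurable_restrictT _ mD); exact: measurable_funTS.
have mt t : measurable_fun (setT : set (measurableTypeR R)) (fun x => f (t, x)).
  exact: measurable_fun_pair2.
have mx x : measurable_fun (setT : set (measurableTypeR R)) (fun t => f (t, x)).
  exact: measurable_fun_pair1.
have it t : (@leb1 R).-integrable B (EFin \o (fun x => f (t, x))).
  by apply: (@bounded_integrable _ _ _ _ _ _ M) => //; exact: measurable_funTS.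
have ix x : (@leb1 R).-integrable A (EFin \o (fun t => f (t, x))).
  by apply: (@bounded_integrable _ _ _ _ _ _ M) => //; exact: measurable_funTS.
have e0 : \int[@leb2 R]_(z in A `*` B) f z = fine (\int[@leb2 R]_z (f \_ D z)%:E)%E.
  by rewrite Rintegral_mkcond.
rewrite e0; split.
  rewrite -(integral12_prod_meas1 fT) /Rintegral [in RHS]integral_mkcond.
  congr fine; apply: eq_integral => t _; rewrite /fubini_F patchE.
  case: ifPn => tA.
    rewrite fineK; last by exact: (integrable_fin_num mB (it t)).
    rewrite [RHS]integral_mkcond; apply: eq_integral => x _.
    rewrite /= !patchE.
    have [xB|xB] := boolP (x \in B).
      by rewrite mem_set//; split; apply: set_mem.
    by rewrite memNset// => -[_ /= /mem_set]; rewrite (negbTE xB).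
  apply: integral0_eq => x _; rewrite /= patchE memNset//.
  by move=> [/= /mem_set]; rewrite (negbTE tA).
rewrite -(integral21_prod_meas1 fT) /Rintegral [in RHS]integral_mkcond.
congr fine; apply: eq_integral => x _; rewrite /fubini_G patchE.
case: ifPn => xB.
  rewrite fineK; last by exact: (integrable_fin_num mA (ix x)).
  rewrite [RHS]integral_mkcond; apply: eq_integral => t _.
  rewrite /= !patchE.
  have [tA|tA] := boolP (t \in A).
    by rewrite mem_set//; split; apply: set_mem.
  by rewrite memNset// => -[/= /mem_set]; rewrite (negbTE tA).
apply: integral0_eq => t _; rewrite /= patchE memNset//.
by move=> [_ /= /mem_set]; rewrite (negbTE xB).
Qed.

(** * Integration by parts with a Lipschitz factor *)

Lemma mvt_lip (R : realType) (g g' : R -> R) (A B K : R) :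
  (forall x : R, A < x -> x < B -> is_derive x 1 g (g' x)) ->
  {within `[A, B], continuous g} ->
  (forall x : R, A < x -> x < B -> `|g' x| <= K) ->
  forall x y : R, A <= x -> x <= B -> A <= y -> y <= B ->
  `|g x - g y| <= K * `|x - y|.
Proof.
move=> dg cg gK x y.
wlog xy : x y / x < y.
  move=> H Ax xB Ay yB; case: (ltgtP x y) => [xy|yx|->].
  - exact: H.
  - by rewrite distrC (distrC x) H.
  - by rewrite !subrr normr0 mulr0.
move=> Ax xB Ay yB.
have [||z] := @MVT _ g g' x y xy.
- by move=> z; rewrite in_itv/= => /andP[h1 h2]; apply: dg; lra.
- apply: continuous_subspaceW cg => z /=; rewrite !in_itv/= => /andP[h1 h2].
  by apply/andP; split; lra.
rewrite in_itv/= => /andP[h1 h2] e.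
rewrite distrC e normrM (distrC x) ler_wpM2r//.
by apply: gK; lra.
Qed.

(** The product with a factor that vanishes at both ends is Lipschitz, hence its
    derivative has integral zero. *)
Lemma ibp_lipschitz (R : realType) (f g g' k : R -> R) (M A B P : R) :
  0 <= M -> A < B -> (forall x y, `|f x - f y| <= M * `|x - y|) ->
  (forall x : R, is_derive x 1 g (g' x)) -> continuous g' -> g A = 0 -> g B = 0 ->
  measurable_fun (setT : set (measurableTypeR R)) k -> (forall x, `|k x| <= P) ->
  {ae @lebesgue_measure R, forall x, A < x -> x < B ->
     forall l, is_derive x 1 f l -> k x = l} ->
  \int[@leb1 R]_(x in `]A, B[) (f x * g' x) =
  - \int[@leb1 R]_(x in `]A, B[) (k x * g x).
Proof.
move=> M0 AB fL dg cg' gA gB mk kP kE.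
have cg : continuous g.
  by move=> x; apply/differentiable_continuous/derivable1_diffP; case: (dg x).
have cf := lipschitz_continuous fL.
have cng : {within `[A, B], continuous (fun x => `|g' x|)}.
  apply: continuous_subspaceT => x; apply: continuous_comp; first exact: cg'.
  exact: norm_continuous.
have [c0 _ hc0] := EVT_max (ltW AB) cng.
set G := `|g' c0| in hc0.
have G0 : 0 <= G by exact: normr_ge0.
have gL x y : A <= x -> x <= B -> A <= y -> y <= B -> `|g x - g y| <= G * `|x - y|.
  apply: (@mvt_lip _ g g') => //; first by apply: continuous_subspaceT.
  by move=> z h1 h2; apply: hc0; rewrite in_itv/= !ltW.
have gb x : A <= x -> x <= B -> `|g x| <= G * (B - A).
  move=> Ax xB; have := gL x A Ax xB (lexx _) (ltW AB).
  rewrite gA subr0 => /le_trans; apply; rewrite ler_wpM2l// ger0_norm; lra.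
pose F0 := `|f A| + M * (B - A).
have fb x : A <= x -> x <= B -> `|f x| <= F0.
  move=> Ax xB; have := fL x A; rewrite (ger0_norm (_ : 0 <= x - A)) ?subr_ge0// => h.
  have h' : M * (x - A) <= M * (B - A) by rewrite ler_wpM2l//; lra.
  rewrite /F0 -[f x](subrK (f A)) (le_trans (ler_normD _ _))//; lra.
have F00 : 0 <= F0 by rewrite /F0 addr_ge0// mulr_ge0//; lra.
(* g is Lipschitz on [A, B] only, hence the clipping of the argument *)
pose cl x := Num.max A (Num.min x B).
have clA x : A <= cl x by rewrite le_max lexx.
have clB x : cl x <= B by rewrite ge_max (ltW AB) ge_min lexx orbT.
have clL x y : `|cl x - cl y| <= `|x - y|.
  exact: clip_lip.
have clE x : A <= x -> x <= B -> cl x = x.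
  by move=> h1 h2; rewrite /cl min_l// max_r.
pose F x := f (cl x) * g (cl x).
pose N := F0 * G + G * (B - A) * M.
have N0 : 0 <= N by rewrite /N addr_ge0// !mulr_ge0//; lra.
have FL x y : `|F x - F y| <= N * `|x - y|.
  apply: (@le_trans _ _ (N * `|cl x - cl y|)); last by rewrite ler_wpM2l.
  rewrite /F (_ : _ - _ = f (cl x) * (g (cl x) - g (cl y)) +
    g (cl y) * (f (cl x) - f (cl y))); last by ring.
  rewrite (le_trans (ler_normD _ _))// !normrM /N mulrDl lerD// -mulrA ler_pM//.
  + exact: fb.
  + exact: gL.
  + exact: gb.
have [kf [_ dkf _]] := lipschitz_FTC M0 AB fL.
have [kF [ikF dkF ikFE]] := lipschitz_FTC N0 AB FL.
have FA : F B - F A = 0 by rewrite /F !clE ?gA ?gB ?mulr0 ?subrr// ltW.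
have mI : measurable (`]A, B] : set (measurableTypeR R)) by exact: measurable_itv.
have Ioo : (@lebesgue_measure R `]A, B] < +oo)%E.
  by rewrite lebesgue_measure_itv/= lte_fin AB -EFinB ltry.
have mg' : measurable_fun (setT : set (measurableTypeR R)) g'.
  exact: measurable_realfun.continuous_measurable_fun.
have mg : measurable_fun (setT : set (measurableTypeR R)) g.
  exact: measurable_realfun.continuous_measurable_fun.
have mf : measurable_fun (setT : set (measurableTypeR R)) f.
  exact: measurable_realfun.continuous_measurable_fun.
have i1 : (@lebesgue_measure R).-integrable `]A, B] (EFin \o (fun x => f x * g' x)).
  apply: (@bounded_integrable _ _ _ _ _ _ (F0 * G)) => //.
    by apply: measurable_funTS; exact: measurable_funM.
  move=> x /=; rewrite in_itv/= => /andP[h1 h2]; rewrite normrM ler_pM//.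
    by apply: fb; lra.
  by apply: hc0; rewrite in_itv/=; lra.
have i2 : (@lebesgue_measure R).-integrable `]A, B] (EFin \o (fun x => k x * g x)).
  apply: (@bounded_integrable _ _ _ _ _ _ (P * (G * (B - A)))) => //.
    by apply: measurable_funTS; exact: measurable_funM.
  move=> x /=; rewrite in_itv/= => /andP[h1 h2]; rewrite normrM ler_pM//.
  by apply: gb; lra.
have oc (h : R -> R) : (@lebesgue_measure R).-integrable `]A, B] (EFin \o h) ->
    \int[@leb1 R]_(x in `]A, B[) h x = \int[@leb1 R]_(x in `]A, B]) h x.
  move=> ih; apply: Rintegral_itv_bndo_bndc.
  by apply: integrableS ih => //; apply: subset_itvl; rewrite bnd_simp.
rewrite !oc//; apply/eqP; rewrite -addr_eq0 -RintegralD//; apply/eqP.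
rewrite -FA -ikFE; congr fine; apply: ae_eq_integral => //.
- by apply/measurable_EFinP; apply: measurable_funTS; apply: measurable_funD;
    apply: measurable_funM.
- by have /integrableP[] := ikF.
have B0 : {ae @lebesgue_measure R, forall x, x != B}.
  exists [set B]; split => //; first exact: lebesgue_measure_set1.
  by move=> x /= h; have [//|/h] := eqVneq x B.
have fae := ae_filter_ringOfSetsType (@lebesgue_measure R).
have H := @filterI _ _ fae _ _ (@filterI _ _ fae _ _ dkf dkF) (@filterI _ _ fae _ _ kE B0).
apply: (@filterS _ _ fae _ _ _ H) => x /= [[h1 h2] [h3 h4]].
rewrite in_itv/= => /andP[Ax xB]; have {h4} xB' : x < B by rewrite lt_neqAle h4.
have d1 := h1 Ax xB'; have d2 := h2 Ax xB'; have kx := h3 Ax xB' _ d1.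
congr (_%:E); rewrite kx.
have d3 : is_derive x 1 (fun y => f y * g y) (kf x * g x + f x * g' x).
  by apply: is_derive_eq; rewrite /GRing.scale/=; ring.
have d4 : is_derive x 1 F (kf x * g x + f x * g' x).
  apply: near_eq_is_derive d3; near=> y; rewrite /F clE//.
    by apply/ltW; near: y; apply: lt_nbhsr.
  by apply/ltW; near: y; apply: lt_nbhsl.
by rewrite addrC; case: d4 => _ <-; case: d2 => _ <-.
Unshelve. all: by end_near. Qed.

(** A derivative as a limsup of difference quotients is defined everywhere and measurable
    in parameters; clipping keeps it bounded. *)
Definition quot_lim (R : realType) (M : R) (q : nat -> R) : R :=
  Num.max (- M) (Num.min (limn_sup q) M).

Lemma quot_lim_bound (R : realType) (M : R) (q : nat -> R) :
  0 <= M -> `|quot_lim M q| <= M.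
Proof.
move=> M0; rewrite /quot_lim /Num.max /Num.min.
by repeat case: ifPn; rewrite -?leNgt => *; rewrite ler_norml; lra.
Qed.

Lemma quot_lim_cvg (R : realType) (M : R) (q : nat -> R) (l : R) :
  (forall n, `|q n| <= M) -> q @ \oo --> l -> quot_lim M q = l.
Proof.
move=> qM ql.
have h n : q n \in `[- M, M] by rewrite in_itv/= -ler_norml.
have lM : - M <= l <= M.
  apply/andP; split.
    by apply: (cvgr_to_ge ql); apply: nearW => n; have := h n; rewrite in_itv/= => /andP[].
  by apply: (cvgr_to_le ql); apply: nearW => n; have := h n; rewrite in_itv/= => /andP[].
have /andP[l1 l2] := lM.
have -> : quot_lim M q = Num.max (- M) (Num.min l M).
  by rewrite /quot_lim (cvg_limn_inf_sup ql).2.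
by rewrite min_l// max_r.
Qed.

Lemma quot_lim_measurable (R : realType) d (T : measurableType d) (M : R)
    (q : nat -> T -> R) :
  (forall n z, `|q n z| <= M) -> (forall n, measurable_fun setT (q n)) ->
  measurable_fun setT (fun z => quot_lim M (q ^~ z)).
Proof.
move=> qM mq; apply: measurable_maxr; first exact: measurable_cst.
apply: measurable_minr; last exact: measurable_cst.
apply: measurable_fun_limn_sup => // z _.
  by exists M => _ [n _ <-]; rewrite (le_trans _ (qM n z))// ler_norm.
by exists (- M) => _ [n _ <-]; have := qM n z; rewrite ler_norml => /andP[].
Qed.

(** * Partial derivatives, test functions and essential bounds *)

Lemma quotient_seq (R : realType) (f : R -> R) (x s l : R) :
  is_derive x 1 f l ->
  (fun n => n.+1%:R * (f (x + s * n.+1%:R^-1) - f x)) @ \oo --> s * l.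
Proof.
move=> [df fl].
have [->|s0] := eqVneq s 0.
  rewrite mul0r; under eq_fun do rewrite mul0r addr0 subrr mulr0.
  exact: cvg_cst.
have H : h^-1 *: (f (h *: (1 : R) + x) - f x) @[h --> 0^'] --> l.
  by rewrite -fl; exact: df.
pose r n := s * n.+1%:R^-1 : R.
have r0 n : r n != 0 by rewrite mulf_neq0// invr_neq0// pnatr_eq0.
have rc : r @ \oo --> (0 : R).
  rewrite -(mulr0 s); apply: cvgM; first exact: cvg_cst.
  exact: cvg_harmonic.
move/cvgr_dnbhsP : H => /(_ r (conj r0 rc)) H.
have -> : (fun n => n.+1%:R * (f (x + s * n.+1%:R^-1) - f x)) =
    (fun n => s * ((r n)^-1 *: (f (r n *: (1 : R) + x) - f x))).
  apply/funext => n; rewrite [r n *: _]mulr1 (addrC (r n)) -/(r n).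
  rewrite /GRing.scale/= mulrA; congr (_ * _).
  by rewrite /r invfM invrK mulrA divff// mul1r.
by apply: cvgM => //; exact: cvg_cst.
Qed.

Lemma is_derive_partial1 (R : realType) (f : R * R -> R) (t x : R) :
  derivable f (t, x) (1, 0) -> is_derive t 1 (fun s => f (s, x)) (d1 f (t, x)).
Proof.
move=> df.
have e : (fun h : R => h^-1 *: (f (h *: ((1, 0) : R * R) + (t, x)) - f (t, x))) =
         (fun h : R => h^-1 *: (f (h *: (1 : R) + t, x) - f (t, x))).
  apply/funext => h; congr (_ *: (f _ - _)).
  by congr pair; rewrite /= ?scaler0 ?add0r.
apply: DeriveDef; first by rewrite /derivable -e.
by rewrite /d1 /derive e.
Qed.

Lemma is_derive_partial2 (R : realType) (f : R * R -> R) (t x : R) :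
  derivable f (t, x) (0, 1) -> is_derive x 1 (fun y => f (t, y)) (d2 f (t, x)).
Proof.
move=> df.
have e : (fun h : R => h^-1 *: (f (h *: ((0, 1) : R * R) + (t, x)) - f (t, x))) =
         (fun h : R => h^-1 *: (f (t, h *: (1 : R) + x) - f (t, x))).
  apply/funext => h; congr (_ *: (f _ - _)).
  by congr pair; rewrite /= ?scaler0 ?add0r.
apply: DeriveDef; first by rewrite /derivable -e.
by rewrite /d2 /derive e.
Qed.

Lemma Csmooth_continuous (R : realType) (f : R * R -> R) : Csmooth f -> continuous f.
Proof. by move=> /(_ 0%N)[]. Qed.

Lemma Csmooth_partials (R : realType) (f : R * R -> R) : Csmooth f ->
  has_partials setT f.
Proof. by move=> /(_ 1%N)[_ []]. Qed.

Lemma Csmooth_d1 (R : realType) (f : R * R -> R) : Csmooth f -> Csmooth (d1 f).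
Proof. by move=> h k; have [_ []] := h k.+1. Qed.

Lemma Csmooth_d2 (R : realType) (f : R * R -> R) : Csmooth f -> Csmooth (d2 f).
Proof. by move=> h k; have [_ []] := h k.+1. Qed.

Lemma test_fun_out (R : realType) (D : set (R * R)) (phi : R * R -> R) z :
  test_fun D phi -> ~ D z -> [/\ phi z = 0, d1 phi z = 0 & d2 phi z = 0].
Proof.
move=> [_ _ hD] nD.
have nz : ~ closure [set y | phi y != 0] z by move=> /hD.
have near0 : \forall y \near z, phi y = 0.
  have oC : open (~` closure [set y | phi y != 0]).
    by apply: closed_openC; exact: closed_closure.
  have := open_nbhs_nbhs (conj oC nz); apply: filterS => y hy.
  apply/eqP; apply: contra_notT hy => hy; exact: subset_closure.
have z0 : phi z = 0 by exact: nbhs_singleton near0.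
have dz v : 'D_v phi z = 0.
  have := @near_eq_derive _ _ _ phi (cst 0) z v.
  by rewrite derive_cst; apply.
by split => //; apply: dz.
Qed.

Lemma compact_support_bounded (R : realType) (K : set (R * R)) (f : R * R -> R) :
  compact K -> continuous f -> (forall z, ~ K z -> f z = 0) ->
  exists B, forall z, `|f z| <= B.
Proof.
move=> cK cf f0.
have [[z0 Kz0]|nK] := pselect (K !=set0); last first.
  exists 0 => z; rewrite f0 ?normr0// => Kz; by apply: nK; exists z.
have cn : {within K, continuous (fun z => `|f z|)}.
  apply: continuous_subspaceT => z; apply: continuous_comp; first exact: cf.
  exact: norm_continuous.
have [c _ hc] := compact_EVT_max (ex_intro _ _ Kz0) cK cn.
exists `|f c| => z; have [Kz|nKz] := pselect (K z); last by rewrite f0 ?normr0.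
by apply: hc; rewrite inE.
Qed.

Lemma test_fun_bounded (R : realType) (D : set (R * R)) (phi : R * R -> R) :
  test_fun D phi -> exists B, forall z, [/\ `|phi z| <= B, `|d1 phi z| <= B & `|d2 phi z| <= B].
Proof.
move=> [sm cK hD].
have tK : test_fun (closure [set z | phi z != 0]) phi by split.
have [B0 h0] := compact_support_bounded cK (Csmooth_continuous sm)
  (fun z nz => let: And3 h _ _ := test_fun_out tK nz in h).
have [B1 h1] := compact_support_bounded cK (Csmooth_continuous (Csmooth_d1 sm))
  (fun z nz => let: And3 _ h _ := test_fun_out tK nz in h).
have [B2 h2] := compact_support_bounded cK (Csmooth_continuous (Csmooth_d2 sm))
  (fun z nz => let: And3 _ _ h := test_fun_out tK nz in h).
exists (Num.max B0 (Num.max B1 B2)) => z.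
have m0 : B0 <= Num.max B0 (Num.max B1 B2) by rewrite le_max lexx.
have m1 : B1 <= Num.max B0 (Num.max B1 B2) by rewrite !le_max lexx orbT.
have m2 : B2 <= Num.max B0 (Num.max B1 B2) by rewrite !le_max lexx !orbT.
by split; [exact: le_trans (h0 z) m0|exact: le_trans (h1 z) m1|exact: le_trans (h2 z) m2].
Qed.

Lemma ocyl_rect (R : realType) (T : R) :
  ocyl T%:E = `]0, T[ `*` `]0, 1[ :> set (R * R).
Proof.
apply/seteqP; split => -[t x] /=; rewrite /ocyl /= !in_itv/= !lte_fin.
  by move=> [-> -> ->].
by move=> [/andP[-> ->] ->].
Qed.

(** A compact support is bounded in time, which reduces the unbounded cylinder to finite
    ones. *)
Lemma test_fun_finite (R : realType) (b : \bar R) (phi : R * R -> R) :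
  (0 < b)%E -> test_fun (ocyl b) phi ->
  exists T : R, [/\ 0 < T, (T%:E <= b)%E & test_fun (ocyl T%:E) phi].
Proof.
move=> b0 [sm cK hD].
case: b b0 hD => [b| |]//; first by rewrite lte_fin => b0 hD; exists b.
move=> _ hD.
have /compact_bounded[N [_ hN]] := cK.
pose T := Num.max 0 N + 2.
have T0 : 0 < T by rewrite /T ltr_wpDl// le_max lexx.
exists T; split; rewrite ?leey//; split => // z hz.
have [h1 _ h2] := hD _ hz; split => //.
have := hN (Num.max 0 N + 1) _ _ hz.
have -> : N < Num.max 0 N + 1 by rewrite ltr_pwDr// le_max lexx orbT.
move=> /(_ isT) h3; rewrite lte_fin (le_lt_trans (ler_norm _))//.
apply: (@le_lt_trans _ _ `|z|).
  by rewrite prod_normE le_max lexx.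
rewrite (le_lt_trans h3)// /T; lra.
Qed.

Lemma Rintegral_supp (R : realType) (D E : set (R * R)) (f : R * R -> R) :
  E `<=` D -> (forall z, ~ E z -> f z = 0) ->
  \int[@leb2 R]_(z in D) f z = \int[@leb2 R]_(z in E) f z.
Proof.
move=> ED f0; rewrite Rintegral_mkcond [RHS]Rintegral_mkcond.
congr (Rintegral _ _ _); apply/funext => z; rewrite !patchE.
have [Ez|nEz] := pselect (E z); first by rewrite !mem_set//; exact: ED.
by rewrite [in RHS]memNset// f0//; case: ifP.
Qed.

Lemma Loo2_le (R : realType) (D : set (R * R)) (f : R * R -> R) (M : R) :
  0 <= M -> (forall z, D z -> `|f z| <= M) -> (Loo2 D f <= M%:E)%E.
Proof.
move=> M0 fM; rewrite /Loo2 unlock; case: ifP => _; last by rewrite lee_fin.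
apply/ess_supP; apply: nearW => z /=; rewrite lee_fin patchE.
by case: ifPn => [/set_mem/fM//|_]; rewrite normr0.
Qed.

Lemma Loo2P (R : realType) (D : set (R * R)) (f : R * R -> R) (M : R) :
  0 <= M -> (Loo2 D f <= M%:E)%E -> {ae @leb2 R, forall z, D z -> `|f z| <= M}.
Proof.
move=> M0; rewrite /Loo2 unlock; case: ifP => [_ /ess_supP|h _].
  apply: filterS => z /=; rewrite lee_fin patchE => h Dz.
  by rewrite mem_set in h.
exists setT; split => //; apply/eqP; move: h.
by rewrite lt_neqAle measure_ge0 andbT => /negbFE; rewrite eq_sym.
Qed.

(** * From characteristics to distributions *)

(** Difference quotients in space forward, in time backward: these are the directions in
    which a transported function is compared with itself. *)
Definition dquot2 (R : realType) (M : R) (u : R * R -> R) (z : R * R) : R :=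
  quot_lim M (fun n => n.+1%:R * (u (z.1, z.2 + 1 * n.+1%:R^-1) - u (z.1, z.2))).

Definition dquot1 (R : realType) (M : R) (u : R * R -> R) (z : R * R) : R :=
  quot_lim M (fun n => - (n.+1%:R * (u (z.1 + - 1 * n.+1%:R^-1, z.2) - u (z.1, z.2)))).

Lemma global_lip_continuous (R : realType) (M : R) (u : R * R -> R) :
  (forall z z', `|u z - u z'| <= M * (`|z.1 - z'.1| + `|z.2 - z'.2|)) ->
  continuous u.
Proof.
move=> uL; have h : Lip2 M setT u by move=> z z' _ _; exact: uL.
move=> z; have /subspace_continuousP/(_ z I) hz := Lip2_continuous h.
move=> A hA; have := hz A hA; rewrite !nbhs_simpl /= => hA'.
have : \forall y \near z, setT y -> A (u y) by exact: hA'.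
by apply: filterS => y; exact.
Qed.

Section dquot.
Variables (R : realType) (M : R) (u : R * R -> R).
Hypothesis M0 : 0 <= M.
Hypothesis uL : forall z z', `|u z - u z'| <= M * (`|z.1 - z'.1| + `|z.2 - z'.2|).

Lemma dquot2_terms n z :
  `|n.+1%:R * (u (z.1, z.2 + 1 * n.+1%:R^-1) - u (z.1, z.2))| <= M.
Proof.
rewrite normrM gtr0_norm ?ltr0n// -ler_pdivlMl ?ltr0n//.
rewrite (le_trans (uL _ _))//= subrr normr0 add0r mul1r addrC addKr.
by rewrite ger0_norm ?invr_ge0// mulrC.
Qed.

Lemma dquot1_terms n z :
  `|- (n.+1%:R * (u (z.1 + - 1 * n.+1%:R^-1, z.2) - u (z.1, z.2)))| <= M.
Proof.
rewrite normrN normrM gtr0_norm ?ltr0n// -ler_pdivlMl ?ltr0n//.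
rewrite (le_trans (uL _ _))//= subrr normr0 addr0 mulN1r addrC addKr.
by rewrite normrN ger0_norm ?invr_ge0// mulrC.
Qed.

Lemma continuous_translate (s t : R) : continuous (fun z : R * R => u (z.1 + s, z.2 + t)).
Proof.
apply: (@global_lip_continuous _ M) => z z'; rewrite (le_trans (uL _ _))//=.
have -> : z.1 + s - (z'.1 + s) = z.1 - z'.1 by ring.
by have -> : z.2 + t - (z'.2 + t) = z.2 - z'.2 by ring.
Qed.

Lemma dquot2_measurable :
  measurable_fun (setT : set (measurableTypeR R * measurableTypeR R)) (dquot2 M u).
Proof.
apply: quot_lim_measurable => [n z|n]; first exact: dquot2_terms.
apply: continuous_measurable2 => z; apply: cvgM; first exact: cvg_cst.
have := @continuous_translate 0 (1 * n.+1%:R^-1) z.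
have := @continuous_translate 0 0 z.
under eq_fun do rewrite !addr0; under [in X in _ -> X -> _]eq_fun do rewrite addr0.
by move=> h1 h2; exact: cvgB.
Qed.

Lemma dquot1_measurable :
  measurable_fun (setT : set (measurableTypeR R * measurableTypeR R)) (dquot1 M u).
Proof.
apply: quot_lim_measurable => [n z|n]; first exact: dquot1_terms.
apply: continuous_measurable2 => z; apply: cvgN; apply: cvgM; first exact: cvg_cst.
have := @continuous_translate (- 1 * n.+1%:R^-1) 0 z.
have := @continuous_translate 0 0 z.
under eq_fun do rewrite !addr0; under [in X in _ -> X -> _]eq_fun do rewrite addr0.
by move=> h1 h2; exact: cvgB.
Qed.

Lemma dquot2_derive (t x l : R) : is_derive x 1 (fun y => u (t, y)) l -> dquot2 M u (t, x) = l.
Proof.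
move=> dl; apply: quot_lim_cvg => [n|]; first exact: (dquot2_terms n (t, x)).
by have := @quotient_seq _ _ _ 1 _ dl; rewrite mul1r.
Qed.

Lemma dquot1_derive (t x l : R) : is_derive t 1 (fun s => u (s, x)) l -> dquot1 M u (t, x) = l.
Proof.
move=> dl; apply: quot_lim_cvg => [n|]; first exact: (dquot1_terms n (t, x)).
have -> : l = - (- 1 * l) by ring.
by apply: cvgN; exact: quotient_seq.
Qed.

(** Backward in time, [u] is a translation in space by the speed [a]. *)
Lemma dquot1_transport (t x a l C d : R) :
  0 < d ->
  (forall e : R, 0 < e -> e < d -> `|u (t, x + a * e) - u (t - e, x)| <= C * e ^+ 2) ->
  is_derive x 1 (fun y => u (t, y)) l -> dquot1 M u (t, x) = - (a * l).
Proof.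
move=> d0 tr dl; apply: quot_lim_cvg => [n|]; first exact: (dquot1_terms n (t, x)).
have A := @quotient_seq _ _ _ a _ dl.
have B : (fun n => n.+1%:R * (u (t, x + a * n.+1%:R^-1) - u (t + - 1 * n.+1%:R^-1, x)))
    @ \oo --> (0 : R).
  apply/cvgrPdist_le => e e0.
  pose r := Num.min d (e / (`|C| + 1)).
  have C1 : 0 < `|C| + 1 by have := normr_ge0 C; lra.
  have r0 : 0 < r by rewrite lt_min d0 divr_gt0.
  have := @cvg_harmonic R; move/cvgrPdist_lt => /(_ r r0); apply: filterS => n.
  rewrite sub0r normrN /harmonic/= ger0_norm ?invr_ge0// => hn.
  have h1 : n.+1%:R^-1 < d by rewrite (lt_le_trans hn)// /r ge_min lexx.
  have h2 : n.+1%:R^-1 < e / (`|C| + 1) by rewrite (lt_le_trans hn)// /r ge_min lexx orbT.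
  have n0 : 0 < n.+1%:R^-1 :> R by rewrite invr_gt0 ltr0n.
  rewrite sub0r normrN normrM gtr0_norm ?ltr0n// mulN1r.
  rewrite -ler_pdivlMl ?ltr0n// (le_trans (tr _ n0 h1))//.
  rewrite expr2 mulrA mulrC ler_wpM2l ?(ltW n0)//.
  apply: (@le_trans _ _ ((`|C| + 1) * n.+1%:R^-1)).
    by rewrite ler_wpM2r ?(ltW n0)// (le_trans (ler_norm _))// lerDl.
  by rewrite mulrC -ler_pdivlMr// ltW.
rewrite -(sub0r (a * l)) (_ : (fun n => _) = (fun n =>
  n.+1%:R * (u (t, x + a * n.+1%:R^-1) - u (t + - 1 * n.+1%:R^-1, x)) -
  n.+1%:R * (u (t, x + a * n.+1%:R^-1) - u (t, x)))); last first.
  by apply/funext => n /=; ring.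
by apply: cvgB.
Qed.
End dquot.

Lemma RintegralN (R : realType) d (T : measurableType d) (mu : {measure set T -> \bar R})
    (D : set T) (f : T -> R) : measurable D -> mu.-integrable D (EFin \o f) ->
  \int[mu]_(x in D) (- f x) = - \int[mu]_(x in D) f x.
Proof.
move=> mD fi; under eq_Rintegral do rewrite -mulN1r.
by rewrite RintegralZl// mulN1r.
Qed.

Lemma itv_fin (R : realType) (a b : R) :
  (@lebesgue_measure R `]a, b[ < +oo)%E.
Proof.
by rewrite lebesgue_measure_itv/= lte_fin; case: ifP => _; rewrite -?EFinB ltry.
Qed.

Lemma leb2_rect_fin (R : realType) (T : R) :
  (@leb2 R (`]0%R, T[ `*` `]0%R, 1%R[)%classic < +oo)%E.
Proof.
have mI (a b : R) : measurable (`]a, b[ : set (measurableTypeR R)) by exact: measurable_itv.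
rewrite [X in (X < _)%E](product_measure1E _ _ (mI 0 T) (mI 0 1)).
have f1 := itv_fin 0 T; have f2 := @itv_fin R 0 1.
by rewrite lte_mul_pinfty// ge0_fin_numE.
Qed.

Lemma continuous_slice2 (R : realType) (f : R * R -> R) (t : R) :
  continuous f -> continuous (fun x => f (t, x)).
Proof.
move=> cf x; apply/cvgrPdist_le => e e0.
have /cvgrPdist_le/(_ e e0)/nbhs_ballP[d /= d0 hd] := cf (t, x).
apply/nbhs_ballP; exists d => // y xy; apply: hd; split => //=; exact: ballxx.
Qed.

Lemma continuous_slice1 (R : realType) (f : R * R -> R) (x : R) :
  continuous f -> continuous (fun t => f (t, x)).
Proof.
move=> cf t; apply/cvgrPdist_le => e e0.
have /cvgrPdist_le/(_ e e0)/nbhs_ballP[d /= d0 hd] := cf (t, x).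
apply/nbhs_ballP; exists d => // s ts; apply: hd; split => //=; exact: ballxx.
Qed.

(** By Fubini and integration by parts on the slices, the quotients at every point are
    the weak derivatives. *)
Lemma test_fun_ibp (R : realType) (T M Bu : R) (u phi : R * R -> R) :
  0 <= M -> 0 < T ->
  (forall z z', `|u z - u z'| <= M * (`|z.1 - z'.1| + `|z.2 - z'.2|)) ->
  (forall z, `|u z| <= Bu) -> test_fun (ocyl T%:E) phi ->
  (\int[@leb2 R]_(z in ocyl T%:E) (u z * d2 phi z) =
    - (\int[@leb2 R]_(z in ocyl T%:E) (dquot2 M u z * phi z)))%R /\
  (\int[@leb2 R]_(z in ocyl T%:E) (u z * d1 phi z) =
    - (\int[@leb2 R]_(z in ocyl T%:E) (dquot1 M u z * phi z)))%R.
Proof.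
move=> M0 T0 uL uB tphi.
have [Bp hB] := test_fun_bounded tphi.
have [sm _ _] := tphi.
have c0 := Csmooth_continuous sm; have c1 := Csmooth_continuous (Csmooth_d1 sm).
have c2 := Csmooth_continuous (Csmooth_d2 sm).
have m0 := continuous_measurable2 c0; have m1 := continuous_measurable2 c1.
have m2 := continuous_measurable2 c2.
have mu := continuous_measurable2 (global_lip_continuous uL).
have mq2 := dquot2_measurable uL; have mq1 := dquot1_measurable uL.
have mD : measurable (`]0, T[ `*` `]0%R, 1%R[ : set (measurableTypeR R * measurableTypeR R)).
  by apply: measurableX; exact: measurable_itv.
have Bp0 : 0 <= Bp by have [h _ _] := hB (0, 0); exact: le_trans h.
have Bu0 : 0 <= Bu by exact: le_trans (uB (0, 0)).
have b2 z : `|u z * d2 phi z| <= Bu * Bp.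
  by rewrite normrM ler_pM//; have [] := hB z.
have b1 z : `|u z * d1 phi z| <= Bu * Bp.
  by rewrite normrM ler_pM//; have [] := hB z.
have bq2 z : `|dquot2 M u z| <= M by exact: quot_lim_bound.
have bq1 z : `|dquot1 M u z| <= M by exact: quot_lim_bound.
have k2 z : `|dquot2 M u z * phi z| <= M * Bp.
  by rewrite normrM ler_pM//; have [] := hB z.
have k1 z : `|dquot1 M u z * phi z| <= M * Bp.
  by rewrite normrM ler_pM//; have [] := hB z.
have mI (a b : R) : measurable (`]a, b[ : set (measurableTypeR R)) by exact: measurable_itv.
rewrite ocyl_rect -!RintegralN//; last 2 first.
- apply: (@bounded_integrable _ _ _ _ _ _ (M * Bp)) => //; first exact: leb2_rect_fin.
  by apply: measurable_funTS; exact: measurable_funM.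
- apply: (@bounded_integrable _ _ _ _ _ _ (M * Bp)) => //; first exact: leb2_rect_fin.
  by apply: measurable_funTS; exact: measurable_funM.
have k2' z : `|- (dquot2 M u z * phi z)| <= M * Bp by rewrite normrN.
have k1' z : `|- (dquot1 M u z * phi z)| <= M * Bp by rewrite normrN.
have zero z : ~ ocyl T%:E z -> phi z = 0 by move=> /(test_fun_out tphi)[].
split.
- rewrite (rect_fubini (mI 0 T) (mI 0 1) (itv_fin _ _) (itv_fin _ _) _ b2).1; last first.
    exact: measurable_funM.
  rewrite (rect_fubini (mI 0 T) (mI 0 1) (itv_fin _ _) (itv_fin _ _) _ k2').1; last first.
    by apply: measurableT_comp => //; exact: measurable_funM.
  apply: eq_Rintegral => t _; rewrite RintegralN//; last first.
    apply: (@bounded_integrable _ _ _ _ _ _ (M * Bp)) => //; first exact: itv_fin.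
    apply: measurable_funTS; apply: measurable_funM; exact: measurable_fun_pair2.
  apply: (@ibp_lipschitz _ (fun x => u (t, x)) (fun x => phi (t, x)) _ _ M 0 1 M) => //.
  + by move=> x y; have := uL (t, x) (t, y); rewrite /= subrr normr0 add0r.
  + by move=> x; exact: is_derive_partial2 (proj2 (Csmooth_partials sm (z := (t, x)) I)).
  + exact: continuous_slice2.
  + by apply: zero => -[_ _ /=]; rewrite ltxx.
  + by apply: zero => -[_ _ /=]; rewrite ltxx andbF.
  + exact: measurable_fun_pair2.
  + by apply: aeW => x _ _ l; exact: dquot2_derive.
- rewrite (rect_fubini (mI 0 T) (mI 0 1) (itv_fin _ _) (itv_fin _ _) _ b1).2; last first.
    exact: measurable_funM.
  rewrite (rect_fubini (mI 0 T) (mI 0 1) (itv_fin _ _) (itv_fin _ _) _ k1').2; last first.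
    by apply: measurableT_comp => //; exact: measurable_funM.
  apply: eq_Rintegral => x _; rewrite RintegralN//; last first.
    apply: (@bounded_integrable _ _ _ _ _ _ (M * Bp)) => //; first exact: itv_fin.
    apply: measurable_funTS; apply: measurable_funM; exact: measurable_fun_pair1.
  apply: (@ibp_lipschitz _ (fun t => u (t, x)) (fun t => phi (t, x)) _ _ M 0 T M) => //.
  + by move=> s t; have := uL (s, x) (t, x); rewrite /= subrr normr0 addr0.
  + by move=> t; exact: is_derive_partial1 (proj1 (Csmooth_partials sm (z := (t, x)) I)).
  + exact: continuous_slice1.
  + by apply: zero => -[/=]; rewrite ltxx.
  + by apply: zero => -[_ /=]; rewrite ltxx.
  + exact: measurable_fun_pair1.
  + by apply: aeW => t _ _ l; exact: dquot1_derive.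
Qed.

(** On every slice in time, [u] is derivable in space almost everywhere. At such points
    the local relation makes the quotient in time equal to [- a] times the space
    derivative, so the two weak derivatives satisfy the equation almost everywhere. *)
Lemma transport_weak (R : realType) (b : \bar R) (u a : R * R -> R) (M Bu Ba : R) :
  (0 < b)%E -> 0 <= M ->
  (forall z z', `|u z - u z'| <= M * (`|z.1 - z'.1| + `|z.2 - z'.2|)) ->
  (forall z, `|u z| <= Bu) -> continuous a -> (forall z, `|a z| <= Ba) ->
  (forall t x : R, ocyl b (t, x) -> exists C d : R, 0 < d /\
     forall e : R, 0 < e -> e < d ->
       `|u (t, x + a (t, x) * e) - u (t - e, x)| <= C * e ^+ 2) ->
  transport_distr (ocyl b) a u.
Proof.
move=> b0 M0 uL uB ca aB tr.
have mq2 := dquot2_measurable uL; have mq1 := dquot1_measurable uL.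
have bq2 z : `|dquot2 M u z| <= M by exact: quot_lim_bound.
have bq1 z : `|dquot1 M u z| <= M by exact: quot_lim_bound.
have sub T : (T%:E <= b)%E -> ocyl T%:E `<=` ocyl b.
  by move=> Tb z [h1 h2 h3]; split => //; exact: lt_le_trans h2 Tb.
exists (dquot2 M u); split; first split.
- exact: measurable_funTS.
- by apply: (@le_lt_trans _ _ M%:E); [exact: Loo2_le|rewrite ltry].
- move=> phi /(test_fun_finite b0)[T [T0 Tb tphi]].
  have [h _] := test_fun_ibp M0 T0 uL uB tphi.
  rewrite (Rintegral_supp (sub _ Tb)); last first.
    by move=> z /(test_fun_out tphi)[_ _ ->]; rewrite mulr0.
  rewrite (Rintegral_supp (sub _ Tb)); last first.
    by move=> z /(test_fun_out tphi)[-> _ _]; rewrite mulr0.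
  exact: h.
move=> phi /(test_fun_finite b0)[T [T0 Tb tphi]].
rewrite (Rintegral_supp (sub _ Tb)); last first.
  by move=> z /(test_fun_out tphi)[_ -> _]; rewrite mulr0.
rewrite (Rintegral_supp (sub _ Tb)); last first.
  by move=> z /(test_fun_out tphi)[-> _ _]; rewrite mulr0.
have [_ ->] := test_fun_ibp M0 T0 uL uB tphi.
have [Bp hB] := test_fun_bounded tphi.
have [sm _ _] := tphi.
have m0 := continuous_measurable2 (Csmooth_continuous sm).
have ma := continuous_measurable2 ca.
have Bp0 : 0 <= Bp by have [h _ _] := hB (0, 0); exact: le_trans h.
have Ba0 : 0 <= Ba by exact: le_trans (aB (0, 0)).
have k1 z : `|dquot1 M u z * phi z| <= M * Bp.
  by rewrite normrM ler_pM//; have [] := hB z.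
have k2 z : `|a z * dquot2 M u z * phi z| <= Ba * M * Bp.
  by rewrite !normrM ler_pM ?mulr_ge0// ?ler_pM//; have [] := hB z.
have mI (s t : R) : measurable (`]s, t[ : set (measurableTypeR R)) by exact: measurable_itv.
have mD : measurable (`]0, T[ `*` `]0%R, 1%R[ : set (measurableTypeR R * measurableTypeR R)).
  by apply: measurableX.
rewrite opprK ocyl_rect -RintegralD//; last 2 first.
- apply: (@bounded_integrable _ _ _ _ _ _ (M * Bp)) => //; first exact: leb2_rect_fin.
  by apply: measurable_funTS; exact: measurable_funM.
- apply: (@bounded_integrable _ _ _ _ _ _ (Ba * M * Bp)) => //; first exact: leb2_rect_fin.
  by apply: measurable_funTS; apply: measurable_funM => //; exact: measurable_funM.
have k3 z : `|dquot1 M u z * phi z + a z * dquot2 M u z * phi z| <= M * Bp + Ba * M * Bp.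
  by rewrite (le_trans (ler_normD _ _))// lerD.
have mS : measurable_fun (setT : set (measurableTypeR R * measurableTypeR R))
    (fun z => dquot1 M u z * phi z + a z * dquot2 M u z * phi z).
  apply: measurable_funD; first exact: measurable_funM.
  by apply: measurable_funM => //; exact: measurable_funM.
rewrite (rect_fubini (mI 0 T) (mI 0 1) (itv_fin _ _) (itv_fin _ _) mS k3).1.
rewrite -[RHS](_ : \int[@leb1 R]_(t in `]0, T[) 0 = 0); last first.
  by rewrite Rintegral_cst// mul0r.
apply: eq_Rintegral => t; rewrite inE/= in_itv/= => /andP[t0 tT].
have fL x y : `|u (t, x) - u (t, y)| <= M * `|x - y|.
  by have := uL (t, x) (t, y); rewrite /= subrr normr0 add0r.
have [k [_ dk _]] := lipschitz_FTC M0 ltr01 fL.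
rewrite -[RHS](_ : \int[@leb1 R]_(x in `]0%R, 1%R[) 0 = 0); last first.
  by rewrite Rintegral_cst// mul0r.
congr fine; apply: ae_eq_integral => //.
- apply/measurable_EFinP; apply: measurable_funTS.
  exact: (@measurable_fun_pair2 _ _ _ _ _ _ _ t mS).
have fae := ae_filter_ringOfSetsType (@lebesgue_measure R).
apply: (@filterS _ _ fae _ _ _ dk) => x /= hx; rewrite in_itv/= => /andP[x0 x1].
have {}hx := hx x0 x1; congr (_%:E).
have hz : ocyl b (t, x) by apply: (sub T Tb); split => /=; rewrite ?lte_fin ?x0.
have [C [d [d0 hd]]] := tr _ _ hz.
rewrite (dquot2_derive uL hx) (dquot1_transport uL d0 hd hx); ring.
Qed.

(** * Smooth mollifiers *)

(** The functions [x ^ (- n) * exp (- 1 / x)], extended by zero: up to linear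
    combinations the family is stable under derivation, so all its members are smooth. *)
Definition flat (R : realType) (n : nat) (x : R) : R :=
  if 0 < x then x^-1 ^+ n * expR (- x^-1) else 0.

Lemma expR_dominates (R : realType) (n : nat) (y : R) :
  0 <= y -> y ^+ n * expR (- y) <= n%:R ^+ n.
Proof.
move=> y0; case: n => [|n].
  by rewrite !expr0 mul1r -expR0 ler_expR oppr_le0.
rewrite expRN ler_pdivrMr ?expR_gt0//.
have -> : expR y = expR (y / n.+1%:R) ^+ n.+1.
  by rewrite -expRM_natl mulrCA divff ?mulr1// pnatr_eq0.
rewrite -exprMn lerXn2r ?nnegrE ?mulr_ge0 ?expR_ge0//.
rewrite -ler_pdivrMl ?ltr0n// mulrC.
by rewrite (le_trans _ (expR_ge1Dx _))// lerDr.
Qed.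

Lemma flat_ge0 (R : realType) (n : nat) (x : R) : 0 <= flat n x.
Proof.
rewrite /flat; case: ifP => // x0.
by rewrite mulr_ge0 ?expR_ge0// exprn_ge0// invr_ge0 ltW.
Qed.

Lemma flat_bound (R : realType) (n : nat) (x : R) : `|flat n x| <= n%:R ^+ n.
Proof.
rewrite ger0_norm ?flat_ge0// /flat; case: ifP => x0; last by rewrite exprn_ge0.
by apply: expR_dominates; rewrite invr_ge0 ltW.
Qed.

(** A quadratic bound at 0 gives the derivative there. *)
Lemma flat_quadratic (R : realType) (n : nat) (x : R) :
  `|flat n x| <= n.+2%:R ^+ n.+2 * x ^+ 2.
Proof.
rewrite ger0_norm ?flat_ge0//; have := flat_bound n.+2 x.
rewrite ger0_norm ?flat_ge0// /flat; case: ifP => x0 h; last first.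
  by rewrite mulr_ge0 ?sqr_ge0// exprn_ge0.
rewrite -ler_pdivrMr ?exprn_gt0//; apply: le_trans h.
rewrite -exprVn -mulrA (mulrC (expR _)) mulrA -exprD addn2.
exact: lexx.
Qed.

Lemma flat_derive (R : realType) (n : nat) (x : R) :
  is_derive x 1 (@flat R n) (flat n.+2 x - n%:R * flat n.+1 x).
Proof.
case: (ltgtP x 0) => x0.
- have h : is_derive x 1 (fun _ : R => 0 : R) 0 by exact: is_derive_cst.
  rewrite [X in is_derive _ _ _ X](_ : _ = 0); last first.
    by rewrite /flat ltNge (ltW x0)/= mulr0 subr0.
  apply: near_eq_is_derive h; near=> y.
  have y0 : y < 0 by near: y; apply: lt_nbhsl.
  by rewrite /flat ltNge (ltW y0).
- have xn0 : x != 0 by rewrite gt_eqF.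
  have hid : is_derive x 1 (fun y : R => y) 1 by exact: is_derive_id.
  have hi : is_derive x 1 (fun y : R => y^-1) (- x ^- 2).
    apply: is_derive_eq; first exact: (is_deriveV xn0 hid).
    by rewrite [_ *: _]mulr1.
  have hn : is_derive x 1 (fun y : R => y^-1 ^+ n) (- (n%:R * x^-1 ^+ n.+1)).
    elim: n => [|n IH].
      have h : is_derive x 1 (fun _ : R => 1 : R) 0 by exact: is_derive_cst.
      by rewrite mul0r oppr0.
    have h : is_derive x 1 (fun y : R => y^-1 * y^-1 ^+ n)
        (- (n.+1%:R * x^-1 ^+ n.+2)).
      apply: is_derive_eq; rewrite /GRing.scale/= -natr1 -exprVn !exprS.
      by ring.
    have -> // : (fun y : R => y^-1 ^+ n.+1) = (fun y : R => y^-1 * y^-1 ^+ n).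
    by apply/funext => y; rewrite exprS.
  have he : is_derive x 1 (fun y : R => expR (- y^-1)) (x ^- 2 * expR (- x^-1)).
    have hN : is_derive x 1 (fun y : R => - y^-1) (x ^- 2).
      by apply: is_derive_eq; rewrite opprK.
    have := @is_derive1_comp _ expR (fun y : R => - y^-1) x _ _ (is_derive_expR _) hN.
    by rewrite mulrC.
  have h : is_derive x 1 (fun y : R => y^-1 ^+ n * expR (- y^-1))
      (flat n.+2 x - n%:R * flat n.+1 x).
    rewrite /flat x0; apply: is_derive_eq.
    by rewrite /GRing.scale/= -exprVn !exprS; ring.
  apply: near_eq_is_derive h; near=> y.
  have y0 : 0 < y by near: y; apply: lt_nbhsr.
  by rewrite /flat y0.
- rewrite x0.
  have f00 m : flat m (0 : R) = 0 by rewrite /flat ltxx.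
  rewrite !f00 mulr0 subr0.
  have q0 : (fun h : R => h^-1 *: (flat n (h *: (1 : R) + 0) - flat n 0)) @ 0^' --> (0 : R).
    apply/cvgr0Pnorm_le => e e0.
    pose K := n.+2%:R ^+ n.+2 : R.
    have K0 : 0 < K by rewrite exprn_gt0// ltr0n.
    near=> h.
    have hz : h != 0 by near: h; exact: nbhs_dnbhs_neq.
    rewrite f00 subr0 addr0 [h *: 1]mulr1 normrZ normfV.
    rewrite ler_pdivrMl ?normr_gt0//.
    rewrite (le_trans (flat_quadratic _ _))// -/K.
    rewrite -real_normK ?num_real// expr2 mulrA mulrC ler_wpM2l//.
    rewrite mulrC -ler_pdivlMr//.
    near: h; apply: dnbhs0_le; exact: divr_gt0.
  apply: DeriveDef; first by apply/cvg_ex; exists 0.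
  exact: cvg_lim q0.
Unshelve. all: by end_near. Qed.

Lemma flat_continuous (R : realType) (n : nat) : continuous (@flat R n).
Proof.
move=> x; apply/differentiable_continuous/derivable1_diffP.
by case: (flat_derive n x).
Qed.

Lemma Ck_cst (R : realType) (k : nat) (c : R) : Ck k (fun _ : R * R => c).
Proof.
elim: k c => [|k IH] c; split => //; try exact: cst_continuous.
have d0 (v : R * R) : (fun z : R * R => 'D_v (fun _ : R * R => c) z) = (fun _ => 0).
  by apply/funext => z; exact: derive_cst.
split; first by move=> z _; split; exact: derivable_cst.
  by rewrite /d1 d0; exact: IH.
by rewrite /d2 d0; exact: IH.
Qed.

Lemma CkW (R : realType) (k : nat) (f : R * R -> R) : Ck k.+1 f -> Ck k f.
Proof.
elim: k f => [|k IH] f; first by move=> [cf _]; split.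
by move=> [cf [pf c1 c2]]; exact: (conj cf (And3 pf (IH _ c1) (IH _ c2))).
Qed.

Lemma Ck_add (R : realType) (k : nat) (f g : R * R -> R) :
  Ck k f -> Ck k g -> Ck k (fun z => f z + g z).
Proof.
elim: k f g => [|k IH] f g.
  by move=> [cf _] [cg _]; split => // z; apply: cvgD; [exact: cf|exact: cg].
move=> [cf [pf f1 f2]] [cg [pg g1 g2]].
split; first by move=> z; apply: cvgD; [exact: cf|exact: cg].
split.
- move=> z _; have [a1 a2] := pf z I; have [b1 b2] := pg z I.
  exact: (conj (derivableD a1 b1) (derivableD a2 b2)).
- rewrite (_ : d1 _ = fun z => d1 f z + d1 g z); first exact: (IH _ _ f1 g1).
  apply/funext => z; have [a1 a2] := pf z I; have [b1 b2] := pg z I.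
  exact: (deriveD a1 b1).
- rewrite (_ : d2 _ = fun z => d2 f z + d2 g z); first exact: (IH _ _ f2 g2).
  apply/funext => z; have [a1 a2] := pf z I; have [b1 b2] := pg z I.
  exact: (deriveD a2 b2).
Qed.

Lemma Ck_mul (R : realType) (k : nat) (f g : R * R -> R) :
  Ck k f -> Ck k g -> Ck k (fun z => f z * g z).
Proof.
elim: k f g => [|k IH] f g.
  by move=> [cf _] [cg _]; split => // z; apply: cvgM; [exact: cf|exact: cg].
move=> Cf Cg; have Cf' := CkW Cf; have Cg' := CkW Cg.
move: Cf Cg => [cf [pf f1 f2]] [cg [pg g1 g2]].
split; first by move=> z; apply: cvgM; [exact: cf|exact: cg].
split.
- move=> z _; have [a1 a2] := pf z I; have [b1 b2] := pg z I.
  exact: (conj (derivableM a1 b1) (derivableM a2 b2)).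
- rewrite (_ : d1 _ = fun z => f z * d1 g z + g z * d1 f z).
    exact: (Ck_add (IH _ _ Cf' g1) (IH _ _ Cg' f1)).
  apply/funext => z; have [a1 a2] := pf z I; have [b1 b2] := pg z I.
  exact: (deriveM a1 b1).
- rewrite (_ : d2 _ = fun z => f z * d2 g z + g z * d2 f z).
    exact: (Ck_add (IH _ _ Cf' g2) (IH _ _ Cg' f2)).
  apply/funext => z; have [a1 a2] := pf z I; have [b1 b2] := pg z I.
  exact: (deriveM a2 b2).
Qed.

Lemma derive_affine (R : realType) (f f' : R -> R) (al be s : R) :
  (forall x : R, is_derive x 1 f (f' x)) ->
  is_derive s 1 (fun y => f (al + be * y)) (be * f' (al + be * s)).
Proof.
move=> df.
have h : is_derive s 1 (fun y : R => al + be * y) be.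
  by apply: is_derive_eq; rewrite /GRing.scale/=; ring.
have := @is_derive1_comp _ f (fun y : R => al + be * y) s _ _ (df _) h.
by rewrite mulrC.
Qed.

Lemma partials_fst (R : realType) (g : R -> R) (g' : R) (t x : R) :
  is_derive t 1 g g' ->
  [/\ derivable (fun z : R * R => g z.1) (t, x) (1, 0),
      derivable (fun z : R * R => g z.1) (t, x) (0, 1),
      d1 (fun z : R * R => g z.1) (t, x) = g' & d2 (fun z : R * R => g z.1) (t, x) = 0].
Proof.
move=> [dg gE].
have e : (fun h : R => h^-1 *: (g (h *: ((1, 0) : R * R) + (t, x)).1 - g (t, x).1)) =
         (fun h : R => h^-1 *: (g (h *: (1 : R) + t) - g t)) by [].
have e0 : (fun h : R => h^-1 *: (g (h *: ((0, 1) : R * R) + (t, x)).1 - g (t, x).1)) =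
         (fun h : R => 0).
  by apply/funext => h; rewrite /= scaler0 add0r subrr scaler0.
split.
- by rewrite /derivable e.
- by rewrite /derivable e0; exact: is_cvg_cst.
- by rewrite /d1 /derive e.
- by rewrite /d2 /derive e0; apply: lim_cst.
Qed.

Lemma partials_snd (R : realType) (g : R -> R) (g' : R) (t x : R) :
  is_derive x 1 g g' ->
  [/\ derivable (fun z : R * R => g z.2) (t, x) (1, 0),
      derivable (fun z : R * R => g z.2) (t, x) (0, 1),
      d1 (fun z : R * R => g z.2) (t, x) = 0 & d2 (fun z : R * R => g z.2) (t, x) = g'].
Proof.
move=> [dg gE].
have e : (fun h : R => h^-1 *: (g (h *: ((0, 1) : R * R) + (t, x)).2 - g (t, x).2)) =
         (fun h : R => h^-1 *: (g (h *: (1 : R) + x) - g x)) by [].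
have e0 : (fun h : R => h^-1 *: (g (h *: ((1, 0) : R * R) + (t, x)).2 - g (t, x).2)) =
         (fun h : R => 0).
  by apply/funext => h; rewrite /= scaler0 add0r subrr scaler0.
split.
- by rewrite /derivable e0; exact: is_cvg_cst.
- by rewrite /derivable e.
- by rewrite /d1 /derive e0; apply: lim_cst.
- by rewrite /d2 /derive e.
Qed.

Lemma Ck_flat (R : realType) (k n : nat) (al be : R) :
  Ck k (fun z : R * R => flat n (al + be * z.1)) /\
  Ck k (fun z : R * R => flat n (al + be * z.2)).
Proof.
have c1 m : continuous (fun z : R * R => flat m (al + be * z.1)).
  move=> z; apply: (@continuous_comp _ _ _ (fun z : R * R => al + be * z.1) (@flat R m));
    last exact: flat_continuous.
  apply: cvgD; first exact: cvg_cst.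
  by apply: cvgM; [exact: cvg_cst|exact: cvg_fst].
have c2 m : continuous (fun z : R * R => flat m (al + be * z.2)).
  move=> z; apply: (@continuous_comp _ _ _ (fun z : R * R => al + be * z.2) (@flat R m));
    last exact: flat_continuous.
  apply: cvgD; first exact: cvg_cst.
  by apply: cvgM; [exact: cvg_cst|exact: cvg_snd].
have df m s := @derive_affine R _ _ al be s (flat_derive (R:=R) m).
elim: k n => [|k IH] n; first by split; exact: (conj (_ : continuous _) I).
have [IH1 _] := IH n.+2; have [IH2 _] := IH n.+1.
have [_ JH1] := IH n.+2; have [_ JH2] := IH n.+1.
have K (f g : R * R -> R) : Ck k f -> Ck k g ->
    Ck k (fun z => be * (f z + - n%:R * g z)).
  move=> hf hg; exact: (Ck_mul (Ck_cst k be) (Ck_add hf (Ck_mul (Ck_cst k (- n%:R)) hg))).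
split.
- refine (conj (c1 n) (And3 _ _ _)).
  + by move=> [t x] _; have [a b _ _] := partials_fst x (df n t).
  + rewrite (_ : d1 _ = fun z => be * (flat n.+2 (al + be * z.1) +
      - n%:R * flat n.+1 (al + be * z.1))); first exact: (K _ _ IH1 IH2).
    by apply/funext => -[t x]; have [_ _ -> _] := partials_fst x (df n t); rewrite mulNr.
  + rewrite (_ : d2 _ = fun z => 0); first exact: Ck_cst.
    by apply/funext => -[t x]; have [_ _ _ ->] := partials_fst x (df n t).
- refine (conj (c2 n) (And3 _ _ _)).
  + by move=> [t x] _; have [a b _ _] := partials_snd t (df n x).
  + rewrite (_ : d1 _ = fun z => 0); first exact: Ck_cst.
    by apply/funext => -[t x]; have [_ _ -> _] := partials_snd t (df n x).
  + rewrite (_ : d2 _ = fun z => be * (flat n.+2 (al + be * z.2) +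
      - n%:R * flat n.+1 (al + be * z.2))); first exact: (K _ _ JH1 JH2).
    by apply/funext => -[t x]; have [_ _ _ ->] := partials_snd t (df n x); rewrite mulNr.
Qed.

(** Each factor vanishes on one side, which confines the product to [-e, e]. *)
Definition smooth_bump (R : realType) (e s : R) : R :=
  flat 0 (1 + e^-1 * s) * flat 0 (1 + - e^-1 * s).

(** The derivative of [flat 0] is [flat 2]. *)
Definition dsmooth_bump (R : realType) (e s : R) : R :=
  e^-1 * flat 2 (1 + e^-1 * s) * flat 0 (1 + - e^-1 * s) -
  e^-1 * flat 0 (1 + e^-1 * s) * flat 2 (1 + - e^-1 * s).

Lemma smooth_bump_ge0 (R : realType) (e s : R) : 0 <= smooth_bump e s.
Proof. by rewrite mulr_ge0 ?flat_ge0. Qed.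

Lemma smooth_bump_out (R : realType) (e s : R) : 0 < e -> e <= `|s| -> smooth_bump e s = 0.
Proof.
move=> e0; rewrite ler_normr => /orP[] es; rewrite /smooth_bump /flat.
  rewrite [X in _ * X](_ : _ = 0) ?mulr0//; case: ifP => // h; exfalso.
  have : e^-1 * e <= e^-1 * s by rewrite ler_pM2l ?invr_gt0.
  by rewrite mulVf ?gt_eqF//; move: h; lra.
rewrite [X in X * _](_ : _ = 0) ?mul0r//; case: ifP => // h; exfalso.
have : e^-1 * e <= e^-1 * - s by rewrite ler_pM2l ?invr_gt0.
by rewrite mulVf ?gt_eqF//; move: h; lra.
Qed.

Lemma smooth_bump0_gt0 (R : realType) (e : R) : 0 < smooth_bump e 0.
Proof.
by rewrite /smooth_bump !mulr0 addr0 /flat ltr01 !mulr_gt0 ?expR_gt0// ?expr0.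
Qed.

Lemma smooth_bump_derive (R : realType) (e s : R) : is_derive s 1 (smooth_bump e) (dsmooth_bump e s).
Proof.
have h1 := @derive_affine R _ _ 1 e^-1 s (flat_derive (R:=R) 0).
have h2 := @derive_affine R _ _ 1 (- e^-1) s (flat_derive (R:=R) 0).
by apply: is_derive_eq; rewrite /dsmooth_bump /GRing.scale/= !mul0r !subr0; ring.
Qed.

Lemma smooth_bump_bound (R : realType) (e s : R) : 0 < e ->
  `|smooth_bump e s| <= 1 /\ `|dsmooth_bump e s| <= 8 * e^-1.
Proof.
move=> e0.
have b0 (y : R) := flat_bound 0 y; have b2 (y : R) := flat_bound 2 y.
have e2 : 2%:R ^+ 2 = 4 :> R by ring.
rewrite /= expr0 in b0; rewrite e2 in b2.
have ei : 0 <= e^-1 by rewrite invr_ge0 ltW.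
split; first by rewrite /smooth_bump normrM -[1]mulr1 ler_pM.
rewrite /dsmooth_bump (le_trans (ler_normB _ _))// !normrM (ger0_norm ei).
have -> : 8 * e^-1 = e^-1 * 4 * 1 + e^-1 * 1 * 4 by ring.
by rewrite lerD// ler_pM ?mulr_ge0// ler_wpM2l.
Qed.

Definition mollifier (R : realType) (e : R) (z w : R * R) : R :=
  smooth_bump e (w.1 - z.1) * smooth_bump e (w.2 - z.2).

Lemma mollifier_smooth (R : realType) (e : R) (z : R * R) : Csmooth (mollifier e z).
Proof.
move=> k.
rewrite (_ : mollifier e z = fun w =>
   (flat 0 ((1 - e^-1 * z.1) + e^-1 * w.1) * flat 0 ((1 + e^-1 * z.1) + - e^-1 * w.1)) *
   (flat 0 ((1 - e^-1 * z.2) + e^-1 * w.2) * flat 0 ((1 + e^-1 * z.2) + - e^-1 * w.2))).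
  have [a1 _] := Ck_flat k 0 (1 - e^-1 * z.1) e^-1.
  have [a2 _] := Ck_flat k 0 (1 + e^-1 * z.1) (- e^-1).
  have [_ a3] := Ck_flat k 0 (1 - e^-1 * z.2) e^-1.
  have [_ a4] := Ck_flat k 0 (1 + e^-1 * z.2) (- e^-1).
  exact: (Ck_mul (Ck_mul a1 a2) (Ck_mul a3 a4)).
apply/funext => w; rewrite /mollifier /smooth_bump.
by congr (flat _ _ * flat _ _ * (flat _ _ * flat _ _)); ring.
Qed.

Lemma mollifier_out (R : realType) (e : R) (z w : R * R) : 0 < e ->
  e <= `|w.1 - z.1| \/ e <= `|w.2 - z.2| -> mollifier e z w = 0.
Proof.
by move=> e0 [h|h]; rewrite /mollifier (smooth_bump_out e0 h) ?mul0r ?mulr0.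
Qed.

Lemma mollifier_partials (R : realType) (e : R) (z w : R * R) :
  d1 (mollifier e z) w = dsmooth_bump e (w.1 - z.1) * smooth_bump e (w.2 - z.2) /\
  d2 (mollifier e z) w = smooth_bump e (w.1 - z.1) * dsmooth_bump e (w.2 - z.2).
Proof.
case: w => s y; have [p1 p2] := Csmooth_partials (mollifier_smooth e z) (z := (s, y)) I.
have k (c : R) (r : R) : is_derive r 1 (fun q => smooth_bump e (q - c)) (dsmooth_bump e (r - c)).
  have := @derive_affine R _ _ (- c) 1 r (smooth_bump_derive e).
  rewrite mul1r (_ : - c + 1 * r = r - c); last by ring.
  rewrite (_ : (fun q => smooth_bump e (- c + 1 * q)) = (fun q => smooth_bump e (q - c)))//.
  by apply/funext => q; congr smooth_bump; ring.
have k1 : is_derive s 1 (fun q => mollifier e z (q, y))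
    (dsmooth_bump e (s - z.1) * smooth_bump e (y - z.2)).
  have k' := k z.1 s.
  by rewrite /mollifier /=; apply: is_derive_eq; rewrite /GRing.scale/=; ring.
have k2 : is_derive y 1 (fun q => mollifier e z (s, q))
    (smooth_bump e (s - z.1) * dsmooth_bump e (y - z.2)).
  have k' := k z.2 y.
  by rewrite /mollifier /=; apply: is_derive_eq; rewrite /GRing.scale/=; ring.
have h1 := is_derive_partial1 p1; have h2 := is_derive_partial2 p2.
by split; [case: h1 => _ <-; case: k1|case: h2 => _ <-; case: k2].
Qed.

Lemma mollifier_test (R : realType) (e : R) (z : R * R) (D : set (R * R)) : 0 < e ->
  (forall w, `|w.1 - z.1| <= e -> `|w.2 - z.2| <= e -> D w) ->
  test_fun D (mollifier e z).
Proof.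
move=> e0 hD.
pose B := `[z.1 - e, z.1 + e]%classic `*` `[z.2 - e, z.2 + e]%classic.
have cB : compact B by apply: compact_setX; exact: segment_compact.
have clB : closed B.
  by apply: compact_closed cB; exact: norm_hausdorff.
have sB : closure [set w | mollifier e z w != 0] `<=` B.
  apply: (@subset_trans _ (closure B)); last by rewrite -(closure_id B).1.
  apply: closureS => w /= hw.
  have [|h1] := leP e `|w.1 - z.1|.
    by move=> h; move: hw; rewrite (mollifier_out e0)//; [rewrite eqxx|left].
  have [|h2] := leP e `|w.2 - z.2|.
    by move=> h; move: hw; rewrite (mollifier_out e0)//; [rewrite eqxx|right].
  move: h1 h2; rewrite !ltr_norml => h1 h2.
  by split; rewrite /= in_itv/=; lra.
split; first exact: mollifier_smooth.
- by apply: (subclosed_compact _ cB sB); exact: closed_closure.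
- move=> w /sB[] /=; rewrite !in_itv/= => h1 h2.
  by apply: hD; rewrite ler_norml; lra.
Qed.

(** * From distributions to characteristics *)

(** Nonempty open sets have positive measure. *)
Lemma open_not_null2 (R : realType) (U : set (R * R)) (z : R * R) (P : R * R -> Prop) :
  open U -> U z -> {ae @leb2 R, forall w, P w} -> exists2 w, U w & P w.
Proof.
move=> oU Uz [N [mN N0 hN]]; apply: contrapT => nP.
have /nbhs_ballP[e /= e0 he] := open_nbhs_nbhs (conj oU Uz).
have mB (y : R) : measurable (ball y e : set (measurableTypeR R)).
  by rewrite ball_itv; exact: measurable_itv.
have BN : ball z.1 e `*` ball z.2 e `<=` N.
  move=> w [h1 h2]; apply: hN => /= Pw; apply: nP; exists w => //.
  by apply: he; split.
have mBB : measurable (ball z.1 e `*` ball z.2 e : set (measurableTypeR R * measurableTypeR R)).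
  exact: measurableX.
have : (@leb2 R (ball z.1 e `*` ball z.2 e) <= 0)%E.
  by rewrite -N0; apply: le_measure => //; rewrite inE.
have hb (y : R) := lebesgue_measure_ball y (ltW e0).
have -> : @leb2 R (ball z.1 e `*` ball z.2 e) = ((e *+ 2) * (e *+ 2))%:E.
  exact: etrans (product_measure1E _ _ (mB z.1) (mB z.2)) (congr2 mule (hb _) (hb _)).
by rewrite lee_fin leNgt mulr_gt0 ?mulrn_wgt0.
Qed.

Lemma transport_distr_eq (R : realType) (D : set (R * R)) (a a' u u' : R * R -> R) :
  (forall z, D z -> a z = a' z /\ u z = u' z) ->
  transport_distr D a u -> transport_distr D a' u'.
Proof.
move=> h [p [[mp pb ibp] tr]]; exists p; split; first split => //.
  move=> phi tphi; rewrite -ibp//; apply: eq_Rintegral => z.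
  by rewrite inE => /h[_ ->].
move=> phi tphi; rewrite -[RHS](tr phi tphi).
congr (- _ + _); apply: eq_Rintegral => z; rewrite inE => /h[h1 h2].
  by rewrite h2.
by rewrite h1.
Qed.

(** Clipping the weak derivative at its essential bound changes it on a null set only. *)
Lemma transport_distr_bounded (R : realType) (T : R) (a u : R * R -> R) (Ba : R) :
  continuous a -> (forall z, `|a z| <= Ba) -> 0 < T ->
  transport_distr (ocyl T%:E) a u ->
  exists (p : R * R -> R) (P : R), [/\ 0 <= P,
    measurable_fun (setT : set (measurableTypeR R * measurableTypeR R)) p,
    forall z, `|p z| <= P &
    forall phi, test_fun (ocyl T%:E) phi ->
     ((\int[@leb2 R]_(z in ocyl T%:E) (u z * d2 phi z) =
       - (\int[@leb2 R]_(z in ocyl T%:E) (p z * phi z)))%R /\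
     (\int[@leb2 R]_(z in ocyl T%:E) (u z * d1 phi z) =
       (\int[@leb2 R]_(z in ocyl T%:E) (a z * p z * phi z)))%R)].
Proof.
move=> ca aB T0 [p [[mp pb ibp] tr]].
have mI (s t : R) : measurable (`]s, t[ : set (measurableTypeR R)) by exact: measurable_itv.
have mD : measurable (ocyl T%:E : set (measurableTypeR R * measurableTypeR R)).
  by rewrite ocyl_rect; exact: measurableX.
have ma := continuous_measurable2 ca.
pose P := fine (Loo2 (ocyl T%:E) p).
have L0 : (0 <= Loo2 (ocyl T%:E) p)%E by exact: Lnorm_ge0.
have PE : Loo2 (ocyl T%:E) p = P%:E by rewrite /P fineK// ge0_fin_numE.
have P0 : 0 <= P by rewrite /P fine_ge0.
have pP : {ae @leb2 R, forall z, ocyl T%:E z -> `|p z| <= P}.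
  by apply: (Loo2P P0); rewrite PE.
(* p is extended by zero and clipped, which changes it on a null set only *)
pose q := Num.max (- P) \o (fun z => Num.min (patch (cst 0) (ocyl T%:E) p z) P).
have mq : measurable_fun (setT : set (measurableTypeR R * measurableTypeR R)) q.
  apply: (@measurable_maxr _ _ _ _ (cst (- P)) (fun z => Num.min (patch (cst 0) (ocyl T%:E) p z) P)).
    exact: measurable_cst.
  apply: (@measurable_minr _ _ _ _ (patch (cst 0) (ocyl T%:E) p) (cst P)); last exact: measurable_cst.
  exact/(measurable_restrictT _ mD).
have qP z : `|q z| <= P.
  rewrite /q /= /Num.max /Num.min.
  by repeat case: ifPn; rewrite -?leNgt => *; rewrite ler_norml; lra.
have qE z : ocyl T%:E z -> `|p z| <= P -> q z = p z.
  move=> Dz; rewrite ler_norml => /andP[h1 h2].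
  by rewrite /q /= patchE mem_set// min_l// max_r.
exists q, P; split => // phi tphi.
have [sm _ _] := tphi.
have m0 := continuous_measurable2 (Csmooth_continuous sm).
split.
  rewrite ibp//; congr (- _); congr fine; apply: ae_eq_integral => //.
  - by apply/measurable_EFinP; apply: measurable_funM => //; exact: measurable_funTS.
  - by apply/measurable_EFinP; apply: measurable_funTS; exact: measurable_funM.
  - by apply: (@filterS _ _ (ae_filter_ringOfSetsType (@leb2 R)) _ _ _ pP) => z hz Dz; rewrite /= qE// hz.
have := tr phi tphi; move/eqP; rewrite addrC subr_eq0 => /eqP <-.
congr fine; apply: ae_eq_integral => //.
- apply/measurable_EFinP; apply: measurable_funM; last exact: measurable_funTS.
  by apply: measurable_funM => //; exact: measurable_funTS.
- apply/measurable_EFinP; apply: measurable_funTS; apply: measurable_funM => //.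
  exact: measurable_funM.
- by apply: (@filterS _ _ (ae_filter_ringOfSetsType (@leb2 R)) _ _ _ pP) => z hz Dz; rewrite /= qE// hz.
Qed.

Lemma le_of_small (R : realType) (x y K m : R) : 0 < m ->
  (forall e, 0 < e -> e < m -> x <= y + K * e) -> x <= y.
Proof.
move=> m0 h; apply/ler_addgt0Pr => r r0.
have K1 : 0 < `|K| + 1 by have := normr_ge0 K; lra.
pose e := Num.min (m / 2) (r / (`|K| + 1)).
have e0 : 0 < e by rewrite lt_min; apply/andP; split; apply: divr_gt0.
have em : e < m by rewrite (@le_lt_trans _ _ (m / 2)) ?ge_min ?lexx//; lra.
have er : e * (`|K| + 1) <= r by rewrite -ler_pdivlMr// ge_min lexx orbT.
have hK : K * e <= `|K| * e by rewrite ler_wpM2r ?(ltW e0)// ler_norm.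
have := h e e0 em; lra.
Qed.

(** The mollifier depends on the difference between the variable and the centre, and the
    centre moves backward; the two signs cancel. *)
Lemma mollifier_path (R : realType) (e al : R) (z w : R * R) (r : R) :
  is_derive r 1 (fun s => mollifier e (z.1 - s, z.2 - s * al) w)
    (d1 (mollifier e (z.1 - r, z.2 - r * al)) w +
     al * d2 (mollifier e (z.1 - r, z.2 - r * al)) w).
Proof.
have [-> ->] := mollifier_partials e (z.1 - r, z.2 - r * al) w.
have k1 := @derive_affine R _ _ (w.1 - z.1) 1 r (smooth_bump_derive e).
have k2 := @derive_affine R _ _ (w.2 - z.2) al r (smooth_bump_derive e).
have e1 (s : R) : w.1 - z.1 + 1 * s = w.1 - (z.1 - s) by ring.
have e2 (s : R) : w.2 - z.2 + al * s = w.2 - (z.2 - s * al) by ring.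
rewrite e1 in k1; rewrite e2 in k2.
rewrite (_ : (fun s => _) = (fun s => smooth_bump e (w.1 - z.1 + 1 * s) * smooth_bump e (w.2 - z.2 + al * s))).
  by apply: is_derive_eq; rewrite /GRing.scale/= e1 e2; ring.
by apply/funext => s; rewrite /mollifier /= e1 e2.
Qed.

Lemma open_ocyl (R : realType) (T : R) : open (ocyl (R := R) T%:E).
Proof.
rewrite (_ : ocyl _ = (fst @^-1` `]0, T[%classic) `&` (snd @^-1` `]0, 1[%classic)).
  apply: openI; apply: open_comp; try exact: interval_open.
    by move=> z _; exact: cvg_fst.
  by move=> z _; exact: cvg_snd.
by rewrite ocyl_rect.
Qed.

(** Averages against a mollifier whose centre [zr r] moves backward along a line of slope
    [al], for the times at which its support stays inside the domain. *)
Section weak_path.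
Variables (R : realType) (T e al : R) (z : R * R) (c d : R).
Hypotheses (T0 : 0 < T) (e0 : 0 < e).
Let D := ocyl T%:E.
Let zr (r : R) := (z.1 - r, z.2 - r * al).
Hypothesis inD : forall r, c < r -> r < d -> forall w : R * R,
  `|w.1 - (zr r).1| <= e -> `|w.2 - (zr r).2| <= e -> D w.

Lemma mollifier_testD r : c < r -> r < d -> test_fun D (mollifier e (zr r)).
Proof. by move=> h1 h2; apply: mollifier_test => // w; exact: inD. Qed.

Let mD : measurable (D : set (measurableTypeR R * measurableTypeR R)).
Proof. by rewrite /D ocyl_rect; apply: measurableX; exact: measurable_itv. Qed.

Let Doo : (@leb2 R D < +oo)%E.
Proof. by rewrite /D ocyl_rect; exact: leb2_rect_fin. Qed.

Let moll_bound y w : [/\ `|mollifier e y w| <= 1, `|d1 (mollifier e y) w| <= 8 * e^-1 &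
  `|d2 (mollifier e y) w| <= 8 * e^-1].
Proof.
have [h1 h2] := smooth_bump_bound (w.1 - y.1) e0; have [h3 h4] := smooth_bump_bound (w.2 - y.2) e0.
have ei : 0 <= e^-1 by rewrite invr_ge0 ltW.
have [-> ->] := mollifier_partials e y w.
split.
- by rewrite /mollifier normrM -[1]mulr1 ler_pM.
- by rewrite normrM -[leRHS]mulr1 ler_pM.
- by rewrite normrM -[leRHS]mul1r ler_pM.
Qed.

Let moll_meas y : [/\ measurable_fun (setT : set (measurableTypeR R * measurableTypeR R)) (mollifier e y),
  measurable_fun (setT : set (measurableTypeR R * measurableTypeR R)) (d1 (mollifier e y)) &
  measurable_fun (setT : set (measurableTypeR R * measurableTypeR R)) (d2 (mollifier e y))].
Proof.
have sm := mollifier_smooth e y.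
split; apply: continuous_measurable2; first exact: Csmooth_continuous.
  exact/Csmooth_continuous/Csmooth_d1.
exact/Csmooth_continuous/Csmooth_d2.
Qed.

Lemma mollified_derive (u : R * R -> R) (Bu r : R) :
  measurable_fun (setT : set (measurableTypeR R * measurableTypeR R)) u ->
  (forall w, `|u w| <= Bu) -> c < r -> r < d ->
  is_derive r 1 (fun s => \int[@leb2 R]_(w in D) (u w * mollifier e (zr s) w))
    ((\int[@leb2 R]_(w in D) (u w * d1 (mollifier e (zr r)) w))%R +
     al * (\int[@leb2 R]_(w in D) (u w * d2 (mollifier e (zr r)) w))%R).
Proof.
move=> mu uB cr rd.
have Bu0 : 0 <= Bu by exact: le_trans (uB z).
have ei : 0 <= e^-1 by rewrite invr_ge0 ltW.
pose f (s : R) w := u w * mollifier e (zr s) w.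
have df (s : R) (w : R * R) : is_derive s 1 (f ^~ w)
    (u w * (d1 (mollifier e (zr s)) w + al * d2 (mollifier e (zr s)) w)).
  have k := mollifier_path e al z w s.
  by rewrite /f; apply: is_derive_eq; rewrite /GRing.scale/=; ring.
have pf (s : R) (w : R * R) : partial1of2 f s w =
    u w * (d1 (mollifier e (zr s)) w + al * d2 (mollifier e (zr s)) w).
  by rewrite partial1of2E; case: (df s w).
pose G := Bu * (8 * e^-1 + `|al| * (8 * e^-1)).
have G0 : 0 <= G by rewrite /G mulr_ge0// addr_ge0// !mulr_ge0.
have crd : `]c, d[%classic r by rewrite /= in_itv/= cr.
have i1 : forall s, `]c, d[%classic s -> (@leb2 R).-integrable D (EFin \o f s).
  move=> s _; apply: (@bounded_integrable _ _ _ _ _ _ Bu) => //.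
    apply: measurable_funTS; apply: measurable_funM => //.
    by have [] := moll_meas (zr s).
  move=> w _; have [h _ _] := moll_bound (zr s) w.
  by rewrite /f normrM -[leRHS]mulr1 ler_pM.
have i2 : forall s w, `]c, d[%classic s -> D w -> derivable (f ^~ w) s 1.
  by move=> s w _ _; case: (df s w).
have i3 : (@leb2 R).-integrable D (EFin \o (fun=> G)).
  by apply: (@bounded_integrable _ _ _ _ _ _ G) => // w _; rewrite ger0_norm.
have i4 : forall s w, `]c, d[%classic s -> D w -> `|partial1of2 f s w| <= G.
  move=> s w _ _; have [_ h1 h2] := moll_bound (zr s) w.
  rewrite pf; move: (d1 (mollifier e (zr s)) w) (d2 (mollifier e (zr s)) w) h1 h2 => A B h1 h2.
  rewrite normrM ler_pM// (le_trans (ler_normD _ _))// lerD//.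
  by rewrite normrM ler_wpM2l.
have h1 := derivable_under_integral mD crd i1 i2 (fun=> G0) i3 i4.
have h2 := differentiation_under_integral mD crd i1 i2 (fun=> G0) i3 i4.
apply: DeriveDef; first exact: h1.
rewrite -derive1E; apply: (etrans h2).
have iu (k : R * R -> R) : measurable_fun (setT : set (measurableTypeR R * measurableTypeR R)) k ->
    (forall w, `|k w| <= 8 * e^-1) ->
    (@leb2 R).-integrable D (EFin \o (fun w => u w * k w)).
  move=> mk kb; apply: (@bounded_integrable _ _ _ _ _ _ (Bu * (8 * e^-1))) => //.
    by apply: measurable_funTS; exact: measurable_funM.
  by move=> w _; rewrite normrM ler_pM.
have [_ m1 m2] := moll_meas (zr r).
have j1 := iu _ m1 (fun w => let: And3 _ h _ := moll_bound (zr r) w in h).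
have j2 := iu _ m2 (fun w => let: And3 _ _ h := moll_bound (zr r) w in h).
have pr w := pf r w.
move: pr j1 j2; move: (d1 (mollifier e (zr r))) (d2 (mollifier e (zr r))) => k1 k2 pr j1 j2.
have j3 : (@leb2 R).-integrable D (EFin \o (fun w => al * (u w * k2 w))).
  have := integrableZl mD al j2; apply: eq_integrable => // w _.
rewrite -(@RintegralZl _ _ _ (@leb2 R) D _ al mD j2) -(@RintegralD _ _ _ (@leb2 R) D _ _ mD j1 j3).
by apply: eq_Rintegral => w _; rewrite pr; ring.
Qed.

(** The case [u = 1] of [mollified_derive]: derivatives of test functions have integral
    zero. *)
Lemma mollifier_mass_const r s : c < r -> r <= s -> s < d ->
  \int[@leb2 R]_(w in D) (mollifier e (zr r) w) =
  \int[@leb2 R]_(w in D) (mollifier e (zr s) w).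
Proof.
move=> cr rs sd.
have H (q : R) : c < q -> q < d ->
  is_derive q 1 (fun q => \int[@leb2 R]_(w in D) (mollifier e (zr q) w)) 0.
  move=> cq qd.
  have := @mollified_derive (cst 1) 1 q (@measurable_cst _ _ _ _ _ _)
    (fun=> ltac:(by rewrite normr1)) cq qd.
  have L1 (z1 z2 : R * R) : `|cst (1 : R) z1 - cst 1 z2| <= 0 * (`|z1.1 - z2.1| + `|z1.2 - z2.2|).
    by rewrite /= subrr normr0 mul0r.
  have B1 (z1 : R * R) : `|cst (1 : R) z1| <= 1 by rewrite /= normr1.
  have [E2 E1] := test_fun_ibp (lexx 0) T0 L1 B1 (mollifier_testD cq qd).
  have z2 w : dquot2 0 (cst (1 : R)) w = 0.
    by apply/eqP; rewrite -normr_le0; exact: quot_lim_bound.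
  have z1 w : dquot1 0 (cst (1 : R)) w = 0.
    by apply/eqP; rewrite -normr_le0; exact: quot_lim_bound.
  have i0 (k m : R * R -> R) : (forall w, k w = 0) ->
      \int[@leb2 R]_(w in ocyl T%:E) (k w * m w) = 0.
    move=> k0; under eq_Rintegral do rewrite k0 mul0r.
    by rewrite Rintegral_cst// mul0r.
  have F1 := etrans E1 (congr1 -%R (i0 _ (mollifier e (zr q)) z1)).
  have F2 := etrans E2 (congr1 -%R (i0 _ (mollifier e (zr q)) z2)).
  have s0 : - 0 + al * - 0 = 0 :> R by rewrite oppr0 mulr0 addr0.
  move=> K; have {}K := is_derive_eq K (etrans (congr2 (fun p q => p + al * q) F1 F2) s0).
  rewrite (_ : (fun q => _) = (fun s => \int[@leb2 R]_(w in D) (cst 1 w * mollifier e (zr s) w)))//.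
  by apply/funext => s'; apply: eq_Rintegral => w _; rewrite mul1r.
have := @mvt_lip R (fun q => \int[@leb2 R]_(w in D) (mollifier e (zr q) w)) (fun=> 0) r s 0.
move=> /(_ _ _ _ r s) h; apply/eqP; rewrite -subr_eq0 -normr_le0.
rewrite -[0](mul0r `|r - s|); apply: h => //.
- by move=> q rq qs; apply: H; lra.
- apply: derivable_within_continuous => q; rewrite in_itv/= => /andP[rq qs].
  by case: (H q _ _) => //; lra.
- by move=> q _ _; rewrite normr0.
Qed.

Lemma mollifier_mass_gt0 r : c < r -> r < d ->
  0 < \int[@leb2 R]_(w in D) (mollifier e (zr r) w).
Proof.
move=> cr rd.
have pos w : 0 <= mollifier e (zr r) w by rewrite mulr_ge0 ?smooth_bump_ge0.
rewrite lt_neqAle Rintegral_ge0// andbT; apply/eqP => I0.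
have [m0 _ _] := moll_meas (zr r).
have im : (@leb2 R).-integrable D (EFin \o mollifier e (zr r)).
  apply: (@bounded_integrable _ _ _ _ _ _ 1) => //; first exact: measurable_funTS.
  by move=> w _; have [] := moll_bound (zr r) w.
have : (\int[@leb2 R]_(w in D) `|(mollifier e (zr r) w)%:E| = 0)%E.
  under eq_integral do rewrite gee0_abs ?lee_fin//.
  rewrite -[LHS]fineK; last by exact: integrable_fin_num im.
  by rewrite -[fine _]/(Rintegral _ _ _) -I0.
move/(ae_eq_integral_abs _ mD) => H.
have {}H := H (measurable_int _ im).
have oU : open (D `&` (mollifier e (zr r) @^-1` [set y | 0 < y])).
  apply: openI; first exact: open_ocyl.
  apply: open_comp; last exact: open_gt.
  by move=> w _; exact/Csmooth_continuous/mollifier_smooth.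
have U0 : (D `&` (mollifier e (zr r) @^-1` [set y | 0 < y])) (zr r).
  split; first by apply: (inD cr rd); rewrite subrr normr0 ltW.
  by rewrite /= /mollifier !subrr mulr_gt0 ?smooth_bump0_gt0.
have [w [Dw /= hw] hw2] := open_not_null2 oU U0 H.
by have := hw2 Dw; case=> h; rewrite h ltxx in hw.
Qed.

Lemma mollified_bound (k : R * R -> R) (Bk K r : R) :
  measurable_fun (setT : set (measurableTypeR R * measurableTypeR R)) k ->
  (forall w, `|k w| <= Bk) -> 0 <= K ->
  (forall w, `|w.1 - (zr r).1| < e -> `|w.2 - (zr r).2| < e -> `|k w| <= K) ->
  `|\int[@leb2 R]_(w in D) (k w * mollifier e (zr r) w)| <=
    K * \int[@leb2 R]_(w in D) (mollifier e (zr r) w).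
Proof.
move=> mk kB K0 kK; have [m0 _ _] := moll_meas (zr r).
have Bk0 : 0 <= Bk by exact: le_trans (kB z).
have mb w : `|mollifier e (zr r) w| <= 1 by have [] := moll_bound (zr r) w.
have i1 : (@leb2 R).-integrable D (EFin \o (fun w => k w * mollifier e (zr r) w)).
  apply: (@bounded_integrable _ _ _ _ _ _ Bk) => //.
    by apply: measurable_funTS; exact: measurable_funM.
  by move=> w _; rewrite normrM -[leRHS]mulr1 ler_pM.
have i2 : (@leb2 R).-integrable D (EFin \o mollifier e (zr r)).
  by apply: (@bounded_integrable _ _ _ _ _ _ 1) => //; exact: measurable_funTS.
have i3 : (@leb2 R).-integrable D (EFin \o (fun w => K * mollifier e (zr r) w)).
  have := integrableZl mD K i2; apply: eq_integrable => // w _.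
have i4 : (@leb2 R).-integrable D (EFin \o (fun w => `|k w * mollifier e (zr r) w|)).
  exact: integrable_norm.
rewrite -(@RintegralZl _ _ _ (@leb2 R) D _ K mD i2).
apply: (le_trans (@le_normr_Rintegral _ _ _ (@leb2 R) D _ mD i1)).
apply: (@le_Rintegral _ _ _ (@leb2 R) D _ _ mD i4 i3) => w _.
have pos : 0 <= mollifier e (zr r) w by rewrite mulr_ge0 ?smooth_bump_ge0.
have [h1|h1] := leP e `|w.1 - (zr r).1|.
  by rewrite (mollifier_out e0 (or_introl h1)) !mulr0 normr0 lexx.
have [h2|h2] := leP e `|w.2 - (zr r).2|.
  by rewrite (mollifier_out e0 (or_intror h2)) !mulr0 normr0 lexx.
by rewrite normrM (ger0_norm pos) ler_wpM2r// kK.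
Qed.
End weak_path.

(** By the equation, the average of [u] around the moving point has as derivative the
    average of [(a - al) * p], where [p] is the weak space derivative. As [al] is the
    value of [a] at the start, [a - al] is [O(eta + e)] there, and integration over the
    path gives [O(eta^2)]. The smoothing costs [O(e)]. *)
Lemma weak_transport_at (R : realType) (T M Bu La Ba P e k : R) (u a p : R * R -> R)
    (z : R * R) (eta : R) :
  let al := a z in let zr r := (z.1 - r, z.2 - r * al) in
  0 < T -> 0 < e -> 0 < eta -> 0 < k -> 0 <= M -> 0 <= La -> 0 <= P ->
  (forall z z', `|u z - u z'| <= M * (`|z.1 - z'.1| + `|z.2 - z'.2|)) ->
  (forall z, `|u z| <= Bu) ->
  (forall z z', `|a z - a z'| <= La * (`|z.1 - z'.1| + `|z.2 - z'.2|)) ->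
  (forall z, `|a z| <= Ba) ->
  measurable_fun (setT : set (measurableTypeR R * measurableTypeR R)) p ->
  (forall z, `|p z| <= P) ->
  (forall phi, test_fun (ocyl T%:E) phi ->
     ((\int[@leb2 R]_(z in ocyl T%:E) (u z * d2 phi z) =
       - (\int[@leb2 R]_(z in ocyl T%:E) (p z * phi z)))%R /\
     (\int[@leb2 R]_(z in ocyl T%:E) (u z * d1 phi z) =
       (\int[@leb2 R]_(z in ocyl T%:E) (a z * p z * phi z)))%R)) ->
  (forall r, - k < r -> r < eta + k -> forall w : R * R,
    `|w.1 - (zr r).1| <= e -> `|w.2 - (zr r).2| <= e -> ocyl T%:E w) ->
  `|u (zr 0) - u (zr eta)| <= P * La * (1 + Ba) * eta ^+ 2 +
    (4 * M + 2 * eta * P * La) * e.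
Proof.
move=> al zr T0 e0 eta0 k0 M0 La0 P0 uL uB aL aB mp pP weak inD.
have cu := global_lip_continuous uL; have mu := continuous_measurable2 cu.
have ca := global_lip_continuous aL; have ma := continuous_measurable2 ca.
have Ba0 : 0 <= Ba by exact: le_trans (aB z).
have Bu0 : 0 <= Bu by exact: le_trans (uB z).
have alB : `|al| <= Ba by exact: aB.
pose D : set (measurableTypeR R * measurableTypeR R) := ocyl T%:E.
have mD : measurable D.
  by rewrite /D ocyl_rect; apply: measurableX; exact: measurable_itv.
pose G r := \int[@leb2 R]_(w in D) (u w * mollifier e (zr r) w).
pose I0 := \int[@leb2 R]_(w in D) (mollifier e (zr 0) w).
have I00 : 0 < I0 by apply: (@mollifier_mass_gt0 R T e al z (- k) (eta + k) e0 inD); lra.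
have IE r : - k < r -> r < eta + k -> \int[@leb2 R]_(w in D) (mollifier e (zr r) w) = I0.
  move=> h1 h2; have [r0|r0] := leP 0 r.
    by rewrite /I0 -(@mollifier_mass_const R T e al z (- k) (eta + k) T0 e0 inD 0 r _ r0 h2)//; lra.
  by rewrite /I0 (@mollifier_mass_const R T e al z (- k) (eta + k) T0 e0 inD r 0 h1 (ltW r0))//; lra.
pose G' r := \int[@leb2 R]_(w in D) (((a w - al) * p w) * mollifier e (zr r) w).
have mk : measurable_fun (setT : set (measurableTypeR R * measurableTypeR R))
    (fun w => (a w - al) * p w).
  by apply: measurable_funM => //; apply: measurable_funB.
have dG r : - k < r -> r < eta + k -> is_derive r 1 G (G' r).
  move=> h1 h2.
  have K := @mollified_derive R T e al z (- k) (eta + k) e0 u Bu r mu uB h1 h2.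
  have [W2 W1] := weak _ (@mollifier_testD R T e al z (- k) (eta + k) e0 inD r h1 h2).
  apply: (is_derive_eq K).
  apply: etrans (congr2 (fun x y => x + al * y) W1 W2) _.
  have m0 := continuous_measurable2 (Csmooth_continuous (mollifier_smooth e (zr r))).
  have mb w : `|mollifier e (zr r) w| <= 1.
    have [b1 _] := smooth_bump_bound (w.1 - (zr r).1) e0.
    have [b2 _] := smooth_bump_bound (w.2 - (zr r).2) e0.
    by rewrite /mollifier normrM -[1]mulr1 ler_pM.
  move: m0 mb; rewrite /G'; move: (mollifier e (zr r)) => phi m0 mb.
  have Doo : (@leb2 R D < +oo)%E by rewrite /D ocyl_rect; exact: leb2_rect_fin.
  have i1 : (@leb2 R).-integrable D (EFin \o (fun w => p w * phi w)).
    apply: (@bounded_integrable _ _ _ _ _ _ P) => //.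
      by apply: measurable_funTS; exact: measurable_funM.
    by move=> w _; rewrite normrM -[leRHS]mulr1 ler_pM.
  have i2 : (@leb2 R).-integrable D (EFin \o (fun w => a w * p w * phi w)).
    apply: (@bounded_integrable _ _ _ _ _ _ (Ba * P)) => //.
      apply: measurable_funTS; apply: measurable_funM => //.
      exact: measurable_funM.
    by move=> w _; rewrite normrM -[leRHS]mulr1 ler_pM// normrM ler_pM.
  have i3 : (@leb2 R).-integrable D (EFin \o (fun w => al * (p w * phi w))).
    have := integrableZl mD al i1; apply: eq_integrable => // w _.
  rewrite mulrN -(@RintegralZl _ _ _ (@leb2 R) D _ al mD i1).
  rewrite -(@RintegralB _ _ _ (@leb2 R) D _ _ mD i2 i3).
  by apply: eq_Rintegral => w _; ring.
pose K := La * (2 * e + eta * (1 + Ba)) * P.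
have K0 : 0 <= K by rewrite /K !mulr_ge0// addr_ge0// ?mulr_ge0 ?addr_ge0// ltW.
have G'b r : 0 < r -> r < eta -> `|G' r| <= K * I0.
  move=> r0 re; rewrite -(IE r); [|lra|lra].
  apply: (@mollified_bound _ T e al z e0 _ ((Ba + Ba) * P)) => // [w|w h1 h2].
    by rewrite normrM ler_pM// (le_trans (ler_normB _ _))// lerD.
  rewrite normrM ler_pM// (le_trans (aL _ _))// ler_wpM2l//.
  have h3 : `|w.1 - z.1| <= e + eta.
    by move: h1; rewrite /= ltr_norml => /andP[h1 h1']; rewrite ler_norml; lra.
  have h4 : `|w.2 - z.2| <= e + eta * Ba.
    rewrite (_ : w.2 - z.2 = (w.2 - (z.2 - r * al)) - r * al); last by ring.
    rewrite (le_trans (ler_normB _ _))// lerD//; first exact: ltW.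
    by rewrite normrM (gtr0_norm r0) ler_pM// ltW.
  by lra.
have dist : `|G 0 - G eta| <= (K * I0) * `|0 - eta|.
  apply: (@mvt_lip _ G G' 0 eta) => //.
  - by move=> r r0 re; apply: dG; lra.
  - apply: derivable_within_continuous => r; rewrite in_itv/= => /andP[r0 re].
    by case: (dG r _ _) => //; lra.
  - exact: ltW.
  - exact: ltW.
have near r : - k < r -> r < eta + k -> `|G r - u (zr r) * I0| <= (2 * M * e) * I0.
  move=> h1 h2; rewrite -(IE r h1 h2).
  have m0 := continuous_measurable2 (Csmooth_continuous (mollifier_smooth e (zr r))).
  have mb w : `|mollifier e (zr r) w| <= 1.
    have [b1 _] := smooth_bump_bound (w.1 - (zr r).1) e0.
    have [b2 _] := smooth_bump_bound (w.2 - (zr r).2) e0.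
    by rewrite /mollifier normrM -[1]mulr1 ler_pM.
  have Doo : (@leb2 R D < +oo)%E by rewrite /D ocyl_rect; exact: leb2_rect_fin.
  have := @mollified_bound _ T e al z e0 (fun w => u w - u (zr r)) (Bu + Bu)
    (2 * M * e) r.
  rewrite -/zr => hb.
  have i1 : (@leb2 R).-integrable D (EFin \o (fun w => u w * mollifier e (zr r) w)).
    apply: (@bounded_integrable _ _ _ _ _ _ Bu) => //.
      by apply: measurable_funTS; exact: measurable_funM.
    by move=> w _; rewrite normrM -[leRHS]mulr1 ler_pM.
  have i2 : (@leb2 R).-integrable D (EFin \o mollifier e (zr r)).
    by apply: (@bounded_integrable _ _ _ _ _ _ 1) => //; exact: measurable_funTS.
  have i3 : (@leb2 R).-integrable D (EFin \o (fun w => u (zr r) * mollifier e (zr r) w)).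
    have := integrableZl mD (u (zr r)) i2; apply: eq_integrable => // w _.
  rewrite /G -(@RintegralZl _ _ _ (@leb2 R) D _ (u (zr r)) mD i2).
  rewrite -(@RintegralB _ _ _ (@leb2 R) D _ _ mD i1 i3).
  have -> : \int[@leb2 R]_(w in D) (u w * mollifier e (zr r) w - u (zr r) * mollifier e (zr r) w)
    = \int[@leb2 R]_(w in D) ((u w - u (zr r)) * mollifier e (zr r) w).
    by apply: eq_Rintegral => w _; ring.
  apply: hb.
  - by apply: measurable_funB => //; exact: measurable_cst.
  - by move=> w; rewrite (le_trans (ler_normB _ _))// lerD.
  - by rewrite !mulr_ge0// ltW.
  - move=> w h3 h4; rewrite (le_trans (uL _ _))//.
    rewrite (_ : 2 * M * e = M * (e + e)); last by ring.
    by rewrite ler_wpM2l// lerD// ltW.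
have n0 := near 0 ltac:(lra) ltac:(lra).
have n1 := near eta ltac:(lra) ltac:(lra).
rewrite sub0r normrN (gtr0_norm eta0) in dist.
rewrite -(ler_pM2r I00) -[`|_ - _| * I0](_ : `|u (zr 0) * I0 - u (zr eta) * I0| = _); last first.
  by rewrite -mulrBl normrM (gtr0_norm I00).
have E : (P * La * (1 + Ba) * eta ^+ 2 + (4 * M + 2 * eta * P * La) * e) * I0 =
  2 * M * e * I0 + (K * I0) * eta + 2 * M * e * I0 by rewrite /K; ring.
rewrite E; apply: le_trans (ler_distD (G eta) _ _) _; apply: lerD; last exact: n1.
apply: le_trans (ler_distD (G 0) _ _) _; apply: lerD; last exact: dist.
by rewrite distrC.
Qed.

(** The width [e] of the mollifier tends to 0. *)
Lemma weak_transport (R : realType) (T M Bu La Ba : R) (u a : R * R -> R) :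
  0 < T -> 0 <= M -> 0 <= La ->
  (forall z z', `|u z - u z'| <= M * (`|z.1 - z'.1| + `|z.2 - z'.2|)) ->
  (forall z, `|u z| <= Bu) ->
  (forall z z', `|a z - a z'| <= La * (`|z.1 - z'.1| + `|z.2 - z'.2|)) ->
  (forall z, `|a z| <= Ba) ->
  transport_distr (ocyl T%:E) a u ->
  exists C, forall t x eta : R, 0 < eta -> ocyl T%:E (t, x) ->
    ocyl T%:E (t - eta, x - eta * a (t, x)) ->
    `|u (t, x) - u (t - eta, x - eta * a (t, x))| <= C * eta ^+ 2.
Proof.
move=> T0 M0 La0 uL uB aL aB tr.
have ca := global_lip_continuous aL.
have [p [P [P0 mp pP weak]]] := transport_distr_bounded ca aB T0 tr.
exists (P * La * (1 + Ba)) => t x eta eta0 [/= t0 tT x01] [/= te0 teT xe01].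
rewrite !lte_fin in tT teT.
set al := a (t, x) in xe01 *.
pose m := Num.min (Num.min (t - eta) (T - t))
  (Num.min (Num.min x (1 - x)) (Num.min (x - eta * al) (1 - (x - eta * al)))).
have m0 : 0 < m by rewrite /m !lt_min; repeat (apply/andP; split); lra.
have [m1 m2 m3] : [/\ m <= t - eta, m <= T - t & m <= x].
  by rewrite /m !ge_min !lexx ?orbT; split.
have [m4 m5 m6] : [/\ m <= 1 - x, m <= x - eta * al & m <= 1 - (x - eta * al)].
  by rewrite /m !ge_min !lexx ?orbT; split.
have al1 : 0 < 1 + `|al| by have := normr_ge0 al; lra.
(* the path may be prolonged by k at both ends with room for the mollifier *)
pose k := m / (4 * (1 + `|al|)).
have k0 : 0 < k by rewrite divr_gt0// mulr_gt0.
have kal : k + k * `|al| = m / 4.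
  by rewrite /k; field; rewrite gt_eqF.
have kal0 : 0 <= k * `|al| by rewrite mulr_ge0// ltW.
apply: (@le_of_small _ _ _ (4 * M + 2 * eta * P * La) (m / 2)); first lra.
move=> e e0 em.
have := @weak_transport_at R T M Bu La Ba P e k u a p (t, x) eta T0 e0 eta0 k0 M0 La0
  P0 uL uB aL aB mp pP weak.
rewrite /= mul0r !subr0 -/al; apply.
move=> r r1 r2 w /=; rewrite !ler_norml => h1 h2.
have hr : m - m / 4 <= x - r * al /\ x - r * al <= 1 - (m - m / 4).
  have [al0|al0] := leP 0 al.
    have p1 : 0 <= (eta + k - r) * al by rewrite mulr_ge0// subr_ge0 ltW.
    have p2 : 0 <= (r + k) * al by rewrite mulr_ge0// -lerBlDr sub0r ltW.
    by rewrite ger0_norm// in kal; clear - p1 p2 k0 kal m3 m4 m5 m6; lra.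
  have al0' : 0 <= - al by rewrite oppr_ge0 ltW.
  have p1 : 0 <= (eta + k - r) * - al by rewrite mulr_ge0// subr_ge0 ltW.
  have p2 : 0 <= (r + k) * - al by rewrite mulr_ge0// -lerBlDr sub0r ltW.
  by rewrite ltr0_norm// in kal; clear - p1 p2 k0 kal m3 m4 m5 m6; lra.
by split => /=; rewrite ?lte_fin; clear - hr m0 m1 m2 h1 h2 r1 r2 em k0 kal kal0; lra.
Qed.

(** * Equivalence of the two forms of the transport equation *)

Lemma flip_global_lip (R : realType) (L : R) (w : R * R -> R) :
  (forall z z', `|w z - w z'| <= L * (`|z.1 - z'.1| + `|z.2 - z'.2|)) ->
  forall z z', `|flip w z - flip w z'| <= L * (`|z.1 - z'.1| + `|z.2 - z'.2|).
Proof.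
move=> wL z z'; rewrite (le_trans (wL _ _))//=.
have -> : 1 - z.2 - (1 - z'.2) = - (z.2 - z'.2) by ring.
by rewrite normrN.
Qed.

Lemma cyl_bounded (R : realType) (T M : R) (u : R * R -> R) :
  0 <= T -> 0 <= M -> Lip2 M (cyl T%:E) u ->
  forall z, `|u (clamp2 T z)| <= `|u (0, 0)| + M * (T + 1).
Proof.
move=> T0 M0 uL z.
have cz := clamp2_cyl z T0.
have c0 : cyl T%:E ((0, 0) : R * R) by split; rewrite //= ?lee_fin ?lexx ?ler01.
have := uL _ _ cz c0; case: cz => /=; rewrite lee_fin => h1 h2 /andP[h3 h4].
rewrite !subr0 (ger0_norm h1) (ger0_norm h3) => h.
have h5 : M * (clamp T z.1 + clamp 1 z.2) <= M * (T + 1) by rewrite ler_wpM2l// lerD.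
have h6 := ler_normB (u (clamp2 T z) - u (0, 0)) (- u (0, 0)).
rewrite normrN opprK subrK in h6; lra.
Qed.

(** Points with [t = T] or [x = 1] are approached by shifting the step backward in both
    variables by [k]; since [a >= c] the foot of the shifted step stays inside. *)
Lemma transported_closure (R : realType) (T c M La C : R) (u a : R * R -> R) :
  0 < c -> 0 <= M -> 0 <= La ->
  (forall z z', `|u z - u z'| <= M * (`|z.1 - z'.1| + `|z.2 - z'.2|)) ->
  (forall z z', `|a z - a z'| <= La * (`|z.1 - z'.1| + `|z.2 - z'.2|)) ->
  (forall z, c <= a z) ->
  (forall t x e : R, 0 < e -> ocyl T%:E (t, x) ->
    ocyl T%:E (t - e, x - e * a (t, x)) ->
    `|u (t, x) - u (t - e, x - e * a (t, x))| <= C * e ^+ 2) ->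
  transported C T a u.
Proof.
move=> c0 M0 La0 uL aL ac tr t x e e0 et tT xe /andP[x0 x1].
set al := a (t, x) in xe *.
have ec : 0 < e * al by rewrite mulr_gt0// (lt_le_trans c0 (ac _)).
pose q := 1 + 2 * e * La.
have q1 : 1 <= q by rewrite /q lerDl !mulr_ge0// ltW.
pose m := Num.min (t - e) ((x - e * al) / q).
have m0 : 0 < m by rewrite lt_min subr_gt0 et divr_gt0//; lra.
apply: (@le_of_small _ _ _ (4 * M + 2 * e * La * M) m m0) => k k0.
rewrite lt_min ltr_pdivlMr; last lra.
move=> /andP[k1 k2].
have kq : k <= k * q by rewrite ler_peMr// ltW.
have dz : `|a (t - k, x - k) - al| <= La * (k + k).
  rewrite (le_trans (aL _ _))//=.
  have -> : t - k - t = - k by ring.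
  have -> : x - k - x = - k by ring.
  by rewrite normrN gtr0_norm.
have dz2 : `|e * a (t - k, x - k) - e * al| <= e * (La * (k + k)).
  by rewrite -mulrBr normrM (gtr0_norm e0) ler_wpM2l// ltW.
have ke : k * q = k + e * (La * (k + k)) by rewrite /q; ring.
have ac' := mulr_gt0 e0 (lt_le_trans c0 (ac (t - k, x - k))).
have := tr (t - k) (x - k) e e0.
have d2 := dz2; rewrite ler_norml in d2.
have o1 : ocyl T%:E (t - k, x - k) by split => /=; rewrite ?lte_fin; lra.
have o2 : ocyl T%:E (t - k - e, x - k - e * a (t - k, x - k)).
  by split => /=; rewrite ?lte_fin; lra.
move=> /(_ o1 o2) H.
have H1 : `|u (t, x) - u (t - k, x - k)| <= M * (k + k).
  by rewrite (le_trans (uL _ _))//= !subKr (gtr0_norm k0).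
have H2 : `|u (t - k - e, x - k - e * a (t - k, x - k)) - u (t - e, x - e * al)|
    <= M * (k + (k + e * (La * (k + k)))).
  rewrite (le_trans (uL _ _))//= ler_wpM2l//.
  have -> : t - k - e - (t - e) = - k by ring.
  rewrite normrN (gtr0_norm k0) lerD//.
  have -> : x - k - e * a (t - k, x - k) - (x - e * al) =
    (- k) - (e * a (t - k, x - k) - e * al) by ring.
  by rewrite (le_trans (ler_normB _ _))// normrN (gtr0_norm k0) lerD.
have E : C * e ^+ 2 + (4 * M + 2 * e * La * M) * k =
  M * (k + k) + C * e ^+ 2 + M * (k + (k + e * (La * (k + k)))) by ring.
by rewrite E; move: H H1 H2; rewrite !ler_norml; lra.
Qed.

Lemma weak_transported (R : realType) (T M La c : R) (u a : R * R -> R) :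
  0 < T -> 0 < c -> 0 <= M -> 0 <= La ->
  Lip2 M (cyl T%:E) u -> Lip2 La (cyl T%:E) a ->
  transport_distr (ocyl T%:E) a u ->
  ((forall z, cyl T%:E z -> c <= a z) -> exists C, transported C T a u) /\
  ((forall z, cyl T%:E z -> a z <= - c) ->
     exists C, transported C T (flip (fun z => - a z)) (flip u)).
Proof.
move=> T0 c0 M0 La0 uL aL tr; have T0' := ltW T0.
pose u' z := u (clamp2 T z); pose a' z := a (clamp2 T z).
have uL' := Lip2_clamp M0 T0' uL; have aL' := Lip2_clamp La0 T0' aL.
have o2c z : ocyl T%:E z -> cyl T%:E z.
  by move=> [h1 h2 /andP[h3 h4]]; split; rewrite ?ltW.
have uE z : cyl T%:E z -> u' z = u z by move=> hz; rewrite /u' clamp2E.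
have aE z : cyl T%:E z -> a' z = a z by move=> hz; rewrite /a' clamp2E.
have tr' : transport_distr (ocyl T%:E) a' u'.
  by apply: transport_distr_eq tr => z /o2c hz; rewrite ?uE ?aE.
have [C HC] := weak_transport T0 M0 La0 uL' (cyl_bounded T0' M0 uL) aL'
  (cyl_bounded T0' La0 aL) tr'.
split=> ac; exists C.
  have := @transported_closure _ T c M La C u' a' c0 M0 La0 uL' aL'
    (fun z => ac _ (clamp2_cyl z T0')) HC.
  move=> H t x e e0 et tT xe x01.
  have z1 : cyl T%:E (t, x) by split; rewrite //= ?lee_fin ?(ltW (lt_trans e0 et)).
  have z2 : cyl T%:E (t - e, x - e * a (t, x)).
    by apply: foot_cyl => //; exact: le_trans (ltW c0) (ac _ z1).
  by have := H t x e e0 et tT; rewrite aE// !uE//; apply.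
have naL z z' : `|(- a' z) - (- a' z')| <= La * (`|z.1 - z'.1| + `|z.2 - z'.2|).
  by rewrite -opprD normrN; exact: aL'.
have fo t x : ocyl T%:E (t, x) -> ocyl T%:E (t, 1 - x).
  by case=> /= h1 h2 h3; split => //=; lra.
have := @transported_closure _ T c M La C (flip u') (flip (fun z => - a' z)) c0 M0 La0
  (flip_global_lip uL') (flip_global_lip naL).
have nc z : c <= flip (fun z => - a' z) z.
  by have := ac _ (clamp2_cyl (z.1, 1 - z.2) T0'); rewrite /flip /a'; lra.
move=> /(_ nc) H.
have {}H : transported C T (flip (fun z => - a' z)) (flip u').
  apply: H => t x e e0 /fo o1 /fo; rewrite /flip /= mulrN opprK.
  have -> : 1 - (x + e * a' (t, 1 - x)) = (1 - x) - e * a' (t, 1 - x) by ring.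
  by move=> o2; exact: HC.
move=> t x e e0 et tT xe x01.
have z1 : cyl T%:E (t, 1 - x).
  by split; rewrite //= ?lee_fin ?(ltW (lt_trans e0 et))//; lra.
have z2 : cyl T%:E (t - e, 1 - (x - e * flip (fun z => - a z) (t, x))).
  apply: (flip_cyl _ (t - e, x - e * flip (fun z => - a z) (t, x))).2.
  apply: foot_cyl => //; rewrite /flip /= lerNr oppr0 (le_trans (ac _ z1))//.
  by rewrite lerNl oppr0 ltW.
have := H t x e e0 et tT.
rewrite [flip (fun z => - a' z) _]/flip/= aE// -[- a (t, 1 - x)]/(flip (fun z => - a z) (t, x)).
by rewrite /flip /= !uE//; apply.
Qed.

(** The step back is taken from [(t, x + a e)], which brings it within [O(e^2)] of
    [(t - e, x)] because [a] is Lipschitz. *)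
Lemma transported_local (R : realType) (T c M La Ba C : R) (u a : R * R -> R) :
  0 < c -> 0 <= M -> 0 <= La ->
  (forall z z', `|u z - u z'| <= M * (`|z.1 - z'.1| + `|z.2 - z'.2|)) ->
  (forall z z', `|a z - a z'| <= La * (`|z.1 - z'.1| + `|z.2 - z'.2|)) ->
  (forall z, c <= a z) -> (forall z, `|a z| <= Ba) ->
  transported C T a u ->
  forall t x : R, 0 < t -> t <= T -> 0 < x -> x < 1 -> exists C' d : R, 0 < d /\
    forall e : R, 0 < e -> e < d ->
      `|u (t, x + a (t, x) * e) - u (t - e, x)| <= C' * e ^+ 2.
Proof.
move=> c0 M0 La0 uL aL ac aB tr t x t0 tT x0 x1.
have ap z : 0 < a z by exact: lt_le_trans (ac z).
have Ba0 : 0 < Ba by apply: lt_le_trans (aB (0, 0)); rewrite normr_gt0 gt_eqF.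
exists (C + M * (La * Ba)).
exists (Num.min t (Num.min (x / Ba) ((1 - x) / Ba))).
split; first by rewrite !lt_min t0 !divr_gt0// subr_gt0.
move=> e e0; rewrite !lt_min !ltr_pdivlMr// => /and3P[et ex ex1].
set x' := x + a (t, x) * e.
have aBz z : a z <= Ba by have := aB z; rewrite gtr0_norm.
have h1 : 0 < a (t, x) * e by rewrite mulr_gt0.
have h2 z : a z * e <= e * Ba by rewrite mulrC ler_wpM2l// ltW.
have h3 := h2 (t, x); have h4 := h2 (t, x'); rewrite mulrC in h4.
have := tr t x' e e0 et tT; rewrite /x' in h4 *.
move=> /(_ ltac:(lra) ltac:(lra)) H.
have H2 : `|u (t - e, x + a (t, x) * e - e * a (t, x + a (t, x) * e)) - u (t - e, x)| <=
    M * (La * Ba) * e ^+ 2.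
  rewrite (le_trans (uL _ _))//= subrr normr0 add0r -[leRHS]mulrA ler_wpM2l//.
  rewrite [X in `|X|](_ : _ = e * (a (t, x) - a (t, x + a (t, x) * e))); last by ring.
  rewrite normrM (gtr0_norm e0).
  have /= h5 := aL (t, x) (t, x + a (t, x) * e).
  rewrite subrr normr0 add0r [x - _](_ : _ = - (a (t, x) * e)) in h5; last by ring.
  rewrite normrN (gtr0_norm h1) in h5.
  have h6 : La * (a (t, x) * e) <= La * (e * Ba) by rewrite ler_wpM2l.
  rewrite [leRHS](_ : _ = e * (La * (e * Ba))); last by ring.
  by rewrite ler_wpM2l ?(ltW e0)// (le_trans h5).
rewrite mulrDl; move: H H2; rewrite !ler_norml; lra.
Qed.

(** Beyond [T] the extension is constant in time, and it is a solution when it is zero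
    there. *)
Lemma transported_weak (R : realType) (b : \bar R) (T M La c C : R) (u a : R * R -> R) :
  (0 < b)%E -> 0 <= T -> 0 < c -> 0 <= M -> 0 <= La ->
  Lip2 M (cyl T%:E) u -> Lip2 La (cyl T%:E) a ->
  ((T%:E < b)%E -> forall x : R, 0 <= x <= 1 -> u (T, x) = 0) ->
  ((forall z, cyl T%:E z -> c <= a z) /\ transported C T a u) \/
  ((forall z, cyl T%:E z -> a z <= - c) /\
     transported C T (flip (fun z => - a z)) (flip u)) ->
  transport_distr (ocyl b) (fun z => a (clamp2 T z)) (fun z => u (clamp2 T z)).
Proof.
move=> b0 T0 c0 M0 La0 uL aL u0 tr.
pose u' z := u (clamp2 T z); pose a' z := a (clamp2 T z).
have uL' := Lip2_clamp M0 T0 uL; have aL' := Lip2_clamp La0 T0 aL.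
have aB := cyl_bounded T0 La0 aL.
have uE z : cyl T%:E z -> u' z = u z by move=> hz; rewrite /u' clamp2E.
have aE z : cyl T%:E z -> a' z = a z by move=> hz; rewrite /a' clamp2E.
apply: (transport_weak b0 M0 uL' (cyl_bounded T0 M0 uL) (global_lip_continuous aL') aB).
move=> t x [/= t0 tb /andP[x0 x1]].
have [tT|Tt] := leP t T; last first.
  exists 0, (t - T); split; first by lra.
  move=> e e0 eT; rewrite mul0r.
  have cT s : T <= s -> clamp T s = T by move=> Ts; rewrite /clamp min_r// max_r.
  have Tb : (T%:E < b)%E by apply: lt_trans tb; rewrite lte_fin.
  rewrite /clamp2 /= !cT; try lra.
  by rewrite !(u0 Tb) ?subrr ?normr0//; exact: clamp_itv.
case: tr => -[ac tr].
  have H := @transported_local _ T c M La _ C u' a' c0 M0 La0 uL' aL'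
    (fun z => ac _ (clamp2_cyl z T0)) aB.
  apply: H => // s y e e0 es sT ye y01.
  have z1 : cyl T%:E (s, y) by split; rewrite //= ?lee_fin ?(ltW (lt_trans e0 es)).
  rewrite aE// in ye *.
  have z2 : cyl T%:E (s - e, y - e * a (s, y)).
    by apply: foot_cyl => //; exact: le_trans (ltW c0) (ac _ z1).
  by rewrite !uE//; exact: tr.
have naL z z' : `|(- a' z) - (- a' z')| <= La * (`|z.1 - z'.1| + `|z.2 - z'.2|).
  by rewrite -opprD normrN; exact: aL'.
have H := @transported_local _ T c M La (`|a (0, 0)| + La * (T + 1)) C (flip u')
  (flip (fun z => - a' z)) c0 M0 La0 (flip_global_lip uL') (flip_global_lip naL).
have [] := H _ _ _ t (1 - x) t0 tT ltac:(lra) ltac:(lra).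
- move=> z; have := ac _ (clamp2_cyl (z.1, 1 - z.2) T0); rewrite /flip /a'; lra.
- by move=> z; rewrite /flip normrN; exact: aB.
- move=> s y e e0 es sT ye y01.
  have z1 : cyl T%:E (s, 1 - y).
    by split; rewrite //= ?lee_fin ?(ltW (lt_trans e0 es))//; lra.
  have aE' : flip (fun z => - a' z) (s, y) = flip (fun z => - a z) (s, y).
    by rewrite /flip /= aE.
  rewrite aE' in ye *.
  have z2 : cyl T%:E (s - e, 1 - (y - e * flip (fun z => - a z) (s, y))).
    apply: (flip_cyl _ (s - e, y - e * flip (fun z => - a z) (s, y))).2.
    apply: foot_cyl => //; rewrite /flip /= lerNr oppr0 (le_trans (ac _ z1))//.
    by rewrite lerNl oppr0 ltW.
  by have := tr s y e e0 es sT ye y01; rewrite /flip /= !uE.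
move=> C' [d [d0 Hd]]; exists C', d; split => // e e0 ed.
have := Hd e e0 ed; rewrite /flip /= !subKr.
have -> : 1 - (1 - x + - a' (t, x) * e) = x + a' (t, x) * e by ring.
by [].
Qed.

(** * The feedback at the right boundary *)

(** A power of the positive part, derivable on the whole line when the exponent exceeds 1. *)
Definition ppow (R : realType) (p s : R) : R := (Num.max 0 s) `^ p.

Lemma ppow_pos (R : realType) (p s : R) : 0 <= s -> ppow p s = s `^ p.
Proof. by move=> s0; rewrite /ppow max_r. Qed.

Lemma ppow_neg (R : realType) (p s : R) : p != 0 -> s <= 0 -> ppow p s = 0.
Proof. by move=> p0 s0; rewrite /ppow max_l// powR0. Qed.

Lemma ppow_derive (R : realType) (p s : R) : 1 < p ->
  is_derive s 1 (ppow p) (p * ppow (p - 1) s).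
Proof.
move=> p1; have p0 : p != 0 by rewrite gt_eqF//; lra.
have p10 : p - 1 != 0 by rewrite gt_eqF//; lra.
have [s0|s0|->] := ltgtP s 0.
- rewrite ppow_neg ?(ltW s0)// mulr0.
  have h : is_derive s 1 (cst 0 : R -> R) 0 by exact: is_derive_cst.
  apply: near_eq_is_derive h.
  have : \forall y \near s, y < 0 by exact: lt_nbhsl.
  by apply: filterS => y y0; rewrite ppow_neg ?ltW.
- rewrite ppow_pos ?(ltW s0)//.
  have h := is_derive1_powR p s0.
  apply: near_eq_is_derive h.
  have : \forall y \near s, 0 < y by exact: lt_nbhsr.
  by apply: filterS => y y0; rewrite ppow_pos ?ltW.
rewrite (ppow_neg p10 (lexx 0)) mulr0.
have H : h^-1 *: (ppow p (h *: (1 : R) + 0) - ppow p 0) @[h --> 0^'] --> (0 : R).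
  apply/cvgrPdist_le => /= e e0.
  near=> h.
  have hn : h != 0 by near: h; exact: nbhs_dnbhs_neq.
  have hd : `|h| <= e `^ (p - 1)^-1.
    near: h; exact: (dnbhs0_le (powR_gt0 (p - 1)^-1 e0)).
  rewrite (ppow_neg p0 (lexx 0)) subr0 addr0 /GRing.scale/= mulr1 sub0r normrN.
  have [h0|h0] := leP h 0; first by rewrite ppow_neg// mulr0 normr0 ltW.
  rewrite ppow_pos ?(ltW h0)// -[X in h `^ X](subrK 1) powRD; last by rewrite hn implybT.
  rewrite powRr1 ?(ltW h0)// mulrCA mulVf// mulr1 ger0_norm ?powR_ge0//.
  have -> : e = (e `^ (p - 1)^-1) `^ (p - 1).
    by rewrite -powRrM mulVf// powRr1// ltW.
  apply: ge0_ler_powR; rewrite ?nnegrE ?powR_ge0 ?(ltW h0)//; first lra.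
  by rewrite -(gtr0_norm h0).
apply: DeriveDef; first by apply/cvg_ex; exists 0; exact: H.
exact: (cvg_lim _ H).
Unshelve. all: by end_near. Qed.

Section friction.
Variables (R : realType) (K gamma : R).
Hypotheses (K0 : 0 < K) (g01 : 0 < gamma < 1).

Let g1 : 0 < 1 - gamma. Proof. by move: g01; lra. Qed.

(** Separation of variables turns the equation into an affine one for
    [|v|^(1 - gamma)], which reaches zero in finite time. *)
Definition friction (a t : R) : R :=
  Num.sg a * ppow (1 - gamma)^-1 (`|a| `^ (1 - gamma) - (1 - gamma) * K * t).

Lemma friction_derive (a t : R) :
  is_derive t 1 (friction a)
    (- K * Num.sg (friction a t) * `|friction a t| `^ gamma).
Proof.
have p1 : 1 < (1 - gamma)^-1 by rewrite invf_gt1//; move: g01; lra.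
have p0 : (1 - gamma)^-1 != 0 by rewrite gt_eqF//; lra.
have gn : gamma != 0 by rewrite gt_eqF//; move: g01; lra.
set s := `|a| `^ (1 - gamma) - (1 - gamma) * K * t.
have ds : is_derive t 1 (fun t => `|a| `^ (1 - gamma) - (1 - gamma) * K * t)
    (- ((1 - gamma) * K)).
  have h := is_derive_id t (1 : R).
  by apply: is_derive_eq; rewrite /GRing.scale/=; ring.
have h1 := @is_derive1_comp R (ppow (1 - gamma)^-1)
  (fun t => `|a| `^ (1 - gamma) - (1 - gamma) * K * t) t _ _ (ppow_derive s p1) ds.
have h2 : is_derive t 1 (friction a) (Num.sg a *
    ((1 - gamma)^-1 * ppow ((1 - gamma)^-1 - 1) s * - ((1 - gamma) * K))).
  apply: is_derive_eq; rewrite /GRing.scale/=; ring.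
apply: is_derive_eq.
have -> : (1 - gamma)^-1 * ppow ((1 - gamma)^-1 - 1) s * - ((1 - gamma) * K) =
  - K * ppow ((1 - gamma)^-1 - 1) s.
  by field; rewrite gt_eqF.
have [->|a0] := eqVneq a 0.
  by rewrite /friction sgr0 !mul0r sgr0 mulr0 mul0r.
rewrite mulrCA -!mulrA; congr (_ * _).
rewrite /friction -/s; have [s0|s0] := leP s 0.
  by rewrite !ppow_neg// ?mulr0 ?sgr0 ?mul0r// gt_eqF//; lra.
rewrite !ppow_pos ?(ltW s0)// normrM normr_sg a0 mul1r ger0_norm ?powR_ge0//.
rewrite sgrM sgr_id (gtr0_sg (powR_gt0 _ s0)) mulr1 -powRrM; congr (_ * _ `^ _).
by field; rewrite gt_eqF.
Qed.

Lemma friction_le (a t : R) : 0 <= t -> `|friction a t| <= `|a|.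
Proof.
move=> t0; rewrite /friction normrM.
have n1 : `|Num.sg a| <= 1 by rewrite normr_sg; case: (_ != _); rewrite ?lexx ?ler01.
have p0 : 0 < (1 - gamma)^-1 by rewrite invr_gt0.
rewrite -[leRHS]mul1r ler_pM// ger0_norm ?powR_ge0// /ppow.
rewrite -[leRHS](powRr1 (normr_ge0 a)) -[X in _ <= _ `^ X](mulfV (lt0r_neq0 g1)) powRrM.
apply: ge0_ler_powR; rewrite ?nnegrE ?powR_ge0 ?le_max ?lexx ?(ltW p0)//.
rewrite ge_max powR_ge0 gerBl// !mulr_ge0// ltW//.
Qed.

Lemma friction_extinct (a t : R) :
  `|a| `^ (1 - gamma) / ((1 - gamma) * K) <= t -> friction a t = 0.
Proof.
rewrite ler_pdivrMr ?mulr_gt0// mulrC => h.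
by rewrite /friction ppow_neg ?mulr0 ?subr_le0// invr_neq0// gt_eqF.
Qed.

Lemma friction0 (a : R) : friction a 0 = a.
Proof.
rewrite /friction mulr0 subr0 ppow_pos ?powR_ge0// -powRrM mulfV ?gt_eqF//.
by rewrite powRr1// -numEsg.
Qed.

Lemma friction_continuous (a : R) : continuous (friction a).
Proof.
move=> t; apply: differentiable_continuous; apply/derivable1_diffP.
by have [] := friction_derive a t.
Qed.

Lemma friction_ode (a : R) : boundary_ode K gamma a (friction a).
Proof.
split; [|exact: friction0|by move=> t _; exact: friction_derive].
by apply: continuous_subspaceT; exact: friction_continuous.
Qed.

Lemma friction_lip (a s t : R) : 0 <= s -> 0 <= t ->
  `|friction a s - friction a t| <= K * `|a| `^ gamma * `|s - t|.
Proof.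
move=> s0 t0.
have st : s <= Num.max s t /\ t <= Num.max s t by rewrite !le_max !lexx orbT.
apply: (@mvt_lip _ (friction a)
  (fun t => - K * Num.sg (friction a t) * `|friction a t| `^ gamma) 0 (Num.max s t)).
- by move=> x _ _; exact: friction_derive.
- by apply: continuous_subspaceT; exact: friction_continuous.
- move=> x x0 _; have := friction_le a (ltW x0); move: (friction a x) => y ya.
  rewrite !normrM normrN (gtr0_norm K0) -mulrA ler_pM2l//.
  have n1 : `|Num.sg y| <= (1 : R).
    by rewrite normr_sg; case: (_ != _); rewrite ?lexx ?ler01.
  rewrite -[leRHS]mul1r ler_pM// ger0_norm ?powR_ge0//.
  apply: ge0_ler_powR; rewrite ?nnegrE//.
  by move: g01; lra.
- by [].
- by case: st.
- by [].
- by case: st.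
Qed.

Lemma friction_force_homo (x y : R) : x <= y ->
  Num.sg x * `|x| `^ gamma <= Num.sg y * `|y| `^ gamma.
Proof.
have g0 : 0 <= gamma by move: g01; lra.
have gn : gamma != 0 by rewrite gt_eqF//; move: g01; lra.
move=> xy; have [x0|x0|x0] := ltgtP x 0; have [y0|y0|y0] := ltgtP y 0;
  rewrite ?x0 ?y0 ?sgr0 ?(gtr0_sg x0) ?(gtr0_sg y0) ?(ltr0_sg x0) ?(ltr0_sg y0) ?mul0r ?mul1r ?mulN1r //;
  rewrite ?oppr_le0 ?powR_ge0//; try (by exfalso; lra).
- rewrite lerN2; apply: ge0_ler_powR; rewrite ?nnegrE//.
  by rewrite !ltr0_norm// lerN2.
- by rewrite (@le_trans _ _ 0)// ?oppr_le0 powR_ge0.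
- apply: ge0_ler_powR; rewrite ?nnegrE//.
  by rewrite !gtr0_norm.
Qed.

(** The right-hand side is not Lipschitz at zero, but it is nonincreasing, so the
    squared distance between two solutions cannot grow. *)
Lemma boundary_ode_unique (a : R) (v : R -> R) : boundary_ode K gamma a v ->
  forall t, 0 <= t -> v t = friction a t.
Proof.
move=> [vc v0 dv] t; rewrite le_eqVlt => /predU1P[<-|t0]; first by rewrite v0 friction0.
pose F x := - K * Num.sg x * `|x| `^ gamma : R.
pose f := friction a.
have sub : `[0, t]%classic `<=` `[0, +oo[%classic.
  by move=> s /=; rewrite !in_itv/= andbT => /andP[].
have dH s : s \in `]0, t[%R -> is_derive s 1 (fun s => (v s - f s) ^+ 2)
    ((F (v s) - F (f s)) * (v s - f s) *+ 2).
  rewrite in_itv/= => /andP[s0 st].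
  have h1 := dv s s0; have h2 := @friction_derive a s.
  by apply: is_derive_eq; rewrite /GRing.scale/= /F -/f; ring.
have cH : {within `[0, t], continuous (fun s => (v s - f s) ^+ 2)}.
  have wc : {within `[0, t], continuous (fun s => v s - f s)}.
    have vc' := continuous_subspaceW sub vc.
    have fc : {within `[0, t], continuous f}.
      by apply: continuous_subspaceT; exact: friction_continuous.
    by move=> s; apply: cvgB; [exact: vc'|exact: fc].
  have -> : (fun s => (v s - f s) ^+ 2) = (fun s => (v s - f s) * (v s - f s)).
    by apply/funext => s; rewrite expr2.
  by move=> s; apply: cvgM; exact: wc.
have [s] := MVT t0 dH cH.
rewrite in_itv/= => /andP[s0 st] E.
have neg : (F (v s) - F (f s)) * (v s - f s) <= 0.
  have [vf|fv] := leP (v s) (f s).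
    rewrite mulr_ge0_le0 ?subr_le0// subr_ge0 /F !mulNr -!mulrA lerN2 ler_pM2l//.
    exact: friction_force_homo.
  rewrite mulr_le0_ge0 ?subr_ge0 ?(ltW fv)// subr_le0 /F !mulNr -!mulrA lerN2 ler_pM2l//.
  by apply: friction_force_homo; exact: ltW.
have : (v t - f t) ^+ 2 <= 0.
  move: E; rewrite v0 [f 0]friction0 subrr expr0n/= !subr0 => ->.
  by rewrite mulr_le0_ge0 ?(ltW t0)// -mulr_natl mulr_ge0_le0.
by rewrite exprn_even_le0//= subr_eq0 => /eqP.
Qed.

End friction.

(** * Essential bounds in one variable *)

Lemma Lip01P (R : realType) (f : R -> R) : Lip01 f ->
  exists2 k : R, 0 <= k &
    forall x y : R, 0 <= x <= 1 -> 0 <= y <= 1 -> `|f x - f y| <= k * `|x - y|.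
Proof.
move=> /pinfty_ex_gt0[k k0 hk]; exists k; first exact: ltW.
by move=> x y x01 y01; apply: (hk (x, y)); split; rewrite /= in_itv.
Qed.

Lemma Loo1P (R : realType) (D : set R) (f : R -> \bar R) (M : R) :
  0 <= M -> (Loo1 D f <= M%:E)%E <-> {ae @leb1 R, forall x, D x -> (`|f x| <= M%:E)%E}.
Proof.
move=> M0; rewrite /Loo1 unlock.
have -> : (0 < @leb1 R setT)%E.
  have : (@lebesgue_measure R `]0%R, 1%R[ <= @leb1 R setT)%E.
    by apply: le_measure => //; rewrite inE.
  by apply: lt_le_trans; rewrite lebesgue_measure_itv/= lte01 sube0 lte01.
split=> [/ess_supP|h].
  by apply: filterS => x /=; rewrite patchE => h Dx; rewrite mem_set in h.
apply/ess_supP; apply: (@filterS _ _ (ae_filter_ringOfSetsType (@leb1 R)) _ _ _ h) => x hx /=.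
by rewrite patchE; case: ifPn => [/set_mem/hx//|_]; rewrite abse0 lee_fin.
Qed.

Lemma open_not_null1 (R : realType) (a b : R) (P : R -> Prop) : a < b ->
  {ae @leb1 R, forall x, P x} -> exists x, [/\ a < x, x < b & P x].
Proof.
move=> ab [N [mN N0 hN]]; apply: contrapT => nP.
have BN : `]a, b[%classic `<=` N.
  move=> x; rewrite /= in_itv/= => /andP[h1 h2]; apply: hN => /= Px.
  by apply: nP; exists x.
have : (@lebesgue_measure R `]a, b[ <= 0)%E.
  by rewrite -N0; apply: le_measure => //; rewrite inE.
by rewrite lebesgue_measure_itv/= lte_fin ab -EFinB lee_fin; lra.
Qed.

(** A bound off a null set propagates to every point by continuity. *)
Lemma sup01_pointwise (R : realType) (f : R -> R) (M : R) : 0 <= M -> Lip01 f ->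
  (sup01 f <= M%:E)%E -> forall x : R, 0 <= x <= 1 -> `|f x| <= M.
Proof.
move=> M0 /Lip01P[k k0 fk] /(Loo1P _ _ M0) fM x x01.
apply: (@le_of_small _ _ _ k 1 ltr01) => e e0 e1.
have [y [y1 y2 hy]] := @open_not_null1 R (Num.max 0 (x - e)) (Num.min 1 (x + e)) _
  ltac:(rewrite lt_min !gt_max; lra) fM.
move: y1 y2; rewrite gt_max lt_min => /andP[y0 xy] /andP[y1 yx].
have := hy _; rewrite /= in_itv/= y0 y1 lee_fin => /(_ isT) h.
have := fk x y x01 ltac:(lra); have h2 : k * `|x - y| <= k * e.
  by rewrite ler_wpM2l// ler_norml; lra.
have := ler_normD (f x - f y) (f y); rewrite subrK; lra.
Qed.

(** An increment is the integral of the derivative. *)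
Lemma dsup01_lip (R : realType) (f : R -> R) (M : R) : 0 <= M -> Lip01 f ->
  (dsup01 f <= M%:E)%E ->
  forall x y : R, 0 <= x <= 1 -> 0 <= y <= 1 -> `|f x - f y| <= M * `|x - y|.
Proof.
move=> M0 /Lip01P[k k0 fk] /(Loo1P _ _ M0) fM x y.
pose F s := f (clamp 1 s).
have FL s t : `|F s - F t| <= k * `|s - t|.
  rewrite (le_trans (fk _ _ (clamp_itv _ ler01) (clamp_itv _ ler01)))//.
  by rewrite ler_wpM2l// clamp_lip.
have FE s : 0 <= s <= 1 -> F s = f s by move=> s01; rewrite /F clampE.
wlog xy : x y / x < y.
  move=> H x01 y01; case: (ltgtP x y) => [xy|yx|->].
  - exact: H.
  - by rewrite distrC (distrC x) H.
  - by rewrite !subrr normr0 mulr0.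
move=> x01 y01.
have [q [iq dq qE]] := lipschitz_FTC k0 xy FL.
rewrite distrC -(FE x x01) -(FE y y01) -qE.
have mI : measurable (`]x, y] : set (measurableTypeR R)) by exact: measurable_itv.
have nB : {ae @lebesgue_measure R, forall s, s != y}.
  exists [set y]; split => //; first exact: lebesgue_measure_set1.
  by move=> s /= /negP; rewrite negbK => /eqP.
have qM : {ae @lebesgue_measure R, forall s, `]x, y]%classic s -> (`|(q s)%:E| <= (cst M%:E) s)%E}.
  apply: (@filterS3 _ _ (ae_filter_ringOfSetsType (@lebesgue_measure R)) _ _ _ _ _ fM dq nB).
  move=> s h1 h2 h3; rewrite /= in_itv/= => /andP[xs]; rewrite le_eqVlt (negbTE h3)/= => sy.
  have s01 : 0 < s < 1 by lra.
  have dF := h2 xs sy.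
  have df : is_derive s 1 f (q s).
    apply: near_eq_is_derive dF.
    have : \forall t \near s, t \in `]0, 1[.
      by apply: near_in_itvoo; rewrite in_itv.
    by apply: filterS => t; rewrite in_itv/= => t01; apply: FE; lra.
  have := h1; rewrite /= in_itv/= s01 derive1E => /(_ isT).
  by case: df => _ ->.
rewrite (le_trans (le_normr_Rintegral mI iq))//.
have h0 : (\int[@lebesgue_measure R]_(s in `]x, y]) `|(q s)%:E| <=
    \int[@lebesgue_measure R]_(s in `]x, y]) (cst M%:E) s)%E.
  apply: ae_ge0_le_integral => //.
  by apply/measurable_EFinP; apply: measurableT_comp => //; apply/measurable_EFinP; exact: measurable_int iq.
rewrite integral_cst//= lebesgue_measure_itv/= lte_fin xy -EFinB -EFinM in h0.
rewrite -lee_fin (distrC x) (gtr0_norm (_ : 0 < y - x)) ?subr_gt0//.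
apply: le_trans h0; rewrite /Rintegral fineK//.
exact: (integrable_fin_num mI (integrable_norm iq)).
Qed.

(** * Bounds on the data and norms of the solution *)

Lemma C0norm_ub (R : realType) (A : set (R * R)) (f : R * R -> R) (B : R) :
  (forall z, A z -> `|f z| <= B) -> forall z, A z -> `|f z| <= C0norm A f.
Proof.
move=> fB z Az; apply: sup_upper_bound; last by exists z.
split; first by exists `|f z|; exists z.
by exists B => _ [w Aw <-]; exact: fB.
Qed.

Lemma C0norm_le (R : realType) (A : set (R * R)) (f : R * R -> R) (M : R) :
  A !=set0 -> (forall z, A z -> `|f z| <= M) -> C0norm A f <= M.
Proof.
move=> [z Az] fM; apply: ge_sup; first by exists `|f z|; exists z.
by move=> _ [w Aw <-]; exact: fM.
Qed.

Lemma box_bounded (R : realType) (a b : R) (f : R * R -> R) : continuous f ->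
  exists B, forall z, (`[- a, a] `*` `[- b, b])%classic z -> `|f z| <= B.
Proof.
move=> cf.
have cK : compact (`[- a, a] `*` `[- b, b] : set (R * R)).
  by apply: compact_setX; exact: segment_compact.
have /compact_bounded[N [_ hN]] := continuous_compact (continuous_subspaceT cf) cK.
exists (N + 1) => z Kz; apply: (hN (N + 1)); first by rewrite ltrDl.
by exists z.
Qed.

Lemma mem_box (R : realType) (a b : R) (u v : R) : `|u| <= a -> `|v| <= b ->
  (`[- a, a] `*` `[- b, b])%classic (u, v).
Proof. by rewrite !ler_norml => ua vb; split; rewrite /= in_itv. Qed.

Lemma box_C0norm (R : realType) (a b : R) (f : R * R -> R) : continuous f ->
  forall u v : R, `|u| <= a -> `|v| <= b -> `|f (u, v)| <= C0norm (`[- a, a] `*` `[- b, b]) f.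
Proof.
move=> cf u v ua vb; have [B fB] := box_bounded a b cf.
by apply: C0norm_ub fB _ _; exact: mem_box.
Qed.

Lemma box_lip (R : realType) (a b M : R) (f : R * R -> R) : Csmooth f ->
  C0norm (`[- a, a] `*` `[- b, b]) (d1 f) <= M ->
  C0norm (`[- a, a] `*` `[- b, b]) (d2 f) <= M ->
  forall u v u' v' : R, `|u| <= a -> `|v| <= b -> `|u'| <= a -> `|v'| <= b ->
  `|f (u, v) - f (u', v')| <= M * (`|u - u'| + `|v - v'|).
Proof.
move=> sf M1 M2 u v u' v' ua vb ua' vb'.
have b1 := box_C0norm (a := a) (b := b) (Csmooth_continuous (Csmooth_d1 sf)).
have b2 := box_C0norm (a := a) (b := b) (Csmooth_continuous (Csmooth_d2 sf)).
have dp := Csmooth_partials sf.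
have h1 : `|f (u, v) - f (u', v)| <= M * `|u - u'|.
  apply: (@mvt_lip _ (fun s => f (s, v)) (fun s => d1 f (s, v)) (- a) a M).
  - by move=> s _ _; apply: is_derive_partial1; have [] := dp (s, v) I.
  - apply: derivable_within_continuous => s _.
    by have [] := is_derive_partial1 (proj1 (dp (s, v) I)).
  - move=> s s1 s2; apply: le_trans M1; apply: b1 => //.
    by rewrite ler_norml !ltW.
  - by move: ua; rewrite ler_norml => /andP[].
  - by move: ua; rewrite ler_norml => /andP[].
  - by move: ua'; rewrite ler_norml => /andP[].
  - by move: ua'; rewrite ler_norml => /andP[].
have h2 : `|f (u', v) - f (u', v')| <= M * `|v - v'|.
  apply: (@mvt_lip _ (fun s => f (u', s)) (fun s => d2 f (u', s)) (- b) b M).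
  - by move=> s _ _; apply: is_derive_partial2; have [] := dp (u', s) I.
  - apply: derivable_within_continuous => s _.
    by have [] := is_derive_partial2 (proj2 (dp (u', s) I)).
  - move=> s s1 s2; apply: le_trans M2; apply: b2 => //.
    by rewrite ler_norml !ltW.
  - by move: vb; rewrite ler_norml => /andP[].
  - by move: vb; rewrite ler_norml => /andP[].
  - by move: vb'; rewrite ler_norml => /andP[].
  - by move: vb'; rewrite ler_norml => /andP[].
rewrite mulrDr; apply: le_trans (ler_distD (f (u', v)) _ _) _.
exact: lerD h1 h2.
Qed.

Lemma Loo2_sub (R : realType) (D E : set (R * R)) (f : R * R -> R) :
  D `<=` E -> (Loo2 E f < +oo)%E -> (Loo2 D f < +oo)%E.
Proof.
move=> DE fE; have L0 : (0 <= Loo2 E f)%E by exact: Lnorm_ge0.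
pose M := fine (Loo2 E f); have ME : Loo2 E f = M%:E by rewrite /M fineK// ge0_fin_numE.
have M0 : 0 <= M by rewrite /M fine_ge0.
have := @Loo2P R E f M M0; rewrite ME => /(_ (lexx _)) h.
apply: (@le_lt_trans _ _ M%:E); last exact: ltry.
rewrite /Loo2 unlock; case: ifP => _; last by rewrite lee_fin.
apply/ess_supP; apply: (@filterS _ _ (ae_filter_ringOfSetsType (@leb2 R)) _ _ _ h) => z hz /=.
by rewrite lee_fin patchE; case: ifPn => [/set_mem/DE/hz//|_]; rewrite normr0.
Qed.

Section strip.
Variables (R : realType) (Cbar C1 : R).
Hypotheses (C10 : 0 < C1) (C1b : C1 <= Cbar).
Let A : set (R * R) := `[- Cbar, Cbar] `*` `[0, +oo[.
Let Q : set (R * R) := `]- C1, C1[ `*` `]0, +oo[.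

Let QA : Q `<=` A.
Proof.
move=> [v t] [] /=; rewrite !in_itv/= !andbT => /andP[h1 h2] h3.
split; rewrite /= in_itv/= ?andbT; last exact: ltW.
by rewrite (le_trans _ (ltW h1)) ?lerN2 ?(le_trans (ltW h2)).
Qed.

Let oQ : open Q.
Proof.
rewrite (_ : Q = (fst @^-1` `]- C1, C1[%classic) `&` (snd @^-1` `]0, +oo[%classic)).
  apply: openI; apply: open_comp; try exact: interval_open.
    by move=> z _; exact: cvg_fst.
  by move=> z _; exact: cvg_snd.
by [].
Qed.

Lemma strip_interior : Q `<=` A°.
Proof. by rewrite -open_subsetE //; exact: QA. Qed.

Lemma strip_approx (g : R * R -> R) (v t e : R) : {within A, continuous g} ->
  `|v| <= C1 -> 0 <= t -> 0 < e ->
  exists2 d : R, 0 < d & forall v' t' : R, A (v', t') -> `|v - v'| < d -> `|t - t'| < d ->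
    `|g (v, t) - g (v', t')| <= e.
Proof.
move=> /subspace_continuousP cg vC t0 e0.
have Az : A (v, t).
  split; rewrite /= in_itv/= ?andbT//.
  by rewrite -ler_norml (le_trans vC).
have /cvgrPdist_le/(_ e e0) := cg _ Az.
rewrite near_withinE => /nbhs_ballP[d /= d0 hd]; exists d => // v' t' Az' hv ht.
exact: (hd (v', t')).
Qed.

(** A displacement into the open strip that shrinks distances in the first variable and
    preserves them in the second one. *)
Definition push_inside (k : R) (z : R * R) : R * R := (z.1 * (1 - k), z.2 + k).

Lemma push_inside_strip (k v t : R) : `|v| <= C1 -> 0 <= t -> 0 < k < 1 -> Q (push_inside k (v, t)).
Proof.
move=> vC t0 k01; split; rewrite /= in_itv/= ?andbT; last by lra.
rewrite -ltr_norml normrM (gtr0_norm (_ : 0 < 1 - k)); last by lra.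
apply: (@le_lt_trans _ _ (C1 * (1 - k))); first by rewrite ler_wpM2r//; lra.
by rewrite -subr_gt0 (_ : C1 - _ = C1 * k) ?mulr_gt0//; [lra|ring].
Qed.

Lemma push_inside_near (v t d : R) : `|v| <= C1 -> 0 < d -> exists2 m : R, 0 < m < 1 &
  forall k : R, 0 < k -> k < m ->
    `|v - (push_inside k (v, t)).1| < d /\ `|t - (push_inside k (v, t)).2| < d.
Proof.
move=> vC d0; exists (Num.min (1/2) (d / (C1 + 1))).
  have h : 0 < d / (C1 + 1) by rewrite divr_gt0//; move: C10; lra.
  rewrite lt_min gt_min h andbT; apply/andP; split; first by lra.
  by apply/orP; left; lra.
move=> k k0; rewrite lt_min => /andP[_]; rewrite ltr_pdivlMr; last by move: C10; lra.
move=> kd; rewrite /push_inside /=.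
have -> : v - v * (1 - k) = v * k by ring.
have -> : t - (t + k) = - k by ring.
rewrite normrN normrM (gtr0_norm k0).
have : `|v| * k <= C1 * k by rewrite ler_wpM2r// ltW.
have : 0 < C1 * k by rewrite mulr_gt0.
have -> : `|v| * k = k * `|v| by ring.
move: kd; rewrite (_ : k * (C1 + 1) = C1 * k + k); last by ring.
by lra.
Qed.

(** If the bound failed at a point of the closed strip, continuity would make it fail on a
    nonempty open part of the open strip, which is not null. *)
Lemma strip_bound (g f : R * R -> R) (M : R) : {within A, continuous g} ->
  (forall z, Q z -> g z = f z) -> 0 <= M -> (Loo2 Q f <= M%:E)%E ->
  forall v t : R, `|v| <= C1 -> 0 <= t -> `|g (v, t)| <= M.
Proof.
move=> cg gf M0 /(Loo2P M0) fM v t vC t0.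
apply: (@le_of_small _ _ _ 1 1 ltr01) => e e0 _; rewrite mul1r.
have [d d0 hd] := strip_approx cg vC t0 e0.
have [m /andP[m0 m1] hm] := push_inside_near t vC d0.
pose k := m / 2; have k0 : 0 < k by rewrite divr_gt0.
have km : k < m by rewrite /k; lra.
have [n1 n2] := hm k k0 km.
pose V : set (R * R) := Q `&` ((fun z => v - z.1) @^-1` `]- d, d[%classic
  `&` (fun z => t - z.2) @^-1` `]- d, d[%classic).
have oV : open V.
  apply: openI; first exact: oQ.
  apply: openI; apply: open_comp; try exact: interval_open.
    by move=> z _; apply: cvgB; [exact: cvg_cst|exact: cvg_fst].
  by move=> z _; apply: cvgB; [exact: cvg_cst|exact: cvg_snd].
have Vp : V (push_inside k (v, t)).
  split; first by apply: push_inside_strip => //; lra.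
  by rewrite /= !in_itv/= -!ltr_norml.
have [[v' t'] [Qw [/= w1 w2]] hw] := open_not_null2 oV Vp fM.
rewrite in_itv/= -ltr_norml in w1; rewrite in_itv/= -ltr_norml in w2.
have h1 := hw Qw; rewrite -gf// in h1.
have h2 := hd _ _ (QA Qw) w1 w2.
have := ler_normD (g (v, t) - g (v', t')) (g (v', t')).
by rewrite subrK; lra.
Qed.

(** The mean value theorem gives the bound inside, where [h] has partial derivatives; the
    boundary is reached by displacing both points inward. *)
Lemma strip_lip (h : R * R -> R) (D1 D2 : R) : 0 <= D1 -> 0 <= D2 ->
  C1_upto A h -> (Loo2 Q (d1 h) <= D1%:E)%E -> (Loo2 Q (d2 h) <= D2%:E)%E ->
  forall v t v' t' : R, `|v| <= C1 -> 0 <= t -> `|v'| <= C1 -> 0 <= t' ->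
    `|h (v, t) - h (v', t')| <= D1 * `|v - v'| + D2 * `|t - t'|.
Proof.
move=> D10 D20 [ch ph [g1 [g2 [cg1 cg2 g12]]]] hD1 hD2.
have gE z : Q z -> g1 z = d1 h z /\ g2 z = d2 h z by move=> /strip_interior/g12.
have b1 := strip_bound cg1 (fun z Qz => proj1 (gE z Qz)) D10 hD1.
have b2 := strip_bound cg2 (fun z Qz => proj2 (gE z Qz)) D20 hD2.
have pQ z : Q z -> derivable h z (1, 0) /\ derivable h z (0, 1).
  by move=> /strip_interior; exact: ph.
have inQ (v t : R) : `|v| < C1 -> 0 < t -> Q (v, t).
  by rewrite ltr_norml => vC t0; split; rewrite /= in_itv/= ?andbT.
have bd1 (v t : R) : `|v| < C1 -> 0 < t -> `|d1 h (v, t)| <= D1.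
  by move=> vC t0; have [<- _] := gE _ (inQ v t vC t0); apply: b1; exact: ltW.
have bd2 (v t : R) : `|v| < C1 -> 0 < t -> `|d2 h (v, t)| <= D2.
  by move=> vC t0; have [_ <-] := gE _ (inQ v t vC t0); apply: b2; exact: ltW.
have HQ (v t v' t' : R) : `|v| < C1 -> 0 < t -> `|v'| < C1 -> 0 < t' ->
    `|h (v, t) - h (v', t')| <= D1 * `|v - v'| + D2 * `|t - t'|.
  move=> vC t0 vC' t0'.
  have h1 : `|h (v, t) - h (v', t)| <= D1 * `|v - v'|.
    pose m : R := Num.max `|v| `|v'|.
    have mC : m < C1 by rewrite gt_max vC vC'.
    have vm : `|v| <= m by rewrite le_max lexx.
    have vm' : `|v'| <= m by rewrite le_max lexx orbT.
    have /andP[a1 a2] : - m <= v <= m by rewrite -ler_norml.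
    have /andP[a3 a4] : - m <= v' <= m by rewrite -ler_norml.
    have inm (s : R) : - m <= s -> s <= m -> `|s| < C1.
      by move=> s1 s2; apply: le_lt_trans mC; rewrite ler_norml s1.
    refine (@mvt_lip R (fun s => h (s, t)) (fun s => d1 h (s, t)) (- m) m D1 _ _ _ v v' a1 a2 a3 a4).
    - move=> s s1 s2; apply: is_derive_partial1.
      by have [] := pQ _ (inQ s t (inm s (ltW s1) (ltW s2)) t0).
    - apply: derivable_within_continuous => s; rewrite in_itv/= => /andP[s1 s2].
      by have [] := is_derive_partial1 (proj1 (pQ _ (inQ s t (inm s s1 s2) t0))).
    - by move=> s s1 s2; apply: bd1 => //; apply: inm; exact: ltW.
  have h2 : `|h (v', t) - h (v', t')| <= D2 * `|t - t'|.
    pose m1 : R := Num.min t t'; pose m2 : R := Num.max t t'.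
    have m10 : 0 < m1 by rewrite lt_min t0.
    have a1 : m1 <= t by rewrite ge_min lexx.
    have a2 : t <= m2 by rewrite le_max lexx.
    have a3 : m1 <= t' by rewrite ge_min lexx orbT.
    have a4 : t' <= m2 by rewrite le_max lexx orbT.
    refine (@mvt_lip R (fun s => h (v', s)) (fun s => d2 h (v', s)) m1 m2 D2 _ _ _ t t' a1 a2 a3 a4).
    - move=> s s1 s2; apply: is_derive_partial2.
      by have [] := pQ _ (inQ v' s vC' (lt_trans m10 s1)).
    - apply: derivable_within_continuous => s; rewrite in_itv/= => /andP[s1 s2].
      by have [] := is_derive_partial2 (proj2 (pQ _ (inQ v' s vC' (lt_le_trans m10 s1)))).
    - by move=> s s1 s2; apply: bd2 => //; exact: lt_trans s1.
  apply: le_trans (ler_distD (h (v', t)) _ _) _.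
  exact: lerD h1 h2.
move=> v t v' t' vC t0 vC' t0'.
apply: (@le_of_small _ _ _ 2 1 ltr01) => e e0 _.
have [d d0 hd] := strip_approx ch vC t0 e0.
have [d' d0' hd'] := strip_approx ch vC' t0' e0.
have [m /andP[m0 m1] hm] := push_inside_near t vC d0.
have [m' /andP[m0' m1'] hm'] := push_inside_near t' vC' d0'.
pose k := Num.min m m' / 2.
have mm0 : 0 < Num.min m m' by rewrite lt_min m0.
have k0 : 0 < k by rewrite divr_gt0.
have k1 : k < m by apply: (@lt_le_trans _ _ (Num.min m m')); rewrite ?ge_min ?lexx// /k; lra.
have k2 : k < m'.
  by apply: (@lt_le_trans _ _ (Num.min m m')); rewrite ?ge_min ?lexx ?orbT// /k; lra.
have [n1 n2] := hm k k0 k1; have [n1' n2'] := hm' k k0 k2.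
have k01 : 0 < k < 1 by lra.
have Qp := push_inside_strip vC t0 k01; have Qp' := push_inside_strip vC' t0' k01.
have H1 := hd _ _ (QA Qp) n1 n2; have H2 := hd' _ _ (QA Qp') n1' n2'.
move: (Qp) (Qp') => [] /=; rewrite !in_itv/= !andbT -ltr_norml => p1 p2 [] /=.
rewrite !in_itv/= !andbT -ltr_norml => p1' p2'.
have H3 := HQ _ _ _ _ p1 p2 p1' p2'.
have E1 : `|t + k - (t' + k)| = `|t - t'| by congr `|_|; ring.
have E2 : `|v * (1 - k) - v' * (1 - k)| <= `|v - v'|.
  rewrite -mulrBl normrM -[leRHS]mulr1 ler_wpM2l// ler_norml; lra.
have E3 : D1 * `|v * (1 - k) - v' * (1 - k)| <= D1 * `|v - v'| by rewrite ler_wpM2l.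
rewrite E1 in H3; rewrite /push_inside /= in H1 H2.
by move: H1 H2 H3; rewrite (distrC (h (v', t'))) !ler_norml; lra.
Qed.
End strip.

(** Where [f] has no derivative, [derive1 f] is the default value 0. *)
Lemma derive1_bound (R : realType) (f : R -> R) (L x : R) : 0 <= L -> 0 < x < 1 ->
  (forall x y : R, 0 <= x <= 1 -> 0 <= y <= 1 -> `|f x - f y| <= L * `|x - y|) ->
  `|derive1 f x| <= L.
Proof.
move=> L0 x01 fL.
have [df|ndf] := pselect (derivable f x 1); last first.
  by rewrite derive1E /derive (dvgP ndf) normr0.
have hx := @quotient_seq R f x 1 (derive1 f x)
  ltac:(by apply: DeriveDef => //; rewrite derive1E).
have := cvg_norm hx; rewrite mul1r => hn.
pose m := Num.min x (1 - x).
have m0 : 0 < m by rewrite lt_min; lra.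
apply: (cvgr_to_le (hn _)).
have := near_infty_natSinv_lt (PosNum m0); apply: filterS => n /= nm.
have n0 : (0 : R) < n.+1%:R by rewrite ltr0n.
have ni : (0 : R) < n.+1%:R^-1 by rewrite invr_gt0.
move: nm; rewrite lt_min => /andP[nx nx1].
rewrite /= mul1r normrM (gtr0_norm n0) mulrC -ler_pdivlMr//.
move: nx nx1 ni; move: (n.+1%:R^-1) => q nx nx1 q0.
rewrite (le_trans (fL _ _ _ _))//; [lra|lra|].
have -> : x + q - x = q by ring.
by rewrite (gtr0_norm q0).
Qed.

Lemma Lip01_norm_le (R : realType) (f : R -> R) (B L : R) : 0 <= B -> 0 <= L ->
  (forall x : R, 0 <= x <= 1 -> `|f x| <= B) ->
  (forall x y : R, 0 <= x <= 1 -> 0 <= y <= 1 -> `|f x - f y| <= L * `|x - y|) ->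
  (Lip01_norm f <= (B + L)%:E)%E.
Proof.
move=> B0 L0 fB fL; rewrite /Lip01_norm EFinD; apply: leeD.
  apply/(Loo1P _ _ B0); apply: aeW => x /=; rewrite in_itv/= lee_fin => x01.
  by apply: fB; lra.
apply/(Loo1P _ _ L0); apply: aeW => x /=; rewrite in_itv/= lee_fin => x01.
exact: derive1_bound.
Qed.

Lemma LooLip_norm2_le (R : realType) (U V : R * R -> R) (B1 L1 B2 L2 : R) :
  0 <= B1 -> 0 <= L1 -> 0 <= B2 -> 0 <= L2 ->
  (forall t x : R, 0 < t -> 0 <= x <= 1 -> `|U (t, x)| <= B1 /\ `|V (t, x)| <= B2) ->
  (forall t x y : R, 0 < t -> 0 <= x <= 1 -> 0 <= y <= 1 ->
     `|U (t, x) - U (t, y)| <= L1 * `|x - y| /\ `|V (t, x) - V (t, y)| <= L2 * `|x - y|) ->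
  (LooLip_norm2 U V <= (B1 + L1 + (B2 + L2))%:E)%E.
Proof.
move=> B10 L10 B20 L20 hB hL.
apply/Loo1P; first by rewrite !addr_ge0.
apply: aeW => t /=; rewrite in_itv/= andbT => t0.
rewrite gee0_abs; last by rewrite !adde_ge0//; exact: Lnorm_ge0.
rewrite /Lip01_norm2 EFinD; apply: leeD; apply: Lip01_norm_le => //.
- by move=> x x01; have [] := hB t x t0 x01.
- by move=> x y x01 y01; have [] := hL t x y t0 x01 y01.
- by move=> x x01; have [] := hB t x t0 x01.
- by move=> x y x01 y01; have [] := hL t x y t0 x01 y01.
Qed.

Lemma Lip01_norm2_le (R : realType) (u v : R -> R) (d : R) : 0 <= d ->
  Lip01 u -> Lip01 v -> (Lip01_norm2 u v <= d%:E)%E ->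
  [/\ forall x : R, 0 <= x <= 1 -> `|u x| <= d, forall x : R, 0 <= x <= 1 -> `|v x| <= d,
    forall x y : R, 0 <= x <= 1 -> 0 <= y <= 1 -> `|u x - u y| <= d * `|x - y| &
    forall x y : R, 0 <= x <= 1 -> 0 <= y <= 1 -> `|v x - v y| <= d * `|x - y|].
Proof.
move=> d0 Lu Lv; rewrite /Lip01_norm2 /Lip01_norm => h.
have p1 : (0 <= sup01 u)%E by exact: Lnorm_ge0.
have p2 : (0 <= dsup01 u)%E by exact: Lnorm_ge0.
have p3 : (0 <= sup01 v)%E by exact: Lnorm_ge0.
have p4 : (0 <= dsup01 v)%E by exact: Lnorm_ge0.
have q1 := le_trans (leeDl _ (adde_ge0 p3 p4)) h.
have q2 := le_trans (leeDr _ (adde_ge0 p1 p2)) h.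
split.
- exact: (sup01_pointwise d0 Lu (le_trans (leeDl _ p2) q1)).
- exact: (sup01_pointwise d0 Lv (le_trans (leeDl _ p4) q2)).
- exact: (dsup01_lip d0 Lu (le_trans (leeDr _ p1) q1)).
- exact: (dsup01_lip d0 Lv (le_trans (leeDr _ p3) q2)).
Qed.

(** * Solutions of the problem as fixed points *)

Lemma frozen_speeds_lip (R : realType) (lam mu h : R * R -> R) (u0 v0 vr : R -> R)
    (c T B C1 C2 C3 C3' D1 D2 G M1 M2 : R) p :
  transport_data lam mu h u0 v0 vr c T B C1 C2 C3 C3' D1 D2 G M1 M2 ->
  in_box T B C1 C3 C3' p ->
  Lip2 (2 * M2 * C3) (cyl T%:E) (fun z => lam (p.1 z, p.2 z)) /\
  Lip2 (2 * M2 * C3) (cyl T%:E) (fun z => mu (p.1 z, p.2 z)).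
Proof.
move=> D bp; have [Llam Lmu _ _] := frozen_speeds D bp; split=> // z1 z2 h1 h2.
have := Lmu _ _ ((flip_cyl _ z1).2 h1) ((flip_cyl _ z2).2 h2).
rewrite /flip /= !subKr -!surjective_pairing -opprD normrN.
rewrite [1 - z1.2 - _](_ : _ = - (z1.2 - z2.2)); last by ring.
by rewrite normrN.
Qed.

(** Continued after [T] by its values at [T], which are zero, the fixed point solves the
    problem on every longer interval, since [vr] and [h (0, t)] vanish there. *)
Lemma fixpoint_is_solution (R : realType) (lam mu h : R * R -> R) (u0 v0 vr : R -> R)
    (K gamma c T B C1 C2 C3 C3' D1 D2 G M1 M2 C : R) p (b : \bar R) :
  transport_data lam mu h u0 v0 vr c T B C1 C2 C3 C3' D1 D2 G M1 M2 ->
  in_box T B C1 C3 C3' p -> frozen_sol lam mu h u0 v0 vr C T p p ->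
  boundary_ode K gamma (v0 1) vr ->
  (forall t : R, T <= t -> vr t = 0 /\ h (0, t) = 0) ->
  (forall x : R, 0 <= x <= 1 -> p.1 (T, x) = 0 /\ p.2 (T, x) = 0) ->
  0 < T -> (T%:E <= b)%E ->
  is_solution lam mu K gamma h b u0 v0
    (fun z => p.1 (clamp2 T z)) (fun z => p.2 (clamp2 T z)).
Proof.
move=> D bp [s1 s2 s3 s4 s5] ode late pT T0 Tb; have T0' := ltW T0.
have [C10 C30 C3'0 C2C3' C2C3] := box_consts D.
have c0 := td_c D; have L0 : 0 <= 2 * M2 * C3 by rewrite !mulr_ge0// (td_M2 D).
have [Llam Lmu] := frozen_speeds_lip D bp.
have [p1 p2 p3 p4] := bp.
have b0 : (0 < b)%E by apply: lt_le_trans Tb; rewrite lte_fin.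
have cT s : T <= s -> clamp T s = T by move=> Ts; rewrite /clamp min_r// max_r.
have in1 : 0 <= (1 : R) <= 1 by rewrite ler01 lexx.
have in0 : 0 <= (0 : R) <= 1 by rewrite ler01 lexx.
have clt (t x : R) : 0 <= t -> t <= T -> 0 <= x <= 1 -> clamp2 T (t, x) = (t, x).
  by move=> t0 tT x01; apply: clamp2E; split; rewrite //= lee_fin.
have clT (t x : R) : T <= t -> 0 <= x <= 1 -> clamp2 T (t, x) = (T, x).
  by move=> tT x01; rewrite /clamp2 /= cT// clampE.
split.
- exists C3; split=> z1 z2 _ _; first exact: (Lip2_clamp C30 T0' p3).
  exact: (Lip2_clamp C30 T0' (Lip2W (td_C3'3 D) p4)).
- split.
    apply: (transported_weak b0 T0' c0 C30 L0 p3 Llam).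
      by move=> _ x x01; have [] := pT x x01.
    by left; split; [move=> z _; exact: td_lam D _|exact: s1].
  apply: (transported_weak b0 T0' c0 C3'0 L0 p4 Lmu).
    by move=> _ x x01; have [] := pT x x01.
  by right; split; [move=> z _; exact: td_mu D _|exact: s2].
- move=> t t0 tb; have [tT|Tt] := leP t T; first by rewrite clt// s3// t0.
  have [e1 e2] := pT 0 in0; have [_ e3] := late t (ltW Tt).
  by rewrite clT ?(ltW Tt)// e1 e2 e3.
- exists vr; split => // t t0 tb; have [tT|Tt] := leP t T; first by rewrite clt// s4// t0.
  have [e1 e2] := pT 1 in1; have [e3 _] := late t (ltW Tt).
  by rewrite clT ?(ltW Tt)// e2 e3.
- by move=> x x01; rewrite clt//; exact: s5.
Qed.

(** The boundary value at [x = 1] is the explicit one because the feedback equation has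
    a unique solution. *)
Lemma solution_is_fixpoint (R : realType) (lam mu h : R * R -> R) (u0 v0 : R -> R)
    (K gamma c T B C1 C2 C3 C3' D1 D2 G M1 M2 : R) p :
  0 < K -> 0 < gamma < 1 -> 0 < T ->
  transport_data lam mu h u0 v0 (friction K gamma (v0 1))
    c T B C1 C2 C3 C3' D1 D2 G M1 M2 ->
  in_box T B C1 C3 C3' p ->
  is_solution lam mu K gamma h T%:E u0 v0 p.1 p.2 ->
  exists C, frozen_sol lam mu h u0 v0 (friction K gamma (v0 1)) C T p p.
Proof.
move=> K0 g01 T0 D bp [_ [tr1 tr2] bu [vr [ode bv]] ini].
have [C10 C30 C3'0 C2C3' C2C3] := box_consts D.
have c0 := td_c D; have L0 : 0 <= 2 * M2 * C3 by rewrite !mulr_ge0// (td_M2 D).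
have [Llam Lmu] := frozen_speeds_lip D bp.
have [p1 p2 p3 p4] := bp.
have [H1 _] := weak_transported T0 c0 C30 L0 p3 Llam tr1.
have [K1 HK1] := H1 (fun z _ => td_lam D (p.1 z, p.2 z)).
have [_ H2] := weak_transported T0 c0 C3'0 L0 p4 Lmu tr2.
have [K2 HK2] := H2 (fun z _ => td_mu D (p.1 z, p.2 z)).
exists (Num.max K1 K2); split.
- by apply: transportedW HK1; rewrite le_max lexx.
- by apply: transportedW HK2; rewrite le_max lexx orbT.
- by move=> t /andP[t0 tT]; apply: bu; rewrite ?lee_fin.
- move=> t /andP[t0 tT]; rewrite bv ?lee_fin//.
  exact: (boundary_ode_unique K0 g01 ode).
- by move=> x x01; exact: ini.
Qed.

(** Test functions of the smaller set are test functions of the larger one. *)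
Lemma transport_distr_restrict (R : realType) (D E : set (R * R)) (a u : R * R -> R) :
  measurable (E : set (measurableTypeR R * measurableTypeR R)) ->
  measurable (D : set (measurableTypeR R * measurableTypeR R)) ->
  D `<=` E -> transport_distr E a u -> transport_distr D a u.
Proof.
move=> mE mD DE [p [[mp pb ibp] tr]].
have tDE phi : test_fun D phi -> test_fun E phi.
  by move=> [h1 h2 h3]; split => //; exact: subset_trans DE.
exists p; split; first split.
- exact: measurable_funS mp.
- exact: Loo2_sub pb.
- move=> phi tphi; have := ibp phi (tDE _ tphi).
  rewrite (@Rintegral_supp R E D (fun z => u z * d2 phi z) DE); last first.
    by move=> z nz; have [_ _ ->] := test_fun_out tphi nz; rewrite mulr0.
  rewrite (@Rintegral_supp R E D (fun z => p z * phi z) DE)//.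
  by move=> z nz; have [-> _ _] := test_fun_out tphi nz; rewrite mulr0.
- move=> phi tphi; have := tr phi (tDE _ tphi).
  rewrite (@Rintegral_supp R E D (fun z => u z * d1 phi z) DE); last first.
    by move=> z nz; have [_ -> _] := test_fun_out tphi nz; rewrite mulr0.
  rewrite (@Rintegral_supp R E D (fun z => a z * p z * phi z) DE)//.
  by move=> z nz; have [-> _ _] := test_fun_out tphi nz; rewrite mulr0.
Qed.

Lemma is_solution_restrict (R : realType) (lam mu h : R * R -> R) (u0 v0 : R -> R)
    (K gamma T : R) (u v : R * R -> R) :
  is_solution lam mu K gamma h +oo%E u0 v0 u v ->
  is_solution lam mu K gamma h T%:E u0 v0 u v.
Proof.
move=> [[M [Lu Lv]] [tr1 tr2] bu [vr [ode bv]] ini].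
have cyl_sub : cyl T%:E `<=` cyl (+oo%E : \bar R) by move=> z [h1 _ h3]; split; rewrite ?leey.
have osub : ocyl T%:E `<=` ocyl (+oo%E : \bar R) by move=> z [h1 _ h3]; split; rewrite ?ltry.
have mT : measurable (ocyl T%:E : set (measurableTypeR R * measurableTypeR R)).
  by rewrite ocyl_rect; apply: measurableX; exact: measurable_itv.
have moo : measurable (ocyl +oo%E : set (measurableTypeR R * measurableTypeR R)).
  rewrite (_ : ocyl +oo%E = `]0, +oo[ `*` `]0, 1[).
    by apply: measurableX; exact: measurable_itv.
  apply/seteqP; split => -[t x] /=; rewrite /ocyl /= !in_itv/= andbT.
    by move=> [-> _ ->].
  by move=> [-> ->]; rewrite ltry.
split.
- by exists M; split=> z1 z2 /cyl_sub h1 /cyl_sub h2; [exact: Lu|exact: Lv].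
- by split; apply: transport_distr_restrict moo mT osub _.
- by move=> t t0 _; apply: bu; rewrite ?leey.
- by exists vr; split => // t t0 _; apply: bv; rewrite ?leey.
- exact: ini.
Qed.

Lemma class_D_box (R : realType) (T C1 C1' C3 C3' : R) (u v : R * R -> R) :
  0 <= T -> 0 <= C3 -> 0 <= C3' -> class_D T C1 C1' C3 C3' u v <->
  in_box T C1' C1 C3 C3' (u, v).
Proof.
move=> T0 C30 C3'0.
have bd (w : R * R -> R) M : 0 <= M -> Lip2 M (cyl T%:E) w ->
    forall z, cyl T%:E z -> `|w z| <= `|w (0, 0)| + M * (T + 1).
  by move=> M0 wL z hz; rewrite -[z in `|w z|](clamp2E hz); exact: cyl_bounded.
have cne : cyl (R := R) T%:E !=set0.
  by exists (0, 0); split; rewrite //= ?lee_fin ?lexx ?ler01.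
split=> [[h1 h2 h3 h4]|[/= h1 h2 h3 h4]]; split => //.
- by move=> z hz; apply: le_trans h1; exact: C0norm_ub (bd _ _ C30 h3) _ hz.
- by move=> z hz; apply: le_trans h2; exact: C0norm_ub (bd _ _ C3'0 h4) _ hz.
- exact: C0norm_le.
- exact: C0norm_le.
Qed.

(** * Small data *)

(** A transported function obeys the bounds of the solution built from its own
    initial and boundary values, since the two coincide. *)
Lemma transport_estimate (R : realType) (a w : R * R -> R) (c C L M M' T G C2 B : R) :
  0 < c -> 0 <= L -> 0 <= T -> 0 <= G -> 0 <= C2 -> 0 <= M' ->
  Lip2 L (cyl T%:E) a -> (forall z, cyl T%:E z -> c <= a z <= M) ->
  transported C T a w -> Lip2 M' (cyl T%:E) w ->
  (forall x y : R, 0 <= x <= 1 -> 0 <= y <= 1 -> `|w (0, x) - w (0, y)| <= C2 * `|x - y|) ->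
  (forall s t : R, 0 <= s <= T -> 0 <= t <= T -> `|w (s, 0) - w (t, 0)| <= G * `|s - t|) ->
  (forall x : R, 0 <= x <= 1 -> `|w (0, x)| <= B) ->
  (forall t : R, 0 <= t <= T -> `|w (t, 0)| <= B) ->
  (forall z, cyl T%:E z -> `|w z| <= B) /\
  Lip2 (Num.max (G / c) C2 * Num.max 1 M * expR (L * T)) (cyl T%:E) w.
Proof.
move=> c0 L0 T0 G0 C20 M'0 aL aM tr wL iniL bdL iniB bdB.
have [w' [tr' L' B' ini' bd']] := @linear_transport R a (fun x => w (0, x))
  (fun t => w (t, 0)) c L M T G C2 B c0 L0 T0 G0 C20 aL aM iniL bdL iniB bdB erefl.
have ac z : cyl T%:E z -> c <= a z by move=> /aM/andP[].
pose K := Num.max C (Num.max (G / c) C2 * (2 * (expR (L * T) * L * (1 + M)))).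
have trK : transported K T a w by apply: transportedW tr; rewrite le_max lexx.
have trK' : transported K T a w' by apply: transportedW tr'; rewrite le_max lexx orbT.
have E z : cyl T%:E z -> w z = w' z.
  move=> hz; apply/eqP; rewrite -subr_eq0 -normr_le0 -[leRHS](mul0r (expR (1 * z.1))) distrC.
  apply: (@transport_compare R a a w' w c K T M' 0 0 1) => //.
  - by exists (Num.max (G / c) C2 * Num.max 1 M * expR (L * T)).
  - by move=> y hy; rewrite subrr normr0 mul0r.
  - by move=> t t0; rewrite bd'// subrr normr0 mul0r.
  - by rewrite mulr0 mulr0.
split=> [z hz|z1 z2 h1 h2]; first by rewrite E.
by rewrite !E//; exact: L'.
Qed.

(** Along the given solution the speeds are as regular as in the whole class, while the
    estimates of the linear problem are homogeneous in the data. *)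
Lemma small_solution (R : realType) (lam mu h : R * R -> R) (u0 v0 vr : R -> R)
    (c T B C1 C2 C3 C3' D1 D2 G M1 M2 C d g : R) p :
  transport_data lam mu h u0 v0 vr c T B C1 C2 C3 C3' D1 D2 G M1 M2 ->
  in_box T B C1 C3 C3' p -> frozen_sol lam mu h u0 v0 vr C T p p ->
  0 <= d -> 0 <= g ->
  (forall w t w' t' : R, `|w| <= C1 -> 0 <= t -> `|w'| <= C1 -> 0 <= t' ->
     `|h (w, t) - h (w', t')| <= D1 * `|w - w'|) ->
  (forall t : R, 0 <= t -> h (0, t) = 0) ->
  (forall x : R, 0 <= x <= 1 -> `|u0 x| <= d) ->
  (forall x : R, 0 <= x <= 1 -> `|v0 x| <= d) ->
  (forall x y : R, 0 <= x <= 1 -> 0 <= y <= 1 -> `|u0 x - u0 y| <= d * `|x - y|) ->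
  (forall x y : R, 0 <= x <= 1 -> 0 <= y <= 1 -> `|v0 x - v0 y| <= d * `|x - y|) ->
  (forall t : R, 0 <= t <= T -> `|vr t| <= d) ->
  (forall s t : R, 0 <= s <= T -> 0 <= t <= T -> `|vr s - vr t| <= g * `|s - t|) ->
  let E := Num.max 1 M1 * expR (2 * M2 * C3 * T) in
  let LV := Num.max (g / c) d * E in
  [/\ forall z, cyl T%:E z -> `|p.1 z| <= Num.max d (D1 * d),
      forall z, cyl T%:E z -> `|p.2 z| <= d,
      Lip2 (Num.max (D1 * LV / c) d * E) (cyl T%:E) p.1 & Lip2 LV (cyl T%:E) p.2].
Proof.
move=> D bp [s1 s2 s3 s4 s5] d0 g0 hL h0 u0B v0B u0L v0L vrB vrL E LV.
have [C10 C30 C3'0 C2C3' C2C3] := box_consts D.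
have c0 := td_c D; have T0 := td_T D; have D10 := td_D1 D.
have L0 : 0 <= 2 * M2 * C3 by rewrite !mulr_ge0// (td_M2 D).
have [Llam Lmu Blam Bmu] := frozen_speeds D bp.
have [p1 p2 p3 p4] := bp.
have mirror (x : R) : 0 <= x <= 1 -> 0 <= 1 - x <= 1 by lra.
have bd0 t : 0 <= t <= T -> flip p.2 (t, 0) = vr t.
  by move=> ht; rewrite /flip /= subr0 s4.
have ini0 (x : R) : 0 <= x <= 1 -> flip p.2 (0, x) = v0 (1 - x).
  by move=> x01; rewrite /flip /=; have [_ ->] := s5 _ (mirror _ x01).
have [VB VL] := @transport_estimate R _ (flip p.2) c C _ M1 C3' T g d d c0 L0 T0 g0 d0
  C3'0 Lmu Bmu s2 (Lip2_flip p4)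
  ltac:(by move=> x y hx hy; rewrite !ini0// (le_trans (v0L _ _ (mirror _ hx) (mirror _ hy)))//
    (_ : 1 - x - (1 - y) = - (x - y)) ?normrN//; ring)
  ltac:(by move=> s t hs ht; rewrite !bd0//; exact: vrL)
  ltac:(by move=> x hx; rewrite ini0//; exact: v0B (mirror _ hx))
  ltac:(by move=> t ht; rewrite bd0//; exact: vrB).
have EE : Num.max (g / c) d * Num.max 1 M1 * expR (2 * M2 * C3 * T) = LV.
  by rewrite /LV /E mulrA.
rewrite EE in VL.
have pVB z : cyl T%:E z -> `|p.2 z| <= d.
  move=> hz; have := VB _ ((flip_cyl _ z).2 hz).
  by rewrite /flip /= subKr -surjective_pairing.
have pVL : Lip2 LV (cyl T%:E) p.2.
  move=> z1 z2 h1 h2.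
  have := VL _ _ ((flip_cyl _ z1).2 h1) ((flip_cyl _ z2).2 h2).
  rewrite /flip /= !subKr -!surjective_pairing.
  by rewrite (_ : 1 - z1.2 - (1 - z2.2) = - (z1.2 - z2.2)) ?normrN//; ring.
have E0 : 0 <= E by rewrite mulr_ge0 ?expR_ge0// le_max ler01.
have LV0 : 0 <= LV by rewrite mulr_ge0// le_max d0 orbT.
have cyl0 (t : R) : 0 <= t <= T -> cyl T%:E (t, 0).
  by move=> /andP[t0 tT]; split; rewrite //= ?lee_fin ?lexx ?ler01.
have UBd (t : R) : 0 <= t <= T -> `|p.1 (t, 0)| <= Num.max d (D1 * d).
  move=> ht; have /andP[t0 _] := ht; rewrite s3//.
  have C10' : `|(0 : R)| <= C1 by rewrite normr0.
  have := hL _ t 0 t (p2 _ (cyl0 _ ht)) t0 C10' t0; rewrite h0// !subr0 => h1.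
  rewrite (le_trans h1)// le_max; apply/orP; right.
  by rewrite ler_wpM2l//; exact: pVB (cyl0 _ ht).
have [UB UL] := @transport_estimate R _ p.1 c C _ M1 C3 T (D1 * LV) d
  (Num.max d (D1 * d)) c0 L0 T0 (mulr_ge0 D10 LV0) d0 C30 Llam Blam s1 p3
  ltac:(by move=> x y hx hy; have [-> _] := s5 _ hx; have [-> _] := s5 _ hy; exact: u0L)
  ltac:(by move=> s t hs ht; rewrite !s3// (le_trans (hL _ _ _ _ (p2 _ (cyl0 _ hs)) _
      (p2 _ (cyl0 _ ht)) _)) ?(andP hs).1 ?(andP ht).1// -mulrA ler_wpM2l//
      (le_trans (pVL _ _ (cyl0 _ hs) (cyl0 _ ht)))//= subrr normr0 addr0)
  ltac:(by move=> x hx; have [-> _] := s5 _ hx; rewrite (le_trans (u0B _ hx))// le_max lexx)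
  UBd.
split => //.
by move: UL; rewrite /E mulrA.
Qed.

(** Every term tends to 0 with [d], the slowest ones like [d ^ gamma]. *)
Lemma small_choice (R : realType) (K gamma c D1 E eps : R) :
  0 < K -> 0 < gamma -> 0 < c -> 0 <= D1 -> 1 <= E -> 0 < eps ->
  exists2 d : R, 0 < d &
    let LV := Num.max (K * d `^ gamma / c) d * E in
    Num.max d (D1 * d) + Num.max (D1 * LV / c) d * E + (d + LV) <= eps.
Proof.
move=> K0 g0 c0 D10 E1 e0; have E0 : 0 < E by lra.
pose F := 1 + D1 / c * E.
have Dc : 0 <= D1 / c by rewrite divr_ge0// ltW.
have F1 : 1 <= F by rewrite /F lerDl mulr_ge0// ltW.
pose A1 := 2 + D1 + E + E * F; pose A2 := K / c * E * F.
have EF : 0 < E * F by rewrite mulr_gt0//; lra.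
have A10 : 0 < A1 by rewrite /A1; lra.
have A20 : 0 < A2 by rewrite /A2 -mulrA mulr_gt0// divr_gt0.
pose d := Num.min (eps / (2 * A1)) ((eps / (2 * A2)) `^ gamma^-1).
have q1 : 0 < eps / (2 * A1) by rewrite divr_gt0// mulr_gt0.
have q2 : 0 < eps / (2 * A2) by rewrite divr_gt0// mulr_gt0.
have d0 : 0 < d by rewrite lt_min q1 powR_gt0.
exists d => // LV.
have d1 : d * A1 <= eps / 2.
  have : d <= eps / (2 * A1) by rewrite ge_min lexx.
  rewrite ler_pdivlMr; last by rewrite mulr_gt0.
  by lra.
have d2 : d `^ gamma * A2 <= eps / 2.
  have : d `^ gamma <= eps / (2 * A2).
    have rE : eps / (2 * A2) = (eps / (2 * A2)) `^ gamma^-1 `^ gamma.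
      by rewrite -powRrM mulVf ?gt_eqF// powRr1// ltW.
    rewrite [leRHS]rE.
    apply: ge0_ler_powR; rewrite ?nnegrE ?powR_ge0 ?(ltW d0) ?(ltW g0)//.
    by rewrite ge_min lexx orbT.
  rewrite ler_pdivlMr; last by rewrite mulr_gt0.
  by lra.
have maxD (x y : R) : 0 <= x -> 0 <= y -> Num.max x y <= x + y.
  by move=> x0 y0; rewrite ge_max lerDl y0 lerDr x0.
have P0 : 0 <= K * d `^ gamma / c by rewrite !mulr_ge0 ?powR_ge0 ?invr_ge0// ltW.
have hLV : LV <= (K * d `^ gamma / c + d) * E.
  by rewrite ler_wpM2r ?(ltW E0)// maxD// ltW.
have LV0 : 0 <= LV by rewrite mulr_ge0 ?(ltW E0)// le_max P0.
have h1 : Num.max d (D1 * d) <= d + D1 * d by rewrite maxD ?mulr_ge0 ?(ltW d0).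
have h2 : Num.max (D1 * LV / c) d * E <= (D1 / c * LV + d) * E.
  have dc : D1 * LV / c = D1 / c * LV by rewrite mulrAC.
  by rewrite dc ler_wpM2r ?(ltW E0)// maxD ?(ltW d0)// mulr_ge0.
have h3 : LV * F <= (K * d `^ gamma / c + d) * E * F by rewrite ler_wpM2r//; lra.
have e1 : (K * d `^ gamma / c + d) * E * F = d `^ gamma * A2 + d * (E * F) by rewrite /A2; ring.
have e2 : (D1 / c * LV + d) * E = LV * F - LV + d * E by rewrite /F; ring.
have e3 : d * A1 = 2 * d + D1 * d + d * E + d * (E * F) by rewrite /A1; ring.
move: d1 d2 h1 h2 h3; rewrite e1 e2 e3; lra.
Qed.

(** * Existence, uniqueness, extinction and stability *)

Theorem theorem2 (R : realType) (lam mu : R * R -> R) (c K gamma : R)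
  (Cbar Th C1 C2 : R) (h : R * R -> R) :
  Csmooth lam -> Csmooth mu ->
  0 < c -> (forall z, mu z <= - c /\ c <= lam z) ->
  0 < K -> 0 < gamma < 1 ->
  0 < Cbar -> 0 < Th ->
  C1_upto (`[- Cbar, Cbar] `*` `[0, +oo[) h ->
  W1oo (`]- Cbar, Cbar[ `*` `]0, +oo[) h ->
  (forall t, Th <= t -> h (0, t) = 0) ->
  0 < C1 <= Cbar -> 0 < C2 ->
  let T := c^-1 +
    Num.max Th (c^-1 + C1 `^ (1 - gamma) / ((1 - gamma) * K)) in
  let Q := `]- C1, C1[ `*` `]0, +oo[ in
  let C1' := Num.max C1 (fine (Loo2 Q h)) in
  let D1 := fine (Loo2 Q (d1 h)) in
  let D2 := fine (Loo2 Q (d2 h)) in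
  let rect := `[- C1', C1'] `*` `[- C1, C1] in
  let M1 := Num.max (C0norm rect lam) (C0norm rect mu) in
  let M2 := Num.max
    (Num.max (C0norm rect (d1 mu)) (C0norm rect (d2 mu)))
    (Num.max (C0norm rect (d1 lam)) (C0norm rect (d2 lam))) in
  let C3 := Num.max (1 / (2 * T * M2)) C2 in
  let C3' := Num.max (K * C1 `^ gamma / c) C2 * Num.max 1 M1 *
             expR (2 * T * M2 * C3) in
  let C3'' := Num.max (c^-1 * (D1 * C3' + D2)) C2 * Num.max 1 M1 *
              expR (2 * T * M2 * C3) in
  0 < M2 -> C3' <= C3 -> C3'' <= C3 ->
  (forall u0 v0 : R -> R, admissible h C1 C2 u0 v0 ->
    exists u v : R * R -> R,
      [/\ class_D T C1 C1' C3 C3' u v,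
          is_solution lam mu K gamma h T%:E u0 v0 u v,
          (forall u' v' : R * R -> R,
             class_D T C1 C1' C3 C3' u' v' ->
             is_solution lam mu K gamma h T%:E u0 v0 u' v' ->
             forall z, cyl T%:E z -> u' z = u z /\ v' z = v z) &
          exists U V : R * R -> R,
            [/\ (forall z, cyl T%:E z -> U z = u z /\ V z = v z),
                is_solution lam mu K gamma h +oo%E u0 v0 U V &
                vanishes_from T U V]]) /\
  ((forall w s t : R, - Cbar <= w <= Cbar -> 0 <= s -> 0 <= t ->
      h (w, s) = h (w, t)) ->
   forall eps : R, 0 < eps -> exists2 delta : R, 0 < delta &
     forall u0 v0 : R -> R, admissible h C1 C2 u0 v0 ->
       (Lip01_norm2 u0 v0 <= delta%:E)%E ->
       forall U V : R * R -> R,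
         class_D T C1 C1' C3 C3' U V ->
         is_solution lam mu K gamma h +oo%E u0 v0 U V ->
         vanishes_from T U V ->
         (LooLip_norm2 U V <= eps%:E)%E).
Proof.
move=> slam smu c0 cml K0 g01 Cb0 Th0 C1h Wh hTh C1b C20.
move=> T Q C1' D1 D2 rect M1 M2 C3 C3' C3'' M20 C3'3 C3''3.
have [C10 C1Cb] : 0 < C1 /\ C1 <= Cbar by move: C1b => /andP[].
have g0 : 0 < gamma by move: g01; lra.
have g1 : 0 < 1 - gamma by move: g01; lra.
(* the time at which the feedback vanishes *)
pose Tr := C1 `^ (1 - gamma) / ((1 - gamma) * K).
have gK : 0 < (1 - gamma) * K by rewrite mulr_gt0.
have Tr0 : 0 <= Tr by rewrite divr_ge0 ?powR_ge0// ltW.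
have ci : 0 < c^-1 by rewrite invr_gt0.
have TE : T = c^-1 + Num.max Th (c^-1 + Tr) by [].
have T0 : 0 < T by rewrite TE ltr_wpDr// le_max (ltW Th0).
have TTh : Th <= T.
  by rewrite TE (@le_trans _ _ (Num.max Th (c^-1 + Tr)))// ?le_max ?lexx// lerDr ltW.
have TTr : Tr <= T.
  rewrite TE (@le_trans _ _ (Num.max Th (c^-1 + Tr)))//; last by rewrite lerDr ltW.
  by rewrite le_max lerDr (ltW ci) orbT.
have Qsub : Q `<=` `]- Cbar, Cbar[ `*` `]0, +oo[.
  move=> [v t] [] /=; rewrite !in_itv/= !andbT => /andP[h1 h2] h3; split=> //.
  by rewrite /= (le_lt_trans _ h1) ?lerN2//= (lt_le_trans h2).
have fineE f : (Loo2 Q f < +oo)%E -> 0 <= fine (Loo2 Q f) /\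
    (Loo2 Q f <= (fine (Loo2 Q f))%:E)%E.
  move=> foo; have L0 : (0 <= Loo2 Q f)%E by exact: Lnorm_ge0.
  by rewrite fine_ge0// fineK// ge0_fin_numE.
have [Wh0 Wh1 Wh2] := Wh.
have [H00 hH] := fineE _ (Loo2_sub Qsub Wh0).
have [D10 hD1] := fineE _ (Loo2_sub Qsub Wh1).
have [D20 hD2] := fineE _ (Loo2_sub Qsub Wh2).
rewrite -/D1 in D10 hD1; rewrite -/D2 in D20 hD2.
have [ch _ _] := C1h.
have hB (w t : R) : `|w| <= C1 -> 0 <= t -> `|h (w, t)| <= C1'.
  move=> wC t0; rewrite /C1' le_max.
  by rewrite (strip_bound C10 C1Cb ch (fun z _ => erefl) H00 hH wC t0) orbT.
have hL := strip_lip C10 C1Cb D10 D20 C1h hD1 hD2.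
have M2le : [/\ C0norm rect (d1 mu) <= M2, C0norm rect (d2 mu) <= M2,
    C0norm rect (d1 lam) <= M2 & C0norm rect (d2 lam) <= M2].
  have max4 (p q r s : R) : [/\ p <= Num.max (Num.max p q) (Num.max r s),
      q <= Num.max (Num.max p q) (Num.max r s), r <= Num.max (Num.max p q) (Num.max r s) &
      s <= Num.max (Num.max p q) (Num.max r s)] by rewrite !le_max !lexx ?orbT.
  exact: max4.
have [m1 m2 m3 m4] := M2le.
have C2C3 : C2 <= C3 by rewrite /C3 le_max lexx orbT.
have C30 : 0 < C3 := lt_le_trans C20 C2C3.
have C2C3' : C2 <= C3'.
  rewrite /C3' -[C2 in leLHS]mulr1 -mulrA; apply: ler_pM => //; first exact: ltW.
    by rewrite le_max lexx orbT.
  rewrite -[1 in leLHS]mulr1 ler_pM//; first by rewrite le_max lexx.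
  by rewrite -expR0 ler_expR !mulr_ge0 ?(ltW T0) ?(ltW M20) ?(ltW C30).
have C3'0 : 0 < C3' := lt_le_trans C20 C2C3'.
have eE : 2 * T * M2 * C3 = 2 * M2 * C3 * T.
  have H (x y z : R) : 2 * x * y * z = 2 * y * z * x by ring.
  exact: H.
pose G := K * C1 `^ gamma.
(* the hypotheses C3' <= C3 and C3'' <= C3 enter here, as stability of the class *)
have data u0 v0 : admissible h C1 C2 u0 v0 ->
    transport_data lam mu h u0 v0 (friction K gamma (v0 1))
      c T C1' C1 C2 C3 C3' D1 D2 G M1 M2.
  move=> [Lu Lv]; rewrite !ge_max => /andP[su sv] /andP[du dv] u0h.
  have uB := sup01_pointwise (ltW C10) Lu su.
  have vB := sup01_pointwise (ltW C10) Lv sv.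
  have v1B : `|v0 1| <= C1 by apply: vB; rewrite ler01 lexx.
  split => //.
  - exact: ltW.
  - by rewrite mulr_ge0 ?powR_ge0// ltW.
  - exact: ltW.
  - exact: ltW.
  - by rewrite le_max lexx.
  - by move=> z; have [] := cml z.
  - by move=> z; have [] := cml z.
  - move=> u v hu hv; rewrite /M1 !le_max.
    by rewrite !box_C0norm ?orbT//; exact: Csmooth_continuous.
  - exact (box_lip slam m3 m4).
  - exact (box_lip smu m1 m2).
  - exact: (dsup01_lip (ltW C20) Lu du).
  - exact: (dsup01_lip (ltW C20) Lv dv).
  - move=> s t /andP[s0 _] /andP[t0 _].
    rewrite (le_trans (friction_lip K0 g01 _ s0 t0))// ler_wpM2r// ler_wpM2l ?(ltW K0)//.
    by apply: ge0_ler_powR; rewrite ?nnegrE ?(ltW g0) ?(ltW C10).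
  - by move=> t /andP[t0 _]; rewrite (le_trans (friction_le K0 g01 _ t0)).
  - exact: friction0.
  - by rewrite -eE.
  - by rewrite -eE [X in Num.max X]mulrC.
have late u0 v0 : admissible h C1 C2 u0 v0 -> forall t : R, Tr <= t ->
    friction K gamma (v0 1) t = 0.
  move=> ad t tt; have D := data _ _ ad.
  apply: (friction_extinct K0 g01); apply: le_trans tt.
  rewrite ler_pM2r ?invr_gt0//; apply: ge0_ler_powR; rewrite ?nnegrE ?(ltW g1) ?(ltW C10)//.
  by apply: (td_v0B D); rewrite ler01 lexx.
split.
  move=> u0 v0 ad; have D := data _ _ ad.
  have [C [p [bp sp]]] := nonlinear_exists D.
  have pT := nonlinear_extinct D bp sp Tr0 (ltW Th0)
    (fun t ht => late _ _ ad t (andP ht).1) hTh TE.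
  pose u := fun z => p.1 (clamp2 T z); pose v := fun z => p.2 (clamp2 T z).
  have ode := @friction_ode R K gamma g01 (v0 1).
  have zero (t : R) : T <= t -> friction K gamma (v0 1) t = 0 /\ h (0, t) = 0.
    by move=> Tt; split; [apply: late ad _ _; exact: le_trans Tt|apply: hTh; exact: le_trans Tt].
  have sol b (Tb : (T%:E <= b)%E) := fixpoint_is_solution D bp sp ode zero pT T0 Tb.
  have uE z : cyl T%:E z -> u z = p.1 z by move=> hz; rewrite /u clamp2E.
  have vE z : cyl T%:E z -> v z = p.2 z by move=> hz; rewrite /v clamp2E.
  have van : vanishes_from T u v.
    move=> t x Tt x01; rewrite /u /v /clamp2 /= [clamp T t]/clamp min_r// max_r ?(ltW T0)//.
    by apply: pT; apply: clamp_itv; rewrite ler01.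
  have bp' : in_box T C1' C1 C3 C3' (u, v).
    case: bp => b1 b2 b3 b4; split=> /=.
    - by move=> z hz; rewrite uE// b1.
    - by move=> z hz; rewrite vE// b2.
    - by move=> z1 z2 h1 h2; rewrite !uE//; exact: b3.
    - by move=> z1 z2 h1 h2; rewrite !vE//; exact: b4.
  exists u, v; split.
  - by apply/class_D_box => //; exact: ltW.
  - exact: sol.
  - move=> u' v' /class_D_box; move=> /(_ (ltW T0) (ltW C30) (ltW C3'0)) bq sq z hz.
    have [C' sp'] := @solution_is_fixpoint R _ _ _ _ _ _ _ _ _ _ _ _ _ _ _ _ _ _ _ (u', v')
      K0 g01 T0 D bq sq.
    by have [e1 e2] := nonlinear_unique D bq bp sp' sp hz; rewrite uE// vE.
  - by exists u, v; split => //; apply: sol; rewrite leey.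
move=> hst eps eps0.
pose E := Num.max 1 M1 * expR (2 * M2 * C3 * T).
have E1 : 1 <= E.
  rewrite /E -[leLHS]mulr1 ler_pM//; first by rewrite le_max lexx.
  by rewrite -expR0 ler_expR !mulr_ge0 ?(ltW T0) ?(ltW M20) ?(ltW C30).
have [d d0 dE] := small_choice K0 g0 c0 D10 E1 eps0.
exists d => // u0 v0 ad nd U V /class_D_box; move=> /(_ (ltW T0) (ltW C30) (ltW C3'0)) bp sol van.
have D := data _ _ ad; have [Lu Lv _ _ _] := ad.
have [u0B v0B u0L v0L] := Lip01_norm2_le (ltW d0) Lu Lv nd.
have v1 : `|v0 1| <= d by apply: v0B; rewrite ler01 lexx.
have [C sp] := @solution_is_fixpoint R _ _ _ _ _ _ _ _ _ _ _ _ _ _ _ _ _ _ _ (U, V)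
  K0 g01 T0 D bp (is_solution_restrict T sol).
have inC (w : R) : `|w| <= C1 -> - Cbar <= w <= Cbar.
  by move=> wC; rewrite -ler_norml (le_trans wC).
(* h is independent of time, so both values of h may be taken at the same time *)
have hL' (w t w' t' : R) : `|w| <= C1 -> 0 <= t -> `|w'| <= C1 -> 0 <= t' ->
    `|h (w, t) - h (w', t')| <= D1 * `|w - w'|.
  move=> wC t0 wC' t0'; rewrite (hst w' t' t (inC _ wC') t0' t0).
  by have := hL _ _ _ _ wC t0 wC' t0; rewrite subrr normr0 mulr0 addr0; apply.
have h0 (t : R) : 0 <= t -> h (0, t) = 0.
  move=> t0; rewrite (hst 0 t Th) ?hTh ?(ltW Th0)//.
  by apply: inC; rewrite normr0 ltW.
have [UB VB UL VL] := @small_solution R _ _ _ _ _ _ _ _ _ _ _ _ _ _ _ _ _ _ _ d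
  (K * d `^ gamma) (U, V) D bp sp (ltW d0)
  (mulr_ge0 (ltW K0) (powR_ge0 d gamma)) hL' h0 u0B v0B u0L v0L
  (fun t ht => le_trans (friction_le K0 g01 (v0 1) (andP ht).1) v1)
  ltac:(move=> s t /andP[s0 _] /andP[t0 _];
    rewrite (le_trans (friction_lip K0 g01 _ s0 t0))// ler_wpM2r// ler_wpM2l ?(ltW K0)//;
    by apply: ge0_ler_powR; rewrite ?nnegrE ?(ltW g0) ?(ltW d0)).
rewrite -/E /= in UB VB UL VL.
have E0 : 0 <= E := le_trans ler01 E1.
set LV := Num.max (K * d `^ gamma / c) d * E in dE UL VL.
have LV0 : 0 <= LV by rewrite mulr_ge0// le_max (ltW d0) orbT.
have LU0 : 0 <= Num.max (D1 * LV / c) d * E by rewrite mulr_ge0// le_max (ltW d0) orbT.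
have BU0 : 0 <= Num.max d (D1 * d) by rewrite le_max (ltW d0).
apply: (@le_trans _ _ (Num.max d (D1 * d) + Num.max (D1 * LV / c) d * E + (d + LV))%:E);
  last by rewrite lee_fin.
have inT (t x : R) : 0 < t -> t <= T -> 0 <= x <= 1 -> cyl T%:E (t, x).
  by move=> t0 tT x01; split; rewrite //= ?lee_fin ?(ltW t0).
apply: LooLip_norm2_le => //; first exact: ltW.
- move=> t x t0 x01; have [tT|Tt] := leP t T.
    by split; [apply: UB|apply: VB]; exact: inT.
  by have [-> ->] := van _ _ (ltW Tt) x01; rewrite normr0 BU0 (ltW d0).
- move=> t x y t0 x01 y01; have [tT|Tt] := leP t T.
    have := UL _ _ (inT _ _ t0 tT x01) (inT _ _ t0 tT y01).
    have := VL _ _ (inT _ _ t0 tT x01) (inT _ _ t0 tT y01).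
    by rewrite /= !subrr !normr0 !add0r.
  have [-> ->] := van _ _ (ltW Tt) x01; have [-> ->] := van _ _ (ltW Tt) y01.
  by split; rewrite subrr normr0 mulr_ge0.
Qed.
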